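(* Let $n=\dim M>2$. For a Finsler manifold $(M,L)$ define the $\pi$-tensor field (the Weyl curvature tensor) $$W(\overline X,\overline Y)\overline Z:=R^\circ(\overline X,\overline Y)\overline Z+\frac1{n+1}\,\mathfrak U_{\overline X,\overline Y}\Big\{(\stackrel{2}{D^\circ}R_1)(\overline Z,\overline Y)\,\overline X+(\stackrel{2}{D^\circ}R_1)(\overline X,\overline Y)\,\overline Z+(\stackrel{2}{D^\circ}\stackrel{2}{D^\circ}R_1)(\overline Z,\overline X,\overline Y)\,\overline\eta\Big\},$$ where $\mathfrak U_{\overline X,\overline Y}\{A(\overline X,\overline Y)\}:=A(\overline X,\overline Y)-A(\overline Y,\overline X)$. Then $W$ is projectively invariant: if $L\to\widetilde L$ is a projective change, i.e. $\widetilde G=G-2\lambda\,\mathcal C$, then $\widetilde W=W$.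
   Context: $M$ is a real paracompact $C^\infty$ manifold of dimension $n$; $\pi:\mathcal TM\to M$ is the bundle of nonzero tangent vectors; $\pi^{-1}(TM)\to\mathcal TM$ is the pullback of $TM$ by $\pi$. Sections of $\pi^{-1}(TM)$ are called $\pi$-vector fields and written $\overline X$; tensor fields on $\pi^{-1}(TM)$ are called $\pi$-tensor fields (scalar-valued covariant ones: $\pi$-forms). $\overline\eta$ is the $\pi$-vector field $\overline\eta(u)=(u,u)$. There is an exact sequence $0\to\pi^{-1}(TM)\xrightarrow{\gamma}T(\mathcal TM)\xrightarrow{\rho}\pi^{-1}(TM)\to0$, where $\gamma$ is the vertical lift $\gamma(u,w)=\frac{d}{dt}\big|_{t=0}(u+tw)$ and $\rho$ sends $X\in T_u(\mathcal TM)$ to $(u,d\pi(X))$. Put $J:=\gamma\circ\rho$ and $\mathcal C:=\gamma\circ\overline\eta$. For a function $f$, $d_Jf(X)=(JX)\cdot f$. For a Finsler manifold $(M,L)$ with $E=\frac12L^2$: the canonical spray $G$ is the vector field with $i_G\,dd_JE=-dE$; the Barthel connection is $\Gamma=[J,G]$, i.e. $\Gamma(X)=[JX,G]-J[X,G]$; $h=\frac12(I+\Gamma)$, $v=\frac12(I-\Gamma)$. The horizontal map $\beta:\pi^{-1}(TM)\to T(\mathcal TM)$ sends $\overline X$ to the unique vector in the image of $h$ with $\rho(\beta\overline X)=\overline X$; $K:T(\mathcal TM)\to\pi^{-1}(TM)$ is determined by $\gamma\circ K=v$. The Berwald connection $D^\circ$ is the linear connection on $\pi^{-1}(TM)$ with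 $D^\circ_{\gamma\overline X}\overline Y=\rho[\gamma\overline X,\beta\overline Y]$ and $D^\circ_{\beta\overline X}\overline Y=K[\beta\overline X,\gamma\overline Y]$. For a $\pi$-tensor field $A$, $(\stackrel{2}{D^\circ}A)(\overline X,\overline Y,\dots):=(D^\circ_{\gamma\overline X}A)(\overline Y,\dots)$, and $\stackrel{2}{D^\circ}\stackrel{2}{D^\circ}A$ means $\stackrel{2}{D^\circ}$ applied to $\stackrel{2}{D^\circ}A$, the outer differentiation direction being the first argument. Curvature: $\mathbf K(X,Y)\overline Z=-D^\circ_XD^\circ_Y\overline Z+D^\circ_YD^\circ_X\overline Z+D^\circ_{[X,Y]}\overline Z$; $R^\circ(\overline X,\overline Y)\overline Z=\mathbf K(\beta\overline X,\beta\overline Y)\overline Z$. Further $R_2(\overline X,\overline Y):=\mathrm{Tr}\{\overline Z\mapsto R^\circ(\overline X,\overline Z)\overline Y\}$ and $R_1(\overline X):=\frac1{n-1}\{nR_2(\overline X,\overline\eta)+R_2(\overline\eta,\overline X)\}$. Projective change: a change $L\to\widetilde L$ of Finsler structures on $M$ whose canonical sprays satisfy $\widetilde G=G-2\lambda\mathcal C$ for a function $\lambda$ on $TM$ (smooth on $\mathcal TM$) positively homogeneous of degree 1 in $y$. Tilded objects are those of $(M,\widetilde L)$. *)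

(* Defs.v *)
From HB Require Import structures.
From mathcomp Require Import all_boot all_order all_algebra.
From mathcomp Require Import all_classical all_reals all_analysis.

Set Implicit Arguments.
Unset Strict Implicit.
Unset Printing Implicit Defensive.

Import Order.TTheory GRing.Theory Num.Theory.
Import numFieldNormedType.Exports.

Local Open Scope classical_set_scope.
Local Open Scope ring_scope.

(* ---------------------------------------------------------------- *)
(** * Smooth maps between (finite-dimensional) normed spaces          *)

Section Smoothness.
Context {R : realType} {V W : normedModType R}.

Fixpoint Ck (k : nat) (O : set V) (F : V -> W) : Prop :=
  if k is k'.+1 then
    (forall a, O a -> differentiable F a) /\ (forall v, Ck k' O ('D_v F))
  else forall a, O a -> {for a, continuous F}.

Definition smooth_at (a : V) (F : V -> W) : Prop :=
  exists O : set V, [/\ open O, O a & forall k, Ck k O F].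

End Smoothness.

(* ---------------------------------------------------------------- *)
(** * Smooth manifolds                                                *)

Record chart (R : realType) (n : nat) (M : topologicalType) := Chart {
  cdom : set M;
  cmap :> M -> 'rV[R]_n;
  cinv : 'rV[R]_n -> M;
  cdom_open : open cdom;
  cimg_open : open (cmap @` cdom);
  cmapK : forall x, cdom x -> cinv (cmap x) = x;
  cmap_cont : forall x, cdom x -> {for x, continuous cmap};
  cinv_cont : forall a, (cmap @` cdom) a -> {for a, continuous cinv} }.

Definition refines (T : Type) (V U : set (set T)) : Prop :=
  forall B, V B -> exists2 A, U A & B `<=` A.

Definition open_cover (T : topologicalType) (U : set (set T)) : Prop :=
  (forall A, U A -> open A) /\ \bigcup_(A in U) A = setT.

Definition locally_finite (T : topologicalType) (U : set (set T)) : Prop :=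
  forall x : T, exists2 N, nbhs x N & finite_set [set A | U A /\ A `&` N !=set0].

Definition paracompact (T : topologicalType) : Prop :=
  hausdorff_space T /\
  forall U : set (set T), open_cover U ->
    exists V, [/\ open_cover V, refines V U & locally_finite V].

(* [chart_at x] selects, once and for all, a chart of the atlas around [x];
   it serves to represent tangent vectors by their components (see below). *)
Record manifold (R : realType) (n : nat) := Manifold {
  carrier :> topologicalType;
  carrier_paracompact : paracompact carrier;
  atlas : set (chart R n carrier);
  chart_at : carrier -> chart R n carrier;
  chart_at_atlas : forall x, atlas (chart_at x);
  chart_at_dom : forall x, cdom (chart_at x) x;
  atlas_compat : forall c d, atlas c -> atlas d ->
    forall x, cdom c x -> cdom d x -> smooth_at (c x) (d \o cinv c) }.

(* ---------------------------------------------------------------- *)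
(** * The tangent bundle and vector fields on it                      *)

(* A tangent vector at [x] is represented by its components in the chart
   [chart_at x]; thus every T_x M is the vector space 'rV_n, the total space TM
   is the set M * 'rV_n, and all smoothness and differentiation statements go
   through the bundle charts [tcoord c] (not through the product structure).
   In the same way, a vector of T_u(TM) is represented by its n + n components
   in the bundle chart [tcoord (chart_at u.1)]. *)

Section TangentBundle.
Context {R : realType} {n : nat} {M : manifold R n}.

Local Notation E := 'rV[R]_n.
Local Notation EE := ('rV[R]_n * 'rV[R]_n)%type.

Definition TM : Type := (M * E)%type.

(* The slit tangent bundle: nonzero tangent vectors. *)
Definition slit (u : TM) : Prop := u.2 != 0.

(* Change of components, from the chart c to the chart d, of a vector of T_x M. *)
Definition tchange (c d : chart R n M) (x : M) (w : E) : E :=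
  'D_w (d \o cinv c) (c x).

Definition tcoord (c : chart R n M) (u : TM) : EE :=
  (c u.1, tchange (chart_at u.1) c u.1 u.2).

Definition tinv (c : chart R n M) (p : EE) : TM :=
  let x := cinv c p.1 in (x, tchange c (chart_at x) x p.2).

Definition vfield : Type := TM -> EE.
Definition pvfield : Type := TM -> E.   (* pi-vector fields *)

(* Local expressions in a chart c of vector fields on TM and of
   pi-vector fields. *)
Definition vf_in (c : chart R n M) (X : vfield) (p : EE) : EE :=
  let u := tinv c p in
  let c0 := chart_at u.1 in
  'D_(X u) (tcoord c \o tinv c0) (tcoord c0 u).

Definition pvf_in (c : chart R n M) (X : pvfield) (p : EE) : E :=
  let u := tinv c p in tchange (chart_at u.1) c u.1 (X u).

(* Smoothness on a neighbourhood of u. *)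
Definition smooth_fun_near (u : TM) (f : TM -> R) : Prop :=
  let c := chart_at u.1 in smooth_at (tcoord c u) (f \o tinv c : EE -> R^o).

Definition smooth_vf_near (u : TM) (X : vfield) : Prop :=
  let c := chart_at u.1 in smooth_at (tcoord c u) (vf_in c X).

Definition smooth_pvf_near (u : TM) (X : pvfield) : Prop :=
  let c := chart_at u.1 in smooth_at (tcoord c u) (pvf_in c X).

(* Smoothness on the slit tangent bundle. *)
Definition smooth_fun (f : TM -> R) : Prop :=
  forall u, slit u -> smooth_fun_near u f.
Definition smooth_vf (X : vfield) : Prop :=
  forall u, slit u -> smooth_vf_near u X.
Definition smooth_pvf (X : pvfield) : Prop :=
  forall u, slit u -> smooth_pvf_near u X.

Definition continuous_on_TM (f : TM -> R) : Prop :=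
  forall u : TM, let c := chart_at u.1 in
    {for tcoord c u, continuous (f \o tinv c : EE -> R^o)}.

Definition homogeneous1 (f : TM -> R) : Prop :=
  forall (u : TM) (t : R), 0 < t -> f (u.1, t *: u.2) = t * f u.

(* X . f *)
Definition der (X : vfield) (f : TM -> R) : TM -> R := fun u =>
  let c := chart_at u.1 in 'D_(X u) (f \o tinv c : EE -> R^o) (tcoord c u).

(* Lie bracket, normalised by [X,Y] . f = X . (Y . f) - Y . (X . f). *)
Definition lie (X Y : vfield) : vfield := fun u =>
  let c := chart_at u.1 in let p := tcoord c u in
  'D_(X u) (vf_in c Y) p - 'D_(Y u) (vf_in c X) p.

(* ---------------------------------------------------------------- *)
(** * The pull-back bundle                                            *)

Definition gamma_at (u : TM) (w : E) : EE :=
  'D_1 (fun t : R^o => tcoord (chart_at u.1) (u.1, u.2 + t *: w)) 0.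

Definition rho_at (u : TM) (w : EE) : E :=
  let c := chart_at u.1 in
  'D_w (fun p => c (tinv c p).1) (tcoord c u).

Definition gamma (X : pvfield) : vfield := fun u => gamma_at u (X u).
Definition rho (X : vfield) : pvfield := fun u => rho_at u (X u).
Definition J (X : vfield) : vfield := gamma (rho X).
Definition eta : pvfield := fun u => u.2.
Definition Liouville : vfield := gamma eta.

(* ---------------------------------------------------------------- *)
(** * Finsler structures                                              *)

Definition energy (L : TM -> R) : TM -> R := fun u => 2^-1 * L u ^+ 2.

Definition dJ (f : TM -> R) (X : vfield) : TM -> R := der (J X) f.

(* Exterior differential of a 1-form, without the factor 1/2. *)
Definition ext_d (w : vfield -> TM -> R) (X Y : vfield) : TM -> R := fun u =>
  der X (w Y) u - der Y (w X) u - w (lie X Y) u.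

Definition Omega (L : TM -> R) (X Y : vfield) : TM -> R :=
  ext_d (dJ (energy L)) X Y.

(* Only the maximal rank of dd_J E is required; strongly convex (positive
   definite) Finsler structures are a special case. *)
Record finsler (L : TM -> R) : Prop := Finsler {
  finsler_smooth : smooth_fun L;
  finsler_continuous : continuous_on_TM L;
  finsler_zero : forall x : M, L (x, 0) = 0;
  finsler_pos : forall u, slit u -> 0 < L u;
  finsler_homogeneous : homogeneous1 L;
  finsler_nondegenerate : forall u, slit u ->
    forall X, smooth_vf_near u X ->
      (forall Y, smooth_vf_near u Y -> Omega L X Y u = 0) -> X u = 0 }.

(* i_G dd_J E = - dE *)
Definition canonical_spray (L : TM -> R) (G : vfield) : Prop :=
  smooth_vf G /\
  forall u, slit u -> forall Y, smooth_vf_near u Y ->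
    Omega L G Y u = - der Y (energy L) u.

(* ---------------------------------------------------------------- *)
(** * Barthel and Berwald connections                                 *)

(* All operators below are local: at u they depend on their arguments only
   through the germs of these at u. *)

Definition barthel (G X : vfield) : vfield := fun u =>
  lie (J X) G u - J (lie X G) u.

Definition hproj (G X : vfield) : vfield := fun u =>
  2^-1 *: (X u + barthel G X u).
Definition vproj (G X : vfield) : vfield := fun u =>
  2^-1 *: (X u - barthel G X u).

(* The unique w in the image of h with rho w = X u. *)
Definition beta (G : vfield) (X : pvfield) : vfield := fun u =>
  xget 0 [set w : EE | rho_at u w = X u /\
                       exists2 Y, smooth_vf_near u Y & hproj G Y u = w].

(* Determined by gamma o K = v. *)
Definition Kmap (G : vfield) (X : vfield) : pvfield := fun u =>
  xget 0 [set w : E | gamma_at u w = vproj G X u].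

(* X = gamma (K X) + beta (rho X), hence
   D_X Y = D_(gamma (K X)) Y + D_(beta (rho X)) Y. *)
Definition berwald (G : vfield) (X : vfield) (Y : pvfield) : pvfield := fun u =>
  rho (lie (gamma (Kmap G X)) (beta G Y)) u
  + Kmap G (lie (beta G (rho X)) (gamma Y)) u.

(* ---------------------------------------------------------------- *)
(** * Curvature                                                       *)

Definition curvK (G : vfield) (X Y : vfield) (Z : pvfield) : pvfield := fun u =>
  - berwald G X (berwald G Y Z) u + berwald G Y (berwald G X Z) u
  + berwald G (lie X Y) Z u.

Definition Rcirc (G : vfield) (X Y Z : pvfield) : pvfield :=
  curvK G (beta G X) (beta G Y) Z.

(* The i-th member of the local frame of pi^{-1}(TM) defined by the chart c;
   it is smooth over the domain of c, its values elsewhere are irrelevant. *)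
Definition frame (c : chart R n M) (i : 'I_n) : pvfield := fun u =>
  tchange c (chart_at u.1) u.1 (delta_mx 0 i).

(* Trace at u of a (local, function-linear) endomorphism A of pi-vector
   fields, computed in the local frame of the chart chart_at u.1. *)
Definition trace (A : pvfield -> pvfield) : TM -> R := fun u =>
  \sum_(i < n) A (frame (chart_at u.1) i) u 0 i.

Definition R2 (G : vfield) (X Y : pvfield) : TM -> R :=
  trace (fun Z => Rcirc G X Z Y).

Definition R1 (G : vfield) (X : pvfield) : TM -> R := fun u =>
  (n%:R - 1)^-1 * (n%:R * R2 G X eta u + R2 G eta X u).

(* Vertical Berwald derivative of pi-forms of degrees 1 and 2. *)
Definition D2_1 (G : vfield) (A : pvfield -> TM -> R)
    (X Y : pvfield) : TM -> R := fun u =>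
  der (gamma X) (A Y) u - A (berwald G (gamma X) Y) u.

Definition D2_2 (G : vfield) (A : pvfield -> pvfield -> TM -> R)
    (X Y Z : pvfield) : TM -> R := fun u =>
  der (gamma X) (A Y Z) u
  - A (berwald G (gamma X) Y) Z u - A Y (berwald G (gamma X) Z) u.

Definition alt (A : pvfield -> pvfield -> pvfield) (X Y : pvfield) : pvfield :=
  fun u => A X Y u - A Y X u.

(* The Weyl curvature tensor W(X,Y)Z, expressed through the canonical spray. *)
Definition weyl (G : vfield) (X Y Z : pvfield) : pvfield := fun u =>
  Rcirc G X Y Z u +
  (n%:R + 1)^-1 *:
    alt (fun X Y u => D2_1 G (R1 G) Z Y u *: X u
                      + D2_1 G (R1 G) X Y u *: Z u
                      + D2_2 G (D2_1 G (R1 G)) Z X Y u *: eta u) X Y u.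

(* G' = G - 2 lambda C on the slit tangent bundle. *)
Definition projectively_related (G G' : vfield) : Prop :=
  exists lambda : TM -> R,
    [/\ smooth_fun lambda, homogeneous1 lambda &
        forall u, slit u -> G' u = G u - (2 * lambda u) *: Liouville u].

End TangentBundle.

Arguments TM {R n} M.
Arguments vfield {R n} M.
Arguments pvfield {R n} M.

(* Main.v *)
(* In a bundle chart a spray is [G = (y, g)] with [g] homogeneous of degree 2
   in [y]. Put [N_a = - 1/2 d_a g] ([d_a] the derivative in the direction [a] of
   the fibre), let [delta_a] be the derivative along [(a, - N_a)], and put
   [H(a, b) = delta_a N_b - delta_b N_a]; then [R(a, b) c = - d_c H(a, b)].
   Under [g' = g - 2 lambda y], Euler's relations give
     [H'(a, b) = H(a, b) + (d_b xi_a - d_a xi_b) y + xi_a b - xi_b a],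
   where [xi_a = delta_a lambda - lambda d_a lambda] is homogeneous of degree 1.
   Taking traces, [R_1' = R_1 - (n + 1) xi], and the two corrections cancel in W.
   The operators of the theory have their usual coordinate expressions in every
   chart by the chain rule and the symmetry of second derivatives. That the
   canonical spray has the form above follows from the nondegeneracy of dd_J E,
   applied to the difference of two vertical vectors. *)
From HB Require Import structures.
Require Import Defs.
From mathcomp Require Import all_boot all_order all_algebra.
From mathcomp Require Import all_classical all_reals all_analysis.
From mathcomp Require Import ring lra.

Set Implicit Arguments.
Unset Strict Implicit.
Unset Printing Implicit Defensive.

Import Order.TTheory GRing.Theory Num.Theory.
Import numFieldNormedType.Exports.

Local Open Scope classical_set_scope.
Local Open Scope ring_scope.

(** * Smooth maps and symmetry of second derivatives *)

Section Differentials.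
Context {R : realType}.

(** The operators are defined point by point through the chart [chart_at u.1], an arbitrary
    selection with no continuity in [u], and their arguments are arbitrary smooth fields. Two
    reductions remove both difficulties. Every operator has the same expression in all charts around
    a point, so a neighbourhood can be read in one fixed chart. The tensors involved depend on their
    arguments only through the values at the point, so in that chart they are families of functions
    linear in constant vectors, and the two sprays are compared on constant vectors only. Comparing
    [H] rather than the curvature itself avoids the terms quadratic in the connection coefficients:
    these reappear by themselves when [H] is differentiated along the fibre. The weights in [R_1]
    come from the trace of [H(a, .)], which changes by [n xi_a - d_a xi_y] with [y] frozen under
    [d_a]: the combination of the two orders of arguments removes the second term. *)

Lemma near_eq_differentiable (V W : normedModType R) (f g : V -> W) (a : V) :
  (\forall x \near a, f x = g x) -> differentiable f a -> differentiable g a.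
Proof.
move=> fg df.
have fga := nbhs_singleton fg.
have fg0 : \forall h \near (0 : V), f (h + a) = g (h + a).
  by move: fg; rewrite (near_shift (0 : V)) /= subr0.
have h0 : g \o shift a = cst (g a) + 'd f a +o_ 0 id.
  have /diff_locally/eqaddoP fo := df.
  apply/eqaddoP => e e0; have := fo _ e0; move=> H; near=> x.
  have fgx : f (x + a) = g (x + a) by near: x.
  rewrite !fctE /= -fgx -fga.
  by near: x.
have E := diff_unique (diff_continuous df) h0.
by apply/diff_locallyP; rewrite E; split=> //; exact: diff_continuous.
Unshelve. all: by end_near. Qed.

Lemma derive_dirP (V W : normedModType R) (f : V -> W) (p : V) (a : R) (v w : V) :
  differentiable f p -> 'D_(a *: v + w) f p = a *: 'D_v f p + 'D_w f p.
Proof. by move=> df; rewrite !deriveE // linearP. Qed.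

Lemma derive_dirD (V W : normedModType R) (f : V -> W) (p : V) (v w : V) :
  differentiable f p -> 'D_(v + w) f p = 'D_v f p + 'D_w f p.
Proof. by move=> df; rewrite !deriveE // linearD. Qed.

Lemma derive_dirB (V W : normedModType R) (f : V -> W) (p : V) (v w : V) :
  differentiable f p -> 'D_(v - w) f p = 'D_v f p - 'D_w f p.
Proof. by move=> df; rewrite !deriveE // linearB. Qed.

Lemma derive_dirN (V W : normedModType R) (f : V -> W) (p : V) (v : V) :
  differentiable f p -> 'D_(- v) f p = - 'D_v f p.
Proof. by move=> df; rewrite !deriveE // linearN. Qed.

Lemma derive_dirZ (V W : normedModType R) (f : V -> W) (p : V) (a : R) (v : V) :
  differentiable f p -> 'D_(a *: v) f p = a *: 'D_v f p.
Proof. by move=> df; rewrite !deriveE // linearZ. Qed.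

Lemma derive_dir_sum (V W : normedModType R) (f : V -> W) (p : V) (I : finType)
    (v : I -> V) :
  differentiable f p -> 'D_(\sum_i v i) f p = \sum_i 'D_(v i) f p.
Proof.
by move=> df; rewrite deriveE // linear_sum; under eq_bigr do rewrite -deriveE //.
Qed.

Lemma derive_chain (U V W : normedModType R) (g : U -> V) (f : V -> W) (p v : U) :
  differentiable g p -> differentiable f (g p) ->
  'D_v (f \o g) p = 'D_('D_v g p) f (g p).
Proof.
move=> dg df; rewrite !deriveE //; last exact: differentiable_comp.
by rewrite diff_comp.
Qed.

Section ContinuousLinear.
Context {V W : normedModType R} (L : V -> W).
Hypotheses (Llin : linear L) (Lcont : continuous L).

HB.instance Definition _ := GRing.isLinear.Build R V W _ L Llin.

Lemma clin_differentiable p : differentiable L p.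
Proof. exact: linear_differentiable. Qed.

Lemma clin_derive v p : 'D_v L p = L v.
Proof. by rewrite deriveE; [rewrite diff_lin | exact: clin_differentiable]. Qed.

Lemma clin_derive_comp (U : normedModType R) (f : U -> V) v p :
  differentiable f p -> 'D_v (L \o f) p = L ('D_v f p).
Proof. by move=> df; rewrite derive_chain ?clin_derive //; exact: clin_differentiable. Qed.

End ContinuousLinear.

Lemma derive_pair (U V W : normedModType R) (f : U -> V) (g : U -> W) v p :
  differentiable f p -> differentiable g p ->
  'D_v (fun q => (f q, g q)) p = ('D_v f p, 'D_v g p).
Proof.
move=> df dg; rewrite !deriveE // ?diff_pair //.
exact: differentiable_pair.
Qed.

(** Scalar multiplication is packaged as a bilinear map, so that the general differential of
    bilinear maps yields the product rule for a scalar function times a vector function. *)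
Definition scalev (W : normedModType R) (a : R^o) (w : W) : W := a *: w.

Lemma scalev_bilinear (W : normedModType R) :
  bilinear_for (GRing.Scale.Law.clone _ _ *:%R _) (GRing.Scale.Law.clone _ _ *:%R _)
    (@scalev W).
Proof.
by split=> [v a u w|v a u w]; rewrite /scalev /= ?scalerDl ?scalerDr !scalerA // mulrC.
Qed.
HB.instance Definition _ (W : normedModType R) :=
  bilinear_isBilinear.Build R R^o W W _ _ (@scalev W) (@scalev_bilinear W).

Lemma is_diff_scalev (V W : normedModType R) (a : V -> R^o) (f : V -> W) p :
  differentiable a p -> differentiable f p ->
  is_diff p (fun q => a q *: f q) (fun v => a p *: 'd f p v + 'd a p v *: f p).
Proof.
move=> da df.
have sc : continuous (fun q : R^o * W => scalev q.1 q.2) by move=> q; exact: scale_continuous.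
have ds q : is_diff q (fun q : R^o * W => scalev q.1 q.2)
    (fun r => scalev q.1 r.2 + scalev r.1 q.2).
  by apply: DiffDef; [exact: differentiable_bilin | rewrite diff_bilin].
have dp : is_diff p (fun q => (a q, f q)) (fun v => ('d a p v, 'd f p v)).
  by apply: DiffDef; [exact: differentiable_pair | rewrite diff_pair].
exact: (is_diff_comp dp (ds _)).
Qed.

Lemma differentiable_scalev (V W : normedModType R) (a : V -> R^o) (f : V -> W) p :
  differentiable a p -> differentiable f p -> differentiable (fun q => a q *: f q) p.
Proof. by move=> da df; have [] := is_diff_scalev da df. Qed.

Lemma derive_scalev (V W : normedModType R) (a : V -> R^o) (f : V -> W) v p :
  differentiable a p -> differentiable f p ->
  'D_v (fun q => a q *: f q) p = 'D_v a p *: f p + a p *: 'D_v f p.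
Proof.
move=> da df; have [ds E] := is_diff_scalev da df.
by rewrite !deriveE // E addrC.
Qed.

Lemma open_near (V : topologicalType) (O : set V) (P : V -> Prop) a :
  open O -> O a -> (forall x, O x -> P x) -> \forall x \near a, P x.
Proof. by move=> oO Oa OP; apply: filterS OP _; exact: open_nbhs_nbhs. Qed.

(** A finite spanning family with continuous linear coefficient functionals. [Ck] differentiates in
    constant directions only; the expansion along [b] rewrites a derivative in a direction varying
    from point to point as a finite sum of derivatives in constant ones. *)
Definition findim (V : normedModType R) : Prop :=
  exists (I : finType) (b : I -> V) (co : I -> V -> R^o),
    (forall i, linear (co i) /\ continuous (co i)) /\
    forall v, v = \sum_i co i v *: b i.

(** * Maps of class C^k on an open set: sums, products, composition *)

Section Ck.
Context {V W : normedModType R}.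
Variable (O : set V).
Hypothesis (oO : open O).

Lemma Ck_ext k (f g : V -> W) : (forall a, O a -> f a = g a) -> Ck k O f -> Ck k O g.
Proof.
elim: k f g => [|k IH] f g fg /=.
  move=> fc a Oa; rewrite /prop_for /= /continuous_at -(fg _ Oa).
  apply: cvg_trans (fc _ Oa); apply: near_eq_cvg.
  exact: open_near oO Oa fg.
case=> fd fD; split.
  move=> a Oa; apply: near_eq_differentiable (fd _ Oa).
  exact: open_near oO Oa fg.
move=> v; apply: IH (fD v) => a Oa; apply: near_eq_derive.
exact: open_near oO Oa fg.
Qed.

Lemma Ck_lower k (f : V -> W) : Ck k.+1 O f -> Ck k O f.
Proof.
elim: k f => [|k IH] f [fd fD].
  by move=> a Oa; exact/differentiable_continuous/fd.
by split=> // v; apply: IH; exact: fD.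
Qed.

Lemma Ck_sub (O' : set V) k (f : V -> W) : O' `<=` O -> Ck k O f -> Ck k O' f.
Proof.
move=> sO; elim: k f => [|k IH] f /=; first by move=> fc a /sO; exact: fc.
by case=> fd fD; split=> [a /sO|v]; [exact: fd | exact/IH/fD].
Qed.

Lemma Ck_cst k (w : W) : Ck k O (cst w).
Proof.
elim: k w => [|k IH] w /=; first by move=> a _; exact: cst_continuous.
split=> [a _|v]; first exact: differentiable_cst.
by apply: Ck_ext (IH 0) => a _; rewrite derive_cst.
Qed.

Lemma CkD k (f g : V -> W) : Ck k O f -> Ck k O g -> Ck k O (fun q => f q + g q).
Proof.
elim: k f g => [|k IH] f g /=.
  by move=> fc gc a Oa; apply: cvgD; [exact: fc | exact: gc].
move=> [fd fD] [gd gD]; split=> [a Oa|v].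
  by apply: differentiableD; [exact: fd | exact: gd].
apply: Ck_ext (IH _ _ (fD v) (gD v)) => a Oa.
by rewrite deriveD //; apply: diff_derivable; [exact: fd | exact: gd].
Qed.

End Ck.

Section Ck_scale.
Context {V W : normedModType R}.
Variable (O : set V).
Hypothesis (oO : open O).

Lemma Ck_scale k (c : V -> R^o) (f : V -> W) :
  Ck k O c -> Ck k O f -> Ck k O (fun q => c q *: f q).
Proof.
elim: k c f => [|k IH] c f; first by move=> fc gc a Oa; apply: cvgZ; [exact: fc | exact: gc].
move=> ck fk; have [cd cD] := ck; have [fd fD] := fk; split=> [a Oa|v].
  by apply: differentiable_scalev; [exact: cd | exact: fd].
apply: (@Ck_ext _ _ _ oO _ (fun q => 'D_v c q *: f q + c q *: 'D_v f q)) => [a Oa|].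
  by rewrite derive_scalev; [|exact: cd|exact: fd].
by apply: CkD => //; apply: IH; do ?exact: cD; do ?exact: fD; exact: Ck_lower.
Qed.

End Ck_scale.

Section Ck_sum.
Context {V W : normedModType R}.
Variable (O : set V).
Hypothesis (oO : open O).

Lemma Ck_sum k (I : finType) (f : I -> V -> W) :
  (forall i, Ck k O (f i)) -> Ck k O (fun q => \sum_i f i q).
Proof.
move=> fk; have : Ck k O (fun q => \sum_(i <- enum I) f i q); last first.
  by apply: Ck_ext => // a Oa; rewrite big_enum.
elim: (enum I) => [|i s IH].
  by apply: Ck_ext (@Ck_cst _ _ _ oO k 0) => // a Oa; rewrite big_nil.
by apply: (Ck_ext oO _ (CkD oO (fk i) IH)) => a Oa; rewrite big_cons.
Qed.

End Ck_sum.

Lemma Ck_lin (V W W' : normedModType R) (O : set V) (L : W -> W') k (f : V -> W) :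
  open O -> linear L -> continuous L -> Ck k O f -> Ck k O (fun q => L (f q)).
Proof.
move=> oO Ll Lc; elim: k f => [|k IH] f /=.
  by move=> fc a Oa; apply: continuous_comp; [exact: fc | exact: Lc].
move=> [fd fD]; split=> [a Oa|v].
  by apply: (@differentiable_comp _ _ _ _ f L); [exact: fd | exact: clin_differentiable].
apply: Ck_ext (IH _ (fD v)) => // a Oa.
by rewrite -(clin_derive_comp Ll Lc) //; exact: fd.
Qed.

Lemma derive_findim (V W : normedModType R) (f : V -> W) p (I : finType) (b : I -> V)
   (co : I -> V -> R^o) v : v = \sum_i co i v *: b i ->
  differentiable f p -> 'D_v f p = \sum_i co i v *: 'D_(b i) f p.
Proof.
move=> vE df; rewrite {1}vE derive_dir_sum //.
by apply: eq_bigr => i _; rewrite derive_dirZ.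
Qed.

Lemma Ck_comp (U V W : normedModType R) (O : set U) (O' : set V) k
    (g : U -> V) (f : V -> W) : findim V -> open O -> (forall a, O a -> O' (g a)) ->
  Ck k O g -> Ck k O' f -> Ck k O (f \o g).
Proof.
move=> [I [b [co [col vE]]]] oO gO; elim: k f => [|k IH] f.
  move=> gc fc a Oa; apply: continuous_comp; first exact: gc.
  exact/fc/gO.
move=> gk fk; have [gd gD] := gk; have [fd fD] := fk; split=> [a Oa|v].
  by apply: differentiable_comp; [exact: gd | exact/fd/gO].
apply: (@Ck_ext _ _ _ oO _ (fun q => \sum_i (co i ('D_v g q)) *: ('D_(b i) f \o g) q)).
  move=> a Oa; rewrite derive_chain; [|exact: gd|exact/fd/gO].
  by rewrite (derive_findim (vE _)) //; exact/fd/gO.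
apply: Ck_sum => // i; apply: Ck_scale => //.
  by have [? ?] := col i; apply: Ck_lin => //; exact: gD.
by apply: IH; [exact: Ck_lower | exact: fD].
Qed.

Lemma findim_rV n : findim 'rV[R]_n.
Proof.
exists 'I_n, (fun i => delta_mx 0 i), (fun i (v : 'rV_n) => v 0 i); split=> [i|v].
  by split=> [a u v|]; [rewrite !mxE | exact: coord_continuous].
exact: row_sum_delta.
Qed.

Lemma findim_regular : findim R^o.
Proof.
exists unit, (fun=> 1), (fun _ v => v); split=> [_|v]; last first.
  by rewrite (big_pred1 tt) /= ?[_ *: _]mulr1 // => -[].
by split=> [a u v|x] //; exact: cvg_id.
Qed.

Lemma findim_prod (V W : normedModType R) : findim V -> findim W -> findim (V * W)%type.
Proof.
move=> [I [b [co [col vE]]]] [I' [b' [co' [col' vE']]]].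
exists (I + I')%type, (fun i => match i with inl i => (b i, 0) | inr j => (0, b' j) end),
  (fun i p => match i with inl i => co i p.1 | inr j => co' j p.2 end); split.
  case=> i; [have [cl cc] := col i | have [cl cc] := col' i].
    by split=> [a u v|p]; [exact: cl | apply: continuous_comp; [exact: cvg_fst | exact: cc]].
  by split=> [a u v|p]; [exact: cl | apply: continuous_comp; [exact: cvg_snd | exact: cc]].
move=> [v w]; rewrite big_sumType /= {1}(vE v) {1}(vE' w).
have -> : \sum_i co i v *: (b i, 0 : W) = (\sum_i co i v *: b i, 0).
  rewrite (_ : (_, 0) = \sum_i (co i v *: b i, 0 : W)).
    by apply: eq_bigr => i _; rewrite -[LHS]/(_ *: b i, _ *: 0) scaler0.
  elim/big_rec2: _ => // i x y _ <-.
  by rewrite -[RHS]/(_ + _, _ + _) addr0.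
have -> : \sum_i co' i w *: (0 : V, b' i) = (0, \sum_i co' i w *: b' i).
  rewrite (_ : (0, _) = \sum_i (0 : V, co' i w *: b' i)).
    by apply: eq_bigr => i _; rewrite -[LHS]/(_ *: 0, _ *: b' i) scaler0.
  elim/big_rec2: _ => // i x y _ <-.
  by rewrite -[RHS]/(_ + _, _ + _) addr0.
by rewrite -[RHS]/(_ + _, _ + _) addr0 add0r.
Qed.

(** * Symmetry of second derivatives through second differences *)

Lemma is_derive_line (V W : normedModType R) (f : V -> W) (p v : V) (s : R) :
  differentiable f (p + s *: v) ->
  is_derive s (1 : R) (fun t => f (p + t *: v)) ('D_v f (p + s *: v)).
Proof.
move=> df.
have E : (fun h : R => h^-1 *: (f (p + (h *: (1 : R) + s) *: v) - f (p + s *: v)))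
    = (fun h : R => h^-1 *: (f (h *: v + (p + s *: v)) - f (p + s *: v))).
  by apply/funext => h; rewrite [_ *: 1]mulr1 scalerDl addrCA.
apply: DeriveDef; last by rewrite /derive /= E.
by have := diff_derivable (v := v) df; rewrite /derivable /= E.
Qed.

Lemma MVT_from0 (phi dphi : R -> R) (h : R) : 0 < h ->
  (forall s : R, 0 <= s <= h -> is_derive s (1 : R) phi (dphi s)) ->
  exists2 s : R, 0 <= s <= h & phi h - phi 0 = dphi s * h.
Proof.
move=> h0 dphiP.
have [s sI E] : exists2 s, s \in `[0, h]%R & phi h - phi 0 = dphi s * (h - 0).
  apply: MVT_segment; first exact: ltW.
    by move=> x /itvP xI; apply: dphiP; rewrite !xI.
  apply: derivable_within_continuous => x /itvP xI.
  by have [] := dphiP x _; rewrite ?xI.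
by exists s; [move: sI; rewrite in_itv | rewrite E subr0].
Qed.

(** The mean value theorem is used twice: along [v] for the difference of two parallel restrictions
    of [f], whose derivative is a difference of values of ['D_v f], and along [w] for ['D_v f]. *)
Lemma second_difference_MVT (V : normedModType R) (f : V -> R) (a v w : V) (h : R) :
  0 < h ->
  (forall s t : R, 0 <= s <= h -> 0 <= t <= h ->
     differentiable f (a + s *: v + t *: w) /\
     differentiable ('D_v f) (a + s *: v + t *: w)) ->
  exists s t : R, [/\ 0 <= s <= h, 0 <= t <= h &
    f (a + h *: v + h *: w) - f (a + h *: v) - (f (a + h *: w) - f a)
    = 'D_w ('D_v f) (a + s *: v + t *: w) * h * h].
Proof.
move=> h0 df.
have hh : 0 <= h <= h by rewrite lexx ltW.
have h00 : (0 : R) <= 0 <= h by rewrite !lexx ltW.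
pose phi (s : R) : R := f (a + h *: w + s *: v) - f (a + s *: v).
pose dphi (s : R) : R := 'D_v f (a + h *: w + s *: v) - 'D_v f (a + s *: v).
have dphiP (s : R) : 0 <= s <= h -> is_derive s (1 : R) phi (dphi s).
  move=> sh; apply: is_deriveB; apply: is_derive_line.
    by rewrite addrAC; have [] := df s h sh hh.
  by have [] := df s 0 sh h00; rewrite scale0r addr0.
have [s sh Es] := MVT_from0 h0 dphiP.
pose psi (t : R) : R := 'D_v f (a + s *: v + t *: w).
pose dpsi (t : R) : R := 'D_w ('D_v f) (a + s *: v + t *: w).
have dpsiP (t : R) : 0 <= t <= h -> is_derive t (1 : R) psi (dpsi t).
  by move=> th; apply: is_derive_line; have [] := df s t sh th.
have [t th Et] := MVT_from0 h0 dpsiP.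
exists s, t; split=> //; rewrite -/(dpsi t) -Et.
have -> : psi h - psi 0 = dphi s.
  by rewrite /psi /dphi scale0r addr0 [a + h *: w + _]addrAC.
by rewrite -Es /phi !scale0r !addr0 [a + h *: v + _]addrAC.
Qed.

(** The second difference of [f] over the parallelogram spanned by [h v] and [h w] is symmetric in
    [v] and [w]. Up to the factor [h^2] it equals each mixed derivative at some point of the
    parallelogram, and by continuity these values are close to those at [a]. *)
Lemma derive_comm_scalar (V : normedModType R) (O : set V) (f : V -> R^o) a v w :
  open O -> O a -> Ck 2 O f -> 'D_v ('D_w f) a = 'D_w ('D_v f) a.
Proof.
move=> oO Oa [fd fD].
have cA : {for a, continuous ('D_w ('D_v f))} by have [_ H] := fD v; exact: H.
have cB : {for a, continuous ('D_v ('D_w f))} by have [_ H] := fD w; exact: H.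
apply/eqP; rewrite -subr_eq0 -normr_le0; apply/ler_addgt0Pl => e e0; rewrite addr0.
have e20 : 0 < e / 2 by rewrite divr_gt0.
have /cvgrPdist_lt/(_ _ e20) nA := cA.
have /cvgrPdist_lt/(_ _ e20) nB := cB.
have nO : nbhs a O by exact: open_nbhs_nbhs.
have [d /= d0 dP] := (nbhs_normP _ _).1 (filterI nO (filterI nA nB)).
(* This choice keeps the whole parallelogram inside the ball of radius [d]; the summand 1 keeps the
   denominator positive when [v] and [w] are zero. *)
pose h := d / (`|v| + `|w| + 1).
have vw0 : 0 < `|v| + `|w| + 1 by rewrite ltr_wpDl // addr_ge0.
have h0 : 0 < h by rewrite divr_gt0.
have inP (s t : R) : 0 <= s <= h -> 0 <= t <= h -> O (a + s *: v + t *: w) /\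
     `|'D_w ('D_v f) a - 'D_w ('D_v f) (a + s *: v + t *: w)| < e / 2 /\
     `|'D_v ('D_w f) a - 'D_v ('D_w f) (a + s *: v + t *: w)| < e / 2.
  move=> /andP[s0 sh] /andP[t0 th]; apply: dP => /=.
  rewrite /ball_ -addrA opprD addrA subrr sub0r normrN.
  apply: (le_lt_trans (ler_normD _ _)); rewrite !normrZ !ger0_norm //.
  apply: (@le_lt_trans _ _ (h * (`|v| + `|w|))).
    by rewrite mulrDr lerD // ler_wpM2r.
  by rewrite /h mulrAC ltr_pdivrMr // ltr_pM2l // ltrDl.
have [s [t [sh th E1]]] : exists s t : R, [/\ 0 <= s <= h, 0 <= t <= h &
    f (a + h *: v + h *: w) - f (a + h *: v) - (f (a + h *: w) - f a)
    = 'D_w ('D_v f) (a + s *: v + t *: w) * h * h].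
  apply: second_difference_MVT => // s t sh th; have [Ost _] := inP s t sh th.
  by split; [exact: fd | have [H _] := fD v; exact: H].
have [t' [s' [th' sh' E2]]] : exists s t : R, [/\ 0 <= s <= h, 0 <= t <= h &
    f (a + h *: w + h *: v) - f (a + h *: w) - (f (a + h *: v) - f a)
    = 'D_v ('D_w f) (a + s *: w + t *: v) * h * h].
  apply: second_difference_MVT => // s2 t2 sh2 th2; have [Ost _] := inP t2 s2 th2 sh2.
  by rewrite addrAC; split; [exact: fd | have [H _] := fD w; exact: H].
have EE : 'D_w ('D_v f) (a + s *: v + t *: w) = 'D_v ('D_w f) (a + s' *: v + t' *: w).
  apply: (mulIf (lt0r_neq0 h0)); apply: (mulIf (lt0r_neq0 h0)).
  rewrite [a + s' *: v + _]addrAC; apply: (etrans (esym E1)); apply: etrans E2.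
  have aux (x y z t0 : R) : x - y - (z - t0) = x - z - (y - t0).
    by rewrite !opprB addrACA [RHS]addrACA [- y - z]addrC.
  by rewrite [a + h *: w + h *: v]addrAC; exact: aux.
have [_ [H1 _]] := inP s t sh th.
have [_ [_ H2]] := inP s' t' sh' th'.
rewrite EE in H1.
have aux (x y z : R) : `|y - z| < e / 2 -> `|x - z| < e / 2 -> `|x - y| <= e.
  rewrite (distrC y) => yz xz; apply/ltW; rewrite (splitr e) -(subrKA z).
  by apply: le_lt_trans (ler_normD _ _) _; exact: ltrD.
exact: aux H1 H2.
Qed.

Lemma derive_comm_Ck (V W : normedModType R) (O : set V) (f : V -> W) a v w :
  findim W -> open O -> O a -> Ck 2 O f -> 'D_v ('D_w f) a = 'D_w ('D_v f) a.
Proof.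
move=> [I [b [co [col vE]]]] oO Oa fk; have [fd fD] := fk.
apply: (etrans (vE _)); apply: (etrans _ (esym (vE _))); apply: eq_bigr => i _; apply: (congr1 (fun c : R => c *: b i)).
have [cl cc] := col i.
have E x y : co i ('D_x ('D_y f) a) = 'D_x ('D_y (co i \o f)) a.
  rewrite -(clin_derive_comp cl cc); last by have [H _] := fD y; exact: H.
  apply: near_eq_derive; apply: open_near oO Oa _ => q Oq /=.
  by rewrite -(clin_derive_comp cl cc) //; exact: fd.
apply: (etrans (E _ _)); apply: (etrans _ (esym (E _ _))).
by apply: (derive_comm_scalar v w oO Oa); exact: Ck_lin.
Qed.

(** * Germs of smooth maps *)

Lemma nbhs_open (T : topologicalType) (p : T) (A : set T) :
  nbhs p A -> exists B, open_nbhs p B /\ B `<=` A.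
Proof. by rewrite nbhsE => -[B ? ?]; exists B. Qed.

Section SmoothAt.
Context {V W : normedModType R}.
Implicit Types (f g : V -> W) (p : V).

Lemma smooth_at_near_eq p f g :
  (\forall q \near p, f q = g q) -> smooth_at p f -> smooth_at p g.
Proof.
move=> fg [A [oO Op fO]].
have [B [[oB Bp] Bfg]] := nbhs_open fg.
exists (A `&` B); split=> [||k]; first exact: openI.
  by split.
apply: (@Ck_ext _ _ _ (openI oO oB) _ f) => [a [_ /Bfg] //|].
apply: Ck_sub (fO k); by move=> a [].
Qed.

Lemma smooth_at_near p f : smooth_at p f -> \forall q \near p, smooth_at q f.
Proof.
by move=> [A [oO Op fO]]; apply: (open_near oO Op) => q Oq; exists A; split.
Qed.

Lemma smooth_at_differentiable p f : smooth_at p f -> differentiable f p.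
Proof. by move=> [A [oO Op fO]]; have [fd _] := fO 1%N; exact: fd. Qed.

Lemma smooth_at_near_differentiable p f :
  smooth_at p f -> \forall q \near p, differentiable f q.
Proof. by move=> /smooth_at_near; apply: filterS => q /smooth_at_differentiable. Qed.

Lemma smooth_at_derive p f v : smooth_at p f -> smooth_at p ('D_v f).
Proof.
by move=> [A [oO Op fO]]; exists A; split=> // k; have [_ H] := fO k.+1; exact: H.
Qed.

Lemma smooth_at_cst p (w : W) : smooth_at p (fun=> w).
Proof. by exists setT; split=> //; [exact: openT | move=> k; exact/Ck_cst/openT]. Qed.

Lemma smooth_atD p f g : smooth_at p f -> smooth_at p g -> smooth_at p (fun q => f q + g q).
Proof.
move=> [A [oO Op fO]] [B' [oO' Op' gO]]; exists (A `&` B'); split=> [||k].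
- exact: openI.
- by [].
have oI := openI oO oO'.
by apply: CkD => //; [apply: Ck_sub (fO k) | apply: Ck_sub (gO k)] => ? [].
Qed.

End SmoothAt.

Lemma smooth_at_scale (V W : normedModType R) p (c : V -> R^o) (f : V -> W) :
  smooth_at p c -> smooth_at p f -> smooth_at p (fun q => c q *: f q).
Proof.
move=> [A [oO Op fO]] [B' [oO' Op' gO]]; exists (A `&` B'); split=> [||k].
- exact: openI.
- by [].
have oI := openI oO oO'.
by apply: Ck_scale => //; [apply: Ck_sub (fO k) | apply: Ck_sub (gO k)] => ? [].
Qed.

Lemma smooth_at_lin (V W W' : normedModType R) p (L : W -> W') (f : V -> W) :
  linear L -> continuous L -> smooth_at p f -> smooth_at p (fun q => L (f q)).
Proof.
by move=> Ll Lc [A [oO Op fO]]; exists A; split=> // k; exact: Ck_lin.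
Qed.

Lemma smooth_atZ (V W : normedModType R) p (a : R) (f : V -> W) :
  smooth_at p f -> smooth_at p (fun q => a *: f q).
Proof. exact/smooth_at_scale/smooth_at_cst. Qed.

Lemma smooth_atN (V W : normedModType R) p (f : V -> W) :
  smooth_at p f -> smooth_at p (fun q => - f q).
Proof.
move=> fs; apply: smooth_at_near_eq (smooth_atZ (-1) fs).
by near=> q; rewrite scaleN1r.
Unshelve. all: by end_near. Qed.

Lemma smooth_atB (V W : normedModType R) p (f g : V -> W) :
  smooth_at p f -> smooth_at p g -> smooth_at p (fun q => f q - g q).
Proof. by move=> fs gs; exact/smooth_atD/smooth_atN. Qed.

Lemma smooth_at_sum (V W : normedModType R) p (I : finType) (f : I -> V -> W) :
  (forall i, smooth_at p (f i)) -> smooth_at p (fun q => \sum_i f i q).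
Proof.
move=> fs; have : smooth_at p (fun q => \sum_(i <- enum I) f i q).
  elim: (enum I) => [|i s IH].
    apply: smooth_at_near_eq (smooth_at_cst p 0).
    by near=> q; rewrite big_nil.
  apply: smooth_at_near_eq (smooth_atD (fs i) IH).
  by near=> q; rewrite big_cons.
by apply: smooth_at_near_eq; near=> q; rewrite big_enum.
Unshelve. all: by end_near. Qed.

Lemma smooth_at_pair (U V W : normedModType R) p (f : U -> V) (g : U -> W) :
  smooth_at p f -> smooth_at p g -> smooth_at p (fun q => (f q, g q)).
Proof.
move=> fs gs.
have fl : smooth_at p (fun q => (fun v : V => (v, 0 : W)) (f q)).
  apply: (@smooth_at_lin _ _ _ _ (fun v : V => (v, 0 : W)) f _ _ fs) => [a u v|v].
    by rewrite -[RHS]/(_ + _, _ *: _ + _) scaler0 addr0.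
  by apply: cvg_pair; [exact: cvg_id | exact: cvg_cst].
have gl : smooth_at p (fun q => (fun w : W => (0 : V, w)) (g q)).
  apply: (@smooth_at_lin _ _ _ _ (fun w : W => (0 : V, w)) g _ _ gs) => [a u v|v].
    by rewrite -[RHS]/(_ *: _ + _, _ + _) scaler0 addr0.
  by apply: cvg_pair; [exact: cvg_cst | exact: cvg_id].
apply: smooth_at_near_eq (smooth_atD fl gl).
by near=> q; rewrite -[LHS]/(_ + _, _ + _) addr0 add0r.
Unshelve. all: by end_near. Qed.

Lemma fst_linear (V W : normedModType R) : linear (@fst V W). Proof. by []. Qed.
Lemma snd_linear (V W : normedModType R) : linear (@snd V W). Proof. by []. Qed.
Lemma fst_continuous (V W : normedModType R) : continuous (@fst V W).
Proof. by move=> p; exact: cvg_fst. Qed.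
Lemma snd_continuous (V W : normedModType R) : continuous (@snd V W).
Proof. by move=> p; exact: cvg_snd. Qed.

Lemma smooth_at_fst (U V W : normedModType R) p (f : U -> V * W) :
  smooth_at p f -> smooth_at p (fun q => (f q).1).
Proof. exact: (smooth_at_lin (@fst_linear V W) (@fst_continuous V W)). Qed.
Lemma smooth_at_snd (U V W : normedModType R) p (f : U -> V * W) :
  smooth_at p f -> smooth_at p (fun q => (f q).2).
Proof. exact: (smooth_at_lin (@snd_linear V W) (@snd_continuous V W)). Qed.

Lemma derive_fst (U V W : normedModType R) (f : U -> V * W) p v :
  differentiable f p -> 'D_v (fun q => (f q).1) p = ('D_v f p).1.
Proof. exact: (clin_derive_comp (@fst_linear V W) (@fst_continuous V W)). Qed.
Lemma derive_snd (U V W : normedModType R) (f : U -> V * W) p v :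
  differentiable f p -> 'D_v (fun q => (f q).2) p = ('D_v f p).2.
Proof. exact: (clin_derive_comp (@snd_linear V W) (@snd_continuous V W)). Qed.

Lemma smooth_at_id (V : normedModType R) (p : V) : smooth_at p (@idfun V).
Proof.
exists setT; split=> //; first exact: openT.
case=> [|k]; first by move=> a _; exact: cvg_id.
split=> [a _|v]; first by have [] := is_diff_id a.
apply: (Ck_ext openT _ (Ck_cst openT k v)) => a _.
by rewrite -[RHS]/('D_v id a) derive_id.
Qed.

Lemma smooth_at_comp (U V W : normedModType R) p (g : U -> V) (f : V -> W) :
  findim V -> smooth_at p g -> smooth_at (g p) f -> smooth_at p (f \o g).
Proof.
move=> fV gs [B' [oO' Op' fO]]; have gc := differentiable_continuous (smooth_at_differentiable gs).
have [A [oO Op gO]] := gs.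
have [B [[oB Bp] Bfg]] : exists B, open_nbhs p B /\ B `<=` g @^-1` B'.
  by apply/nbhs_open/gc; exact: open_nbhs_nbhs.
have oI := openI oO oB.
exists (A `&` B); split=> // k.
apply: (Ck_comp fV oI _ _ (fO k)) => [a [_ /Bfg]|] //.
by apply: Ck_sub (gO k) => a [].
Qed.

Lemma derive_comm (V W : normedModType R) p (f : V -> W) v w :
  findim W -> smooth_at p f -> 'D_v ('D_w f) p = 'D_w ('D_v f) p.
Proof. by move=> fW [A [oO Op fO]]; exact: (derive_comm_Ck v w fW oO Op (fO 2)). Qed.

Lemma derive_sum_fin (V W : normedModType R) (I : finType) (f : I -> V -> W) p v :
  (forall i, differentiable (f i) p) ->
  'D_v (fun q => \sum_i f i q) p = \sum_i 'D_v (f i) p.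
Proof.
move=> fd.
have [] : differentiable (fun q => \sum_(i <- enum I) f i q) p /\
    'D_v (fun q => \sum_(i <- enum I) f i q) p = \sum_(i <- enum I) 'D_v (f i) p.
  elim: (enum I) => [|i s [IHd IHv]].
    rewrite (_ : (fun _ => _) = cst 0); last by apply/funext => q; rewrite big_nil.
    by rewrite big_nil derive_cst; split=> //; exact: differentiable_cst.
  rewrite (_ : (fun _ => _) = f i + (fun q => \sum_(j <- s) f j q)); last first.
    by apply/funext => q; rewrite big_cons.
  split; first exact: differentiableD.
  by rewrite big_cons deriveD ?IHv //; exact: diff_derivable.
rewrite (_ : (fun _ => _) = fun q => \sum_i f i q); last first.
  by apply/funext => q; rewrite big_enum.
by move=> _ ->; rewrite big_enum.
Qed.

Lemma derive_affine (V : normedModType R) (v w : V) :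
  'D_1 (fun t : R^o => v + t *: w) 0 = w.
Proof.
have dsc : differentiable (fun t : R^o => t *: w) 0.
  by have [] := is_diff_scalel (0 : R^o) w.
have D := deriveD (derivable_cst v (0 : R^o) (1 : R^o)) (diff_derivable (v := 1 : R^o) dsc).
apply: (etrans D); rewrite derive_cst add0r deriveE //.
by have [_ ->] := is_diff_scalel (0 : R^o) w; rewrite scale1r.
Qed.

Lemma linear_findim (U W : normedModType R) (L : U -> W) (I : finType) (b : I -> U)
    (co : I -> U -> R^o) u : u = \sum_i co i u *: b i -> linear L ->
  L u = \sum_i co i u *: L (b i).
Proof.
move=> uE Ll; pose L' : {linear U -> W} := HB.pack L (GRing.isLinear.Build _ _ _ _ _ Ll).
rewrite {1}uE -[LHS]/(L' _) linear_sum.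
by apply: eq_bigr => i _; rewrite linearZ.
Qed.

(** * Families of maps linear in a parameter, and their Leibniz rule *)

Section LinearFamilies.
Context {U V W : normedModType R}.

(** The shape of a tensor in coordinates: linear in the argument [u], smooth in the point for each
    fixed [u]. Over a finite-dimensional [U] this already controls [F (A q) q] for an argument that
    varies with [q]. *)
Definition smooth_family (p : V) (F : U -> V -> W) : Prop :=
  (forall u, smooth_at p (F u)) /\ \forall q \near p, linear (F^~ q).

Lemma smooth_family_field p F (A : V -> U) : findim U -> smooth_family p F ->
  smooth_at p A -> smooth_at p (fun q => F (A q) q).
Proof.
move=> [I [b [co [col uE]]]] [Fs Fl] As.
apply: (smooth_at_near_eq (f := fun q => \sum_i co i (A q) *: F (b i) q)).
  by apply: filterS Fl => q Fq; rewrite [RHS](linear_findim (uE (A q)) Fq).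
apply: smooth_at_sum => i; apply: smooth_at_scale => //.
by have [cl cc] := col i; exact: smooth_at_lin As.
Qed.

(** Expanding [A q] along the spanning family of [U] turns the left side into a finite sum of scalar
    functions times [F (b i)]; the product rule then separates the variation of the argument from
    that of the coefficients. *)
Lemma derive_family p F (A : V -> U) v : findim U -> smooth_family p F ->
  differentiable A p ->
  'D_v (fun q => F (A q) q) p = F ('D_v A p) p + 'D_v (F (A p)) p.
Proof.
move=> [I [b [co [col uE]]]] [Fs Fl] Ad.
have FE (a : U) : \forall q \near p, F a q = \sum_i co i a *: F (b i) q.
  by apply: filterS Fl => q Fq; exact: (linear_findim (uE a) Fq).
have Fd i := smooth_at_differentiable (Fs (b i)).
have cd i : differentiable (fun q => co i (A q)) p.
  have [cl cc] := col i.
  exact: (differentiable_comp Ad (clin_differentiable cl cc _)).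
rewrite (nbhs_singleton (FE _)) [X in _ = _ + X](near_eq_derive _ (FE (A p))).
rewrite (near_eq_derive (g := fun q => \sum_i co i (A q) *: F (b i) q)); last first.
  by apply: filterS Fl => q Fq; exact: (linear_findim (uE (A q)) Fq).
rewrite !derive_sum_fin; last 2 first.
- by move=> i; exact: differentiableZ.
- by move=> i; exact: differentiable_scalev.
rewrite -big_split; apply: eq_bigr => i _; have [cl cc] := col i.
rewrite -(clin_derive_comp cl cc) //.
have Z : 'D_v (fun q => co i (A p) *: F (b i) q) p = co i (A p) *: 'D_v (F (b i)) p.
  by apply: deriveZ; exact: diff_derivable.
apply: etrans (derive_scalev _ (cd i) (Fd i)) _.
exact: (congr1 (+%R _) (esym Z)).
Qed.

End LinearFamilies.

Lemma smooth_family_derive (V W : normedModType R) p (f : V -> W) :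
  smooth_at p f -> smooth_family p (fun v => 'D_v f).
Proof.
move=> fs; split=> [u|]; first exact: smooth_at_derive.
apply: filterS (smooth_at_near_differentiable fs) => q fq a u v /=.
by rewrite derive_dirP.
Qed.

Lemma smooth_at_derive_field (V W : normedModType R) p (f : V -> W) (X : V -> V) :
  findim V -> smooth_at p f -> smooth_at p X -> smooth_at p (fun q => 'D_(X q) f q).
Proof. by move=> fV fs; exact: smooth_family_field fV (smooth_family_derive fs). Qed.

(** The Leibniz rule yields the last term as ['D_v ('D_(X p) f)] with [X p] frozen; symmetry of
    second derivatives then puts the direction [X p] outermost. *)
Lemma derive_derive_field (V W : normedModType R) p (f : V -> W) (X : V -> V) v :
  findim V -> findim W -> smooth_at p f -> differentiable X p ->
  'D_v (fun q => 'D_(X q) f q) p = 'D_('D_v X p) f p + 'D_(X p) ('D_v f) p.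
Proof.
move=> fV fW fs Xd; rewrite (derive_comm (X p) v fW fs).
exact: (derive_family v fV (smooth_family_derive fs) Xd).
Qed.

(* The bracket of vector fields related by a smooth map is related by it too:
   the second derivatives of [phi] cancel by symmetry. *)
Lemma bracket_related (V : normedModType R) (phi : V -> V) (X Y X' Y' : V -> V) q :
  findim V -> smooth_at q phi -> smooth_at q X -> smooth_at q Y ->
  differentiable X' (phi q) -> differentiable Y' (phi q) ->
  (\forall r \near q, X' (phi r) = 'D_(X r) phi r) ->
  (\forall r \near q, Y' (phi r) = 'D_(Y r) phi r) ->
  'D_('D_(X q) Y q - 'D_(Y q) X q) phi q =
  'D_(X' (phi q)) Y' (phi q) - 'D_(Y' (phi q)) X' (phi q).
Proof.
move=> fV ps Xs Ys Xd Yd nX nY.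
have pd := smooth_at_differentiable ps.
have H Z Z' v : smooth_at q Z -> differentiable Z' (phi q) ->
    (\forall r \near q, Z' (phi r) = 'D_(Z r) phi r) ->
   'D_('D_v Z q) phi q = 'D_('D_v phi q) Z' (phi q) - 'D_(Z q) ('D_v phi) q.
  move=> Zs Zd nZ; apply: (canRL (addrK _)).
  rewrite -derive_derive_field //; last exact: smooth_at_differentiable.
  by rewrite -derive_chain //; apply: near_eq_derive; apply: filterS nZ => r rE; exact: esym rE.
rewrite (derive_dirB _ _ pd) (H X X') // (H Y Y') // (nbhs_singleton nX) (nbhs_singleton nY).
by rewrite (derive_comm (Y q) (X q) fV ps) opprB addrA subrK.
Qed.


Section FamiliesOn.
Context {U V W : normedModType R}.
Variable (A : set V).
Hypothesis (oA : open A).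

Definition smooth_on (f : V -> W) : Prop := forall q, A q -> smooth_at q f.

Definition smooth_family_on (F : U -> V -> W) : Prop :=
  (forall u, smooth_on (F u)) /\ forall q, A q -> linear (F^~ q).

Lemma smooth_family_on_at F p : smooth_family_on F -> A p -> smooth_family p F.
Proof.
move=> [Fs Fl] Ap; split=> [u|]; first exact: Fs.
exact: open_near oA Ap Fl.
Qed.

(** The linear relation between members of the family holds on a neighbourhood of every point of
    [A], so it survives differentiation in the base point. *)
Lemma smooth_family_on_derive_in F v :
  smooth_family_on F -> smooth_family_on (fun u => 'D_v (F u)).
Proof.
move=> [Fs Fl]; split=> [u q Aq|q Aq s a b /=]; first exact/smooth_at_derive/Fs.
have Fd u := smooth_at_differentiable (Fs u q Aq).
rewrite (near_eq_derive (g := s *: F a + F b)); last first.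
  by apply: (open_near oA Aq) => r Ar; rewrite Fl.
rewrite deriveD; [|exact/derivableZ/diff_derivable|exact: diff_derivable].
by rewrite deriveZ //; exact: diff_derivable.
Qed.

End FamiliesOn.

Lemma smooth_family_on_derive (V W : normedModType R) (A : set V) (f : V -> W) :
  smooth_on A f -> smooth_family_on A (fun v => 'D_v f).
Proof.
move=> fs; split=> [u q Aq|q Aq s a b]; first exact/smooth_at_derive/fs.
by rewrite /= derive_dirP //; exact/smooth_at_differentiable/fs.
Qed.

Lemma smooth_family_on_comp (U U' V W : normedModType R) (A : set V) (L : U' -> U)
    (F : U -> V -> W) : linear L ->
  smooth_family_on A F -> smooth_family_on A (fun u => F (L u)).
Proof.
move=> Ll [Fs Fl]; split=> [u|q Aq s a b]; first exact: Fs.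
by rewrite /= Ll Fl.
Qed.

Section BilinearFamilies.
Context {U U' V W : normedModType R}.

Definition smooth_family2 (p : V) (F : U -> U' -> V -> W) : Prop :=
  (forall a b, smooth_at p (F a b)) /\
  \forall q \near p, (forall b, linear (fun a => F a b q)) /\ (forall a, linear (fun b => F a b q)).

Lemma smooth_family2_l p F b : smooth_family2 p F -> smooth_family p (fun a => F a b).
Proof. by move=> [Fs Fl]; split=> // ; apply: filterS Fl => q [Fq _]; exact: Fq. Qed.

Lemma smooth_family2_r p F (X : V -> U) : findim U -> smooth_family2 p F ->
  smooth_at p X -> smooth_family p (fun b q => F (X q) b q).
Proof.
move=> fU Ff Xs; split=> [b|].
  exact: (smooth_family_field fU (smooth_family2_l b Ff) Xs).
by have [_] := Ff; apply: filterS => q [_ Fq]; exact: Fq.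
Qed.

Lemma smooth_family2_field p F (X : V -> U) (Y : V -> U') : findim U -> findim U' ->
  smooth_family2 p F -> smooth_at p X -> smooth_at p Y ->
  smooth_at p (fun q => F (X q) (Y q) q).
Proof.
move=> fU fU' Ff Xs Ys.
exact: (smooth_family_field fU' (smooth_family2_r fU Ff Xs) Ys).
Qed.

Lemma derive_family2 p F (X : V -> U) (Y : V -> U') v : findim U -> findim U' ->
  smooth_family2 p F -> smooth_at p X -> smooth_at p Y ->
  'D_v (fun q => F (X q) (Y q) q) p =
  F ('D_v X p) (Y p) p + F (X p) ('D_v Y p) p + 'D_v (F (X p) (Y p)) p.
Proof.
move=> fU fU' Ff Xs Ys.
have Xd := smooth_at_differentiable Xs; have Yd := smooth_at_differentiable Ys.
have D1 := derive_family v fU' (smooth_family2_r fU Ff Xs) Yd.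
have D2 := derive_family v fU (smooth_family2_l (Y p) Ff) Xd.
by rewrite D1 D2 addrA [X in X + _]addrC.
Qed.

End BilinearFamilies.

End Differentials.

(** * Invariance under changes of charts *)

Section Charts.
Context {R : realType} {n : nat} {M : manifold R n}.
Local Notation E := 'rV[R]_n.
Local Notation EE := ('rV[R]_n * 'rV[R]_n)%type.
Implicit Types (c d e : chart R n M) (x : M) (u : TM M) (p q : EE).

Lemma findim_E : findim E. Proof. exact: findim_rV. Qed.
Lemma findim_EE : findim EE. Proof. exact/findim_prod/findim_E/findim_E. Qed.

(** The part of the model space over the image of [c], zero vectors included; [sdom] removes them
    later. *)
Definition cbase c : set EE := [set p | (c @` cdom c) p.1].

Lemma cinvK c (a : E) : (c @` cdom c) a -> cdom c (cinv c a) /\ c (cinv c a) = a.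
Proof. by case=> x cx <-; rewrite cmapK. Qed.

Lemma cbase_open c : open (cbase c).
Proof.
rewrite (_ : cbase c = fst @^-1` (c @` cdom c)) //.
by apply: open_comp; [move=> p _; exact: cvg_fst | exact: cimg_open].
Qed.

Lemma near_cimg c d (a : E) : (c @` cdom c) a -> cdom d (cinv c a) ->
  \forall b \near a, (c @` cdom c) b /\ cdom d (cinv c b).
Proof.
move=> ca da; have nc : nbhs a (c @` cdom c).
  by apply: open_nbhs_nbhs; split=> //; exact: cimg_open.
have nd : nbhs a (cinv c @^-1` cdom d).
  by apply: (cinv_cont ca); apply: open_nbhs_nbhs; split=> //; exact: cdom_open.
by apply: filterS (filterI nc nd) => b [].
Qed.

Lemma transition_smooth c d (a : E) : atlas c -> atlas d ->
  (c @` cdom c) a -> cdom d (cinv c a) -> smooth_at a (d \o cinv c).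
Proof.
move=> ac ad ca da; have [cx ce] := cinvK ca.
by rewrite -[a in smooth_at a]ce; exact: atlas_compat.
Qed.

(** Near [a] the map [e \o cinv c] factors through the chart [d], and the chain rule gives the
    cocycle identity of the Jacobians. It is what makes vectors recorded in the selected chart
    readable in any other chart. *)
Lemma transition_chain c d e (a w : E) : atlas c -> atlas d -> atlas e ->
  (c @` cdom c) a -> cdom d (cinv c a) -> cdom e (cinv c a) ->
  'D_('D_w (d \o cinv c) a) (e \o cinv d) ((d \o cinv c) a) = 'D_w (e \o cinv c) a.
Proof.
move=> ac ad ae ca da ea.
have s1 := smooth_at_differentiable (transition_smooth ac ad ca da).
have da' : (d @` cdom d) (d (cinv c a)) by exists (cinv c a).
have s2 : differentiable (e \o cinv d) ((d \o cinv c) a).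
  apply/smooth_at_differentiable/transition_smooth => //=.
  by rewrite cmapK.
rewrite -(derive_chain w s1 s2); apply: near_eq_derive.
have := near_cimg ca da; apply: filterS => b [cb db] /=.
by rewrite cmapK.
Qed.

Lemma transition_id c (a w : E) : (c @` cdom c) a -> 'D_w (c \o cinv c) a = w.
Proof.
move=> ca; rewrite (near_eq_derive (g := id)) ?derive_id //.
have [cx _] := cinvK ca; have := near_cimg ca cx; apply: filterS => b [cb _] /=.
by have [] := cinvK cb.
Qed.

Lemma tchange_chain c d e x w : atlas c -> atlas d -> atlas e ->
  cdom c x -> cdom d x -> cdom e x -> tchange d e x (tchange c d x w) = tchange c e x w.
Proof.
move=> ac ad ae cx dx ex; have cc : (c @` cdom c) (c x) by exists x.
have := @transition_chain c d e (c x) w ac ad ae cc.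
by rewrite /= (cmapK cx); apply.
Qed.

Lemma tchange_id c x w : cdom c x -> tchange c c x w = w.
Proof. by move=> cx; apply: transition_id; exists x. Qed.

Lemma tchange_differentiable c d x : atlas c -> atlas d -> cdom c x -> cdom d x ->
  differentiable (d \o cinv c) (c x).
Proof. by move=> ac ad cx dx; exact/smooth_at_differentiable/atlas_compat. Qed.

Lemma tinvK c u : atlas c -> cdom c u.1 -> tinv c (tcoord c u) = u.
Proof.
case: u => x w ac /= cx; rewrite /tinv /tcoord /= cmapK // tchange_chain //.
- by rewrite tchange_id //; exact: chart_at_dom.
- exact: chart_at_atlas.
- exact: chart_at_atlas.
- exact: chart_at_dom.
- exact: chart_at_dom.
Qed.

Lemma tcoordK c p : atlas c -> cbase c p -> tcoord c (tinv c p) = p.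
Proof.
case: p => a w ac /cinvK[/= cx ce]; rewrite /tinv /tcoord /= ce tchange_chain //.
- by rewrite tchange_id.
- exact: chart_at_atlas.
- exact: chart_at_dom.
Qed.

Lemma cbase_tcoord c u : cdom c u.1 -> cbase c (tcoord c u).
Proof. by move=> cu; exists u.1. Qed.

(* [p] is the image, in the chart [c], of a vector tangent to [M] at a point
   which also lies in the domain of [d]. *)
Definition overlap c d p : Prop :=
  [/\ atlas c, atlas d, cbase c p & cdom d (tinv c p).1].

Definition trans c d : EE -> EE := tcoord d \o tinv c.

Lemma overlap_refl c p : atlas c -> cbase c p -> overlap c c p.
Proof. by move=> ac cp; split=> //; have [] := cinvK cp. Qed.

Lemma overlap_chart_at c p : atlas c -> cbase c p ->
  overlap c (chart_at (tinv c p).1) p.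
Proof.
by move=> ac cp; split=> //; [exact: chart_at_atlas | exact: chart_at_dom].
Qed.

Lemma overlap_near c d p : overlap c d p -> \forall q \near p, overlap c d q.
Proof.
move=> [ac ad cp dp]; have n1 := near_cimg cp dp.
have : \forall q \near p, (c @` cdom c) q.1 /\ cdom d (cinv c q.1) by exact: cvg_fst n1.
by apply: filterS => q [].
Qed.

(** By the cocycle identity the chart selected by [chart_at] drops out, which leaves the tangent map
    of the transition map of [M]. *)
Lemma transE c d p : overlap c d p ->
  trans c d p = ((d \o cinv c) p.1, 'D_(p.2) (d \o cinv c) p.1).
Proof.
move=> [ac ad cp dp]; have [cx ce] := cinvK cp; apply: (congr1 (pair _)) => /=.
have x0 := chart_at_dom (cinv c p.1).
have a0 := chart_at_atlas (cinv c p.1).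
by rewrite (tchange_chain p.2 ac a0 ad cx x0 dp) /tchange ce.
Qed.

Lemma transK c d p : overlap c d p -> tinv d (trans c d p) = tinv c p.
Proof. by move=> [ac ad cp dp]; rewrite /trans /= tinvK. Qed.

Lemma overlap_sym c d p : overlap c d p -> overlap d c (trans c d p).
Proof.
move=> o; have [ac ad cp dp] := o; split=> //; first exact: cbase_tcoord.
by rewrite transK //; have [] := cinvK cp.
Qed.

Lemma trans_trans c d e p : overlap c d p -> trans d e (trans c d p) = trans c e p.
Proof. by move=> o; rewrite /trans /= -/(trans c d p) transK. Qed.

Lemma trans_id c p : atlas c -> cbase c p -> trans c c p = p.
Proof. exact: tcoordK. Qed.

Lemma overlap_smooth c d p : overlap c d p -> smooth_at p.1 (d \o cinv c).
Proof. by move=> [ac ad cp dp]; exact: transition_smooth. Qed.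

Lemma smooth_at_pfst p : smooth_at p (fst : EE -> E).
Proof. exact: smooth_at_fst (smooth_at_id p). Qed.
Lemma smooth_at_psnd p : smooth_at p (snd : EE -> E).
Proof. exact: smooth_at_snd (smooth_at_id p). Qed.

Lemma overlap_smooth_fst c d p : overlap c d p ->
  smooth_at p ((d \o cinv c) \o fst : EE -> E).
Proof.
move=> o; apply: smooth_at_comp (smooth_at_pfst p) (overlap_smooth o).
exact: findim_E.
Qed.

Lemma derive_comp_fst (f : E -> E) p v :
  differentiable f p.1 -> 'D_v (f \o fst) p = 'D_(v.1) f p.1.
Proof.
move=> df.
have dfst := clin_differentiable (@fst_linear R E E) (@fst_continuous R E E) p.
apply: (etrans (derive_chain v dfst df)).
by rewrite (clin_derive (@fst_linear R E E) (@fst_continuous R E E)).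
Qed.

(** The fibre component becomes the derivative of a map on the total space in the direction
    [(y, 0)], a form to which the rules for derivatives along variable directions apply. *)
Lemma transE_near c d p : overlap c d p -> \forall q \near p, trans c d q =
  (((d \o cinv c) \o fst) q, 'D_((q.2, 0)) ((d \o cinv c) \o fst) q).
Proof.
move=> /overlap_near; apply: filterS => q o; by rewrite transE //= derive_comp_fst.
Qed.

Lemma smooth_at_psnd0 p : smooth_at p (fun q : EE => (q.2, 0) : EE).
Proof. by apply: smooth_at_pair; [exact: smooth_at_psnd | exact: smooth_at_cst]. Qed.

Lemma trans_smooth c d p : overlap c d p -> smooth_at p (trans c d).
Proof.
move=> o; have s := overlap_smooth_fst o.
apply: smooth_at_near_eq (smooth_at_pair s
  (smooth_at_derive_field findim_EE s (smooth_at_psnd0 p))).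
by have := transE_near o; apply: filterS => q ->.
Qed.

Lemma trans_differentiable c d p : overlap c d p -> differentiable (trans c d) p.
Proof. by move=> /trans_smooth/smooth_at_differentiable. Qed.

Lemma derive_trans_fst c d p v : overlap c d p ->
  ('D_v (trans c d) p).1 = 'D_(v.1) (d \o cinv c) p.1.
Proof.
move=> o; rewrite -derive_fst; last exact: trans_differentiable.
rewrite -derive_comp_fst; last exact/smooth_at_differentiable/overlap_smooth.
by apply: near_eq_derive; have := transE_near o; apply: filterS => q ->.
Qed.

Lemma derive_trans_vertical c d p (w : E) : overlap c d p ->
  'D_((0, w)) (trans c d) p = (0, 'D_w (d \o cinv c) p.1).
Proof.
move=> o; rewrite [LHS]surjective_pairing derive_trans_fst //= derive0.
congr (_, _); rewrite -derive_snd; last exact: trans_differentiable.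
have s := overlap_smooth_fst o; have ds := smooth_at_differentiable.
rewrite (near_eq_derive (g := fun q => 'D_((q.2, 0)) ((d \o cinv c) \o fst) q)); last first.
  by have := transE_near o; apply: filterS => q ->.
rewrite derive_derive_field; [|exact: findim_EE|exact: findim_E|by []|exact/ds/smooth_at_psnd0].
rewrite derive_pair; [|exact/ds/smooth_at_psnd|exact: differentiable_cst].
rewrite (clin_derive (@snd_linear _ _ _) (@snd_continuous _ _ _)) derive_cst /=.
(* The base map composed with [fst] does not vary along the fibre, so the second-derivative term
   vanishes and only the linear dependence on the fibre vector is left. *)
have -> : 'D_((p.2, 0)) ('D_((0, w)) ((d \o cinv c) \o fst)) p = 0.
  rewrite (near_eq_derive (g := cst 0)) ?derive_cst //.
  have := overlap_near o; apply: filterS => q oq.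
  by rewrite derive_comp_fst ?derive0 //; exact/ds/overlap_smooth.
by rewrite addr0 derive_comp_fst //; exact/ds/overlap_smooth.
Qed.

Lemma transKK c d p : overlap c d p -> trans d c (trans c d p) = p.
Proof. by move=> o; have [ac _ cp _] := o; rewrite trans_trans // trans_id. Qed.

(** * Local expressions of fields and operators under a change of chart *)

Lemma vf_inE c X p : vf_in c X p =
  'D_(X (tinv c p)) (trans (chart_at (tinv c p).1) c) (trans c (chart_at (tinv c p).1) p).
Proof. by []. Qed.

Lemma pvf_inE c (X : pvfield M) p : atlas c -> cbase c p -> pvf_in c X p =
  'D_(X (tinv c p)) (c \o cinv (chart_at (tinv c p).1))
     (trans c (chart_at (tinv c p).1) p).1.
Proof. by []. Qed.

Lemma tcoord_tinv c d p : tcoord d (tinv c p) = trans c d p.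
Proof. by []. Qed.

Opaque trans.

(** Both local expressions are images of the same components, those in the chart [c0] selected at
    the base point; the chain rule for the factorisation of [trans c0 d] through [c] compares
    them. *)
Lemma vf_in_change c d X p : overlap c d p ->
  vf_in d X (trans c d p) = 'D_(vf_in c X p) (trans c d) p.
Proof.
move=> o; have [ac ad cp dp] := o; have o0 := overlap_chart_at ac cp.
rewrite !vf_inE (transK o) (trans_trans _ o).
set c0 := chart_at _ in o0 *; set q := trans c c0 p.
have o1 : overlap c0 c q := overlap_sym o0.
have qp : trans c0 c q = p := transKK o0.
have o' : overlap c d (trans c0 c q) by rewrite qp.
have E w : 'D_w (trans c0 d) q = 'D_('D_w (trans c0 c) q) (trans c d) (trans c0 c q).
  rewrite -(derive_chain w (trans_differentiable o1) (trans_differentiable o')).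
  apply: near_eq_derive; have := overlap_near o1; apply: filterS => r o2.
  by rewrite /= (trans_trans d o2).
rewrite E qp; reflexivity.
Qed.

Lemma vf_in_chart_at u X :
  vf_in (chart_at u.1) X (tcoord (chart_at u.1) u) = X u.
Proof.
have ac := chart_at_atlas u.1; have cu := chart_at_dom u.1.
have cb := cbase_tcoord cu.
rewrite vf_inE (tinvK ac cu) (trans_id ac cb).
rewrite (near_eq_derive (g := id)) ?derive_id //.
have o := overlap_refl ac (cbase_tcoord cu).
by have := overlap_near o; apply: filterS => r [_ _ cr _]; rewrite trans_id.
Qed.

Lemma vf_in_own c p X : vf_in (chart_at (tinv c p).1) X (trans c (chart_at (tinv c p).1) p)
  = X (tinv c p).
Proof. by rewrite -tcoord_tinv vf_in_chart_at. Qed.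

Lemma vf_in_chart c p X : atlas c -> cbase c p ->
  X (tinv c p) = 'D_(vf_in c X p) (trans c (chart_at (tinv c p).1)) p.
Proof.
move=> ac cp; rewrite -(vf_in_change X (overlap_chart_at ac cp)).
by rewrite vf_in_own.
Qed.

Lemma vf_in_inj c p X Y : atlas c -> cbase c p ->
  vf_in c X p = vf_in c Y p -> X (tinv c p) = Y (tinv c p).
Proof.
move=> ac cp XY; have := vf_in_chart X ac cp; rewrite XY => HX.
exact: (etrans HX (esym (vf_in_chart Y ac cp))).
Qed.

Lemma vf_in_eq c p X Y : X (tinv c p) = Y (tinv c p) -> vf_in c X p = vf_in c Y p.
Proof. by move=> XY; rewrite !vf_inE XY. Qed.

Lemma vf_inD c p (X Y : vfield M) : atlas c -> cbase c p ->
  vf_in c (fun u => X u + Y u) p = vf_in c X p + vf_in c Y p.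
Proof.
move=> ac cp; have o := overlap_sym (overlap_chart_at ac cp).
by rewrite !vf_inE derive_dirD //; exact: trans_differentiable.
Qed.

Lemma vf_inB c p (X Y : vfield M) : atlas c -> cbase c p ->
  vf_in c (fun u => X u - Y u) p = vf_in c X p - vf_in c Y p.
Proof.
move=> ac cp; have o := overlap_sym (overlap_chart_at ac cp).
by rewrite !vf_inE derive_dirB //; exact: trans_differentiable.
Qed.

Lemma vf_inZ c p (a : TM M -> R) (X : vfield M) : atlas c -> cbase c p ->
  vf_in c (fun u => a u *: X u) p = a (tinv c p) *: vf_in c X p.
Proof.
move=> ac cp; have o := overlap_sym (overlap_chart_at ac cp).
by rewrite !vf_inE derive_dirZ //; exact: trans_differentiable.
Qed.

Lemma pvf_in_change c d (X : pvfield M) p : overlap c d p ->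
  pvf_in d X (trans c d p) = 'D_(pvf_in c X p) (d \o cinv c) p.1.
Proof.
move=> o; have [ac ad cp dp] := o; rewrite /pvf_in (transK o).
have [cx ce] := cinvK cp.
rewrite -(tchange_chain _ (chart_at_atlas _) ac ad (chart_at_dom _) cx dp).
by rewrite {1}/tchange /= ce.
Qed.

Lemma pvf_in_chart_at u (X : pvfield M) :
  pvf_in (chart_at u.1) X (tcoord (chart_at u.1) u) = X u.
Proof.
have ac := chart_at_atlas u.1; have cu := chart_at_dom u.1.
by rewrite /pvf_in (tinvK ac cu) tchange_id.
Qed.

Lemma pvf_in_chart c p (X : pvfield M) : atlas c -> cbase c p ->
  X (tinv c p) = 'D_(pvf_in c X p) (chart_at (tinv c p).1 \o cinv c) p.1.
Proof.
move=> ac cp; rewrite -(pvf_in_change X (overlap_chart_at ac cp)).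
by rewrite -tcoord_tinv pvf_in_chart_at.
Qed.

Lemma pvf_in_inj c p (X Y : pvfield M) : atlas c -> cbase c p ->
  pvf_in c X p = pvf_in c Y p -> X (tinv c p) = Y (tinv c p).
Proof.
move=> ac cp XY; have := pvf_in_chart X ac cp; rewrite XY => HX.
exact: (etrans HX (esym (pvf_in_chart Y ac cp))).
Qed.

Lemma pvf_in_eq c p (X Y : pvfield M) : X (tinv c p) = Y (tinv c p) ->
  pvf_in c X p = pvf_in c Y p.
Proof. by move=> XY; rewrite /pvf_in XY. Qed.

Lemma eta_in c p : atlas c -> cbase c p -> pvf_in c eta p = p.2.
Proof. by move=> ac cp; have := tcoordK ac cp => /(congr1 snd). Qed.

Lemma gamma_atE u (w : E) : gamma_at u w = (0, w).
Proof.
have cu := chart_at_dom u.1.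
rewrite /gamma_at /tcoord /=.
rewrite (_ : (fun _ => _) = (fun t : R^o => (chart_at u.1 u.1, u.2 + t *: w))); last first.
  by apply/funext => t; rewrite tchange_id.
have dsc : differentiable (fun t : R^o => t *: w) 0.
  by have [] := is_diff_scalel (0 : R^o) w.
have dl : differentiable (fun t : R^o => u.2 + t *: w) 0.
  by apply: differentiableD => //; exact: differentiable_cst.
by rewrite derive_pair // derive_cst derive_affine.
Qed.

Lemma rho_atE u (w : EE) : rho_at u w = w.1.
Proof.
have ac := chart_at_atlas u.1; have cu := chart_at_dom u.1.
rewrite /rho_at (near_eq_derive (g := fst)).
  by rewrite (clin_derive (@fst_linear R E E) (@fst_continuous R E E)).
have := overlap_near (overlap_refl ac (cbase_tcoord cu)); apply: filterS => q [_ _ cq _].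
by have [] := cinvK cq.
Qed.

Opaque vf_in pvf_in tcoord tinv.

Lemma smooth_fun_change c d (f : TM M -> R) p : overlap c d p ->
  smooth_at p (f \o tinv c : EE -> R^o) ->
  smooth_at (trans c d p) (f \o tinv d : EE -> R^o).
Proof.
move=> o fs; have o' := overlap_sym o.
have fs' : smooth_at (trans d c (trans c d p)) (f \o tinv c : EE -> R^o) by rewrite (transKK o).
apply: smooth_at_near_eq (smooth_at_comp findim_EE (trans_smooth o') fs').
by have := overlap_near o'; apply: filterS => q oq; rewrite /= (transK oq).
Qed.

Lemma smooth_vf_change c d X p : overlap c d p ->
  smooth_at p (vf_in c X) -> smooth_at (trans c d p) (vf_in d X).
Proof.
move=> o Xs; have o' := overlap_sym o.
have fs : smooth_at p (fun q => 'D_(vf_in c X q) (trans c d) q).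
  by apply: smooth_at_derive_field => //; [exact: findim_EE | exact: trans_smooth].
have fs' : smooth_at (trans d c (trans c d p)) (fun q => 'D_(vf_in c X q) (trans c d) q).
  by rewrite (transKK o).
apply: smooth_at_near_eq (smooth_at_comp findim_EE (trans_smooth o') fs').
have := overlap_near o'; apply: filterS => q oq.
by rewrite /= -(vf_in_change X (overlap_sym oq)) (transKK oq).
Qed.

Lemma smooth_pvf_change c d X p : overlap c d p ->
  smooth_at p (pvf_in c X) -> smooth_at (trans c d p) (pvf_in d X).
Proof.
move=> o Xs; have o' := overlap_sym o.
have fs : smooth_at p (fun q => 'D_((pvf_in c X q, 0)) ((d \o cinv c) \o fst : EE -> E) q).
  apply: smooth_at_derive_field; [exact: findim_EE | exact: overlap_smooth_fst |].
  by apply: smooth_at_pair => //; exact: smooth_at_cst.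
have fs' : smooth_at (trans d c (trans c d p))
    (fun q => 'D_((pvf_in c X q, 0)) ((d \o cinv c) \o fst : EE -> E) q).
  by rewrite (transKK o).
apply: smooth_at_near_eq (smooth_at_comp findim_EE (trans_smooth o') fs').
have := overlap_near o'; apply: filterS => q oq; have oq' := overlap_sym oq.
rewrite /= derive_comp_fst; last exact/smooth_at_differentiable/overlap_smooth.
by rewrite -(pvf_in_change X oq') (transKK oq).
Qed.

Lemma der_in c p X (f : TM M -> R) : atlas c -> cbase c p ->
  smooth_at p (f \o tinv c : EE -> R^o) ->
  der X f (tinv c p) = 'D_(vf_in c X p) (f \o tinv c : EE -> R^o) p.
Proof.
move=> ac cp fs; have o := overlap_chart_at ac cp; have o' := overlap_sym o.
rewrite /der tcoord_tinv.
set d := chart_at _ in o o' *; set q := trans c d p.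
have qp : trans d c q = p := transKK o.
have fs' : smooth_at (trans d c q) (f \o tinv c : EE -> R^o) by rewrite qp.
rewrite (near_eq_derive (g := (f \o tinv c : EE -> R^o) \o trans d c)); last first.
  by have := overlap_near o'; apply: filterS => r /= or_; rewrite (transK or_).
rewrite (derive_chain _ (trans_differentiable o') (smooth_at_differentiable fs')).
by rewrite -(vf_in_own c p X) -/d -/q -(vf_in_change X o') qp.
Qed.

(** [lie] is computed at each point in the chart selected there. The passage to the fixed chart [c]
    is naturality of the bracket, [bracket_related], for the transition map between the two. *)
Lemma lie_in c p X Y : atlas c -> cbase c p ->
  smooth_at p (vf_in c X) -> smooth_at p (vf_in c Y) ->
  vf_in c (lie X Y) p = 'D_(vf_in c X p) (vf_in c Y) p - 'D_(vf_in c Y p) (vf_in c X) p.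
Proof.
move=> ac cp Xs Ys; have o := overlap_chart_at ac cp; have o' := overlap_sym o.
rewrite vf_inE /lie tcoord_tinv.
rewrite -(vf_in_own c p X) -(vf_in_own c p Y).
set d := chart_at _ in o o' *; set q := trans c d p in o' *.
have qp : trans d c q = p := transKK o.
have Xd : differentiable (vf_in c X) (trans d c q).
  by rewrite qp; exact: smooth_at_differentiable.
have Yd : differentiable (vf_in c Y) (trans d c q).
  by rewrite qp; exact: smooth_at_differentiable.
have nZ Z : \forall r \near q, vf_in c Z (trans d c r) = 'D_(vf_in d Z r) (trans d c) r.
  by have := overlap_near o'; apply: filterS => r or_; exact: vf_in_change.
have L := bracket_related findim_EE (trans_smooth o') (smooth_vf_change o Xs)
  (smooth_vf_change o Ys) Xd Yd (nZ X) (nZ Y).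
by rewrite qp in L.
Qed.

Lemma gamma_in c p X : atlas c -> cbase c p -> vf_in c (gamma X) p = (0, pvf_in c X p).
Proof.
move=> ac cp; have o := overlap_chart_at ac cp; have o' := overlap_sym o.
by rewrite vf_inE /gamma gamma_atE (derive_trans_vertical _ o').
Qed.

Lemma rho_in c p X : atlas c -> cbase c p -> pvf_in c (rho X) p = (vf_in c X p).1.
Proof.
move=> ac cp; have o := overlap_chart_at ac cp; have o' := overlap_sym o.
by rewrite pvf_inE // /rho rho_atE vf_inE (derive_trans_fst _ o').
Qed.

Lemma J_in c p X : atlas c -> cbase c p -> vf_in c (J X) p = (0, (vf_in c X p).1).
Proof. by move=> ac cp; rewrite gamma_in // rho_in. Qed.

(** Extends prescribed components in the chart [c] to a local vector field, in particular a single
    vector to a field with constant components; the values away from [c] carry no meaning. *)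
Definition vf_lift c (F : EE -> EE) : vfield M := fun u =>
  'D_(F (tcoord c u)) (trans c (chart_at u.1)) (tcoord c u).

Lemma vf_lift_in c F p : atlas c -> cbase c p -> vf_in c (vf_lift c F) p = F p.
Proof.
move=> ac cp; have o := overlap_chart_at ac cp; have o' := overlap_sym o.
rewrite vf_inE /vf_lift (tcoordK ac cp); set d := chart_at _ in o o' *.
have o2 : overlap d c (trans c d p) by [].
rewrite -(derive_chain _ (trans_differentiable o) (trans_differentiable o2)).
rewrite (near_eq_derive (g := id)) ?derive_id //.
by have := overlap_near o; apply: filterS => q oq; rewrite /= (transKK oq).
Qed.

End Charts.

(** * Connection and curvature of a spray in coordinates *)

Section LocalSpray.
Context {R : realType} {n : nat}.
Local Notation E := 'rV[R]_n.
Local Notation EE := ('rV[R]_n * 'rV[R]_n)%type.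
Implicit Types (g Z : EE -> E) (V W : EE -> EE) (a b c : E) (p q : EE).

Definition vert (a : E) : EE := (0, a).

(* For the spray [(y, g (x, y))] and constant vectors [a], [b], in coordinates:
   [Nl] and [Gm] are the coefficients of the Barthel and Berwald connections,
   [hl] is the horizontal lift, [cov] the Berwald connection, and
   [[hl a, hl b] = - vert (Hc a b)]. *)
Definition Nl g a : EE -> E := fun q => - 2^-1 *: 'D_(vert a) g q.
Definition Gm g a b : EE -> E := 'D_(vert b) (Nl g a).
Definition hl g a : EE -> EE := fun q => (a, - Nl g a q).
Definition cov g V Z : EE -> E := fun q => 'D_(V q) Z q + Gm g (V q).1 (Z q) q.
Definition Hc g a b : EE -> E := fun q => 'D_(hl g a q) (Nl g b) q - 'D_(hl g b q) (Nl g a) q.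

Lemma vert_linear : linear vert.
Proof. by move=> s a b; rewrite /vert -[RHS]/(_ *: _ + _, _) scaler0 addr0. Qed.
Lemma vertD a b : vert (a + b) = vert a + vert b.
Proof. by rewrite /vert -[RHS]/(_ + _, _) addr0. Qed.
Lemma vertN a : vert (- a) = - vert a.
Proof. by rewrite /vert -[RHS]/(- _, _) oppr0. Qed.
Lemma vertZ (s : R) a : vert (s *: a) = s *: vert a.
Proof. by rewrite /vert -[RHS]/(_ *: _, _) scaler0. Qed.
Let fE : findim E := findim_E.
Let fEE : findim EE := findim_EE.

Variable (A : set EE).
Hypothesis (oA : open A).

Lemma derive_ext_on (T : normedModType R) (f h : EE -> T) v p : A p ->
  (forall q, A q -> f q = h q) -> 'D_v f p = 'D_v h p.
Proof. by move=> Ap fh; apply: near_eq_derive; exact: open_near oA Ap fh. Qed.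

(** * Curvature of the Berwald connection in coordinates *)

Section Connection.
Variable g : EE -> E.
Hypothesis gs : smooth_on A g.

Lemma Nl_family : smooth_family_on A (Nl g).
Proof.
have [Fs Fl] := smooth_family_on_comp vert_linear (smooth_family_on_derive gs).
split=> [a q Aq|q Aq s a b]; first exact/smooth_atZ/Fs.
by rewrite /Nl /= Fl // scalerDr !scalerA mulrC.
Qed.

Lemma Nl_smooth a : smooth_on A (Nl g a).
Proof. by have [Fs _] := Nl_family; exact: Fs. Qed.

Lemma Nl_differentiable a q : A q -> differentiable (Nl g a) q.
Proof. by move=> Aq; exact/smooth_at_differentiable/Nl_smooth. Qed.

Lemma Gm_family1 b : smooth_family_on A (fun a => Gm g a b).
Proof. exact: (smooth_family_on_derive_in oA (vert b) Nl_family). Qed.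

Lemma Gm_family2 a : smooth_family_on A (Gm g a).
Proof.
exact: (smooth_family_on_comp vert_linear (smooth_family_on_derive (Nl_smooth a))).
Qed.

Lemma GmBl a b c q : A q -> Gm g (a - b) c q = Gm g a c q - Gm g b c q.
Proof.
move=> Aq; have [_ Fl] := Gm_family1 c; have := Fl q Aq (-1) b a.
by rewrite !scaleN1r ![- _ + _]addrC.
Qed.
Lemma GmDr a b c q : A q -> Gm g a (b + c) q = Gm g a b q + Gm g a c q.
Proof.
by move=> Aq; have [_ Fl] := Gm_family2 a; have := Fl q Aq 1 b c; rewrite !scale1r.
Qed.
Lemma GmNr a b q : A q -> Gm g a (- b) q = - Gm g a b q.
Proof.
by move=> Aq; rewrite /Gm vertN derive_dirN //; exact: Nl_differentiable.
Qed.

Lemma Gm_family p : A p -> smooth_family2 p (Gm g).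
Proof.
move=> Ap; split=> [a b|]; first by have [Fs _] := Gm_family2 a; exact: Fs.
apply: (open_near oA Ap) => q Aq; split=> [b|a].
  by have [_ Fl] := Gm_family1 b; exact: Fl.
by have [_ Fl] := Gm_family2 a; exact: Fl.
Qed.

Lemma Gm_field_smooth p (X Y : EE -> E) : A p -> smooth_at p X -> smooth_at p Y ->
  smooth_at p (fun q => Gm g (X q) (Y q) q).
Proof. by move=> Ap; exact: smooth_family2_field fE fE (Gm_family Ap). Qed.

Lemma derive_Gm_field p (X Y : EE -> E) v : A p -> smooth_at p X -> smooth_at p Y ->
  'D_v (fun q => Gm g (X q) (Y q) q) p =
  Gm g ('D_v X p) (Y p) p + Gm g (X p) ('D_v Y p) p + 'D_v (Gm g (X p) (Y p)) p.
Proof. by move=> Ap; exact: (derive_family2 v fE fE (Gm_family Ap)). Qed.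

Lemma cov_smooth p V Z : A p -> smooth_at p V -> smooth_at p Z -> smooth_at p (cov g V Z).
Proof.
move=> Ap Vs Zs; apply: smooth_atD; first exact: smooth_at_derive_field.
by apply: Gm_field_smooth => //; exact: smooth_at_fst.
Qed.

(** Long cancellations are stated for arbitrary vectors or scalars, so that the algebra sees only
    atoms in place of derivatives; the other [regroup_] lemmas serve the same purpose. *)
Lemma curvature_regroup (x1 x2 x3 x4 x5 x6 x7 x8 x9 x10 x11 : E) :
  - (x1 + x3 + (x4 + x6 + x8) + (x7 + x10)) + (x2 + x3 + (x5 + x7 + x9) + (x6 + x11))
  + (x1 - x2 + (x4 - x5)) = - (x8 - x9 + x10 - x11).
Proof. by apply/rowP => i; rewrite !mxE; ring. Qed.

Lemma curvature_regroup2 (x1 x2 x3 x4 : E) : x1 - x3 - (x2 - x4) = x1 - x2 + x4 - x3.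
Proof. by apply/rowP => i; rewrite !mxE; ring. Qed.

Opaque derive.

(** All derivatives of [Z] cancel: the second ones by symmetry, the first ones against ['D_U Z] and
    against each other. Derivatives of [V] and [W] cancel through the bracket [U]. What remains is
    the usual expression, derivative of the coefficients plus their commutator, with the minus sign
    of the curvature convention. *)
Lemma cov_curvature p V W U Z : A p ->
  smooth_at p V -> smooth_at p W -> smooth_at p Z ->
  U p = 'D_(V p) W p - 'D_(W p) V p ->
  - cov g V (cov g W Z) p + cov g W (cov g V Z) p + cov g U Z p =
  - ('D_(V p) (Gm g (W p).1 (Z p)) p - 'D_(W p) (Gm g (V p).1 (Z p)) p
     + Gm g (V p).1 (Gm g (W p).1 (Z p) p) p - Gm g (W p).1 (Gm g (V p).1 (Z p) p) p).
Proof.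
move=> Ap Vs Ws Zs UE.
have K V' W' : smooth_at p V' -> smooth_at p W' ->
  cov g V' (cov g W' Z) p =
  'D_('D_(V' p) W' p) Z p + 'D_(W' p) ('D_(V' p) Z) p +
  (Gm g ('D_(V' p) W' p).1 (Z p) p + Gm g (W' p).1 ('D_(V' p) Z p) p +
   'D_(V' p) (Gm g (W' p).1 (Z p)) p) +
  (Gm g (V' p).1 ('D_(W' p) Z p) p + Gm g (V' p).1 (Gm g (W' p).1 (Z p) p) p).
  move=> Vs' Ws'; have Wd := smooth_at_differentiable Ws'.
  have W1s := smooth_at_fst Ws'.
  rewrite [LHS]/cov GmDr // deriveD; last 2 first.
  - exact/diff_derivable/smooth_at_differentiable/smooth_at_derive_field.
  - exact/diff_derivable/smooth_at_differentiable/Gm_field_smooth.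
  have D1 := derive_derive_field (V' p) fEE fE Zs Wd.
  have D2 := derive_Gm_field (V' p) Ap W1s Zs.
  have D3 := derive_fst (V' p) Wd.
  rewrite D3 in D2; congr (_ + _ + _); [exact: D1 | exact: D2].
have Zd := smooth_at_differentiable Zs.
have K1 := K V W Vs Ws; have K2 := K W V Ws Vs.
have K3 : cov g U Z p = 'D_('D_(V p) W p) Z p - 'D_('D_(W p) V p) Z p +
    (Gm g ('D_(V p) W p).1 (Z p) p - Gm g ('D_(W p) V p).1 (Z p) p).
  by rewrite /cov UE; congr (_ + _); [exact: derive_dirB | exact: GmBl].
have S := derive_comm (V p) (W p) fE Zs; rewrite S in K2.
apply: (etrans (congr2 _ (congr2 _ (congr1 _ K1) K2) K3)).
exact: curvature_regroup.
Qed.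

Lemma hl_smooth a : smooth_on A (hl g a).
Proof.
move=> q Aq; apply: smooth_at_pair; first exact: smooth_at_cst.
exact/smooth_atN/Nl_smooth.
Qed.

Lemma derive_hl a v q : A q -> 'D_v (hl g a) q = (0, - 'D_v (Nl g a) q).
Proof.
move=> Aq; have Nd := Nl_differentiable a Aq.
rewrite derive_pair; [|exact: differentiable_cst|exact: differentiableN].
by rewrite derive_cst deriveN //; exact: diff_derivable.
Qed.

Lemma derive_hl_vert a c q : A q -> 'D_(vert c) (hl g a) q = vert (- Gm g a c q).
Proof. exact: derive_hl. Qed.

Lemma derive_Nl_hl_smooth a b : smooth_on A (fun q => 'D_(hl g a q) (Nl g b) q).
Proof.
by move=> q Aq; apply: smooth_at_derive_field => //; [exact: Nl_smooth | exact: hl_smooth].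
Qed.

Lemma Hc_smooth a b : smooth_on A (Hc g a b).
Proof. by move=> q Aq; apply: smooth_atB; exact: derive_Nl_hl_smooth. Qed.

(** Differentiating the lifts [hl] themselves along [vert c] produces [- vert (Gm g a c)], the
    source of the two quadratic terms. The right side is, up to sign, that of [cov_curvature] for
    horizontal [V] and [W]; hence the curvature is a fibre derivative. *)
Lemma derive_Hc_vert a b c p : A p -> 'D_(vert c) (Hc g a b) p =
  'D_(hl g a p) (Gm g b c) p - 'D_(hl g b p) (Gm g a c) p
  + Gm g a (Gm g b c p) p - Gm g b (Gm g a c p) p.
Proof.
move=> Ap.
have K a' b' : 'D_(vert c) (fun q => 'D_(hl g a' q) (Nl g b') q) p =
    'D_(hl g a' p) (Gm g b' c) p - Gm g b' (Gm g a' c p) p.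
  have hd := smooth_at_differentiable (hl_smooth a' Ap).
  have D := derive_derive_field (vert c) fEE fE (Nl_smooth b' Ap) hd.
  apply: (etrans D); rewrite addrC; congr (_ + _).
  by rewrite derive_hl_vert //; exact: GmNr.
have dN a' b' : derivable (fun q => 'D_(hl g a' q) (Nl g b') q) p (vert c).
  exact/diff_derivable/smooth_at_differentiable/derive_Nl_hl_smooth.
have D := deriveB (dN a b) (dN b a); apply: (etrans D).
apply: (etrans (congr2 (fun x y => x - y) (K a b) (K b a))).
exact: curvature_regroup2.
Qed.

(** [Gm] is [-1/2] times a second fibre derivative of [g]: the Berwald connection has no torsion. *)
Lemma Gm_sym a b q : A q -> Gm g a b q = Gm g b a q.
Proof.
move=> Aq.
have GE c d : Gm g c d q = - 2^-1 *: 'D_(vert d) ('D_(vert c) g) q.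
  have ds := smooth_at_differentiable (smooth_at_derive (vert c) (gs Aq)).
  exact: (deriveZ _ (diff_derivable ds)).
apply: (etrans (GE a b)); apply: (etrans _ (esym (GE b a))).
exact: (congr1 _ (derive_comm _ _ fE (gs Aq))).
Qed.

End Connection.

(** * Euler's relation for homogeneous functions *)

Section EulerRelation.

Lemma smooth_at_vert_snd p : smooth_at p (fun q : EE => vert q.2).
Proof. by apply: smooth_at_pair; [exact: smooth_at_cst | exact: smooth_at_psnd]. Qed.

Lemma derive_psnd v p : 'D_v (snd : EE -> E) p = v.2.
Proof. exact: (clin_derive (@snd_linear R E E) (@snd_continuous R E E)). Qed.

Lemma derive_vert_snd v p : 'D_v (fun q : EE => vert q.2) p = vert v.2.
Proof.
have sd := smooth_at_differentiable (smooth_at_psnd p).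
have D := derive_pair v (differentiable_cst (0 : E) p) sd.
rewrite derive_cst derive_psnd in D; exact: D.
Qed.

(** Differentiating Euler's identity along a constant [v] also differentiates the coefficient vector
    [(0, y)], which contributes the subtracted term. A fibre direction thus lowers the degree by
    one, while a direction [(a, 0)] keeps it. *)
Lemma euler_derive (T : normedModType R) (f : EE -> T) (k : R) v q :
  findim T -> smooth_on A f -> (forall r, A r -> 'D_(vert r.2) f r = k *: f r) ->
  A q -> 'D_(vert q.2) ('D_v f) q = k *: 'D_v f q - 'D_(vert v.2) f q.
Proof.
move=> fT fs Ef Aq.
have D := derive_derive_field v fEE fT (fs q Aq)
  (smooth_at_differentiable (smooth_at_vert_snd q)).
rewrite derive_vert_snd in D.
have D' : 'D_v (fun q => 'D_(vert q.2) f q) q = k *: 'D_v f q.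
  have fd := diff_derivable (v := v) (smooth_at_differentiable (fs q Aq)).
  apply: (etrans _ (deriveZ k fd)); exact: derive_ext_on Aq Ef.
apply: (canRL (addrK _)); rewrite addrC -D; exact: D'.
Qed.

End EulerRelation.

Section Traces.
Variable g : EE -> E.
Hypothesis gs : smooth_on A g.

Definition trH a : EE -> R^o := fun q => \sum_(i < n) Hc g a (delta_mx 0 i) q 0 i.

Lemma regroup_linB (s : R) (x y z w : E) :
  s *: x + y - (s *: z + w) = s *: (x - z) + (y - w).
Proof. by apply/rowP => i; rewrite !mxE; ring. Qed.

Lemma Hc_family b : smooth_family_on A (fun a => Hc g a b).
Proof.
split=> [a|q Aq s a c /=]; first exact: Hc_smooth.
have [_ Nlin] := Nl_family gs.
have H : hl g (s *: a + c) q = s *: hl g a q + hl g c q.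
  by rewrite /hl (Nlin q Aq) opprD -scalerN.
have D1 := derive_dirP s (hl g a q) (hl g c q) (Nl_differentiable gs b Aq).
have [_ Dl] := smooth_family_on_derive_in oA (hl g b q) (Nl_family gs).
have D2 := Dl q Aq s a c; rewrite /= in D2.
rewrite /Hc H; apply: (etrans (congr2 (fun x y => x - y) D1 D2)).
exact: regroup_linB.
Qed.

Lemma coord_linear i : linear (fun w : E => w 0 i : R^o).
Proof. by move=> s a b; rewrite !mxE. Qed.
Lemma coord_cont i : continuous (fun w : E => w 0 i : R^o).
Proof. by move=> a; exact: coord_continuous. Qed.

Lemma entry_linP (s : R) (v w : E) i : (s *: v + w) 0 i = s * v 0 i + w 0 i.
Proof. by rewrite !mxE. Qed.

Lemma trH_family : smooth_family_on A trH.
Proof.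
split=> [a q Aq|q Aq s a b].
  apply: smooth_at_sum => i.
  exact: (smooth_at_lin (coord_linear i) (@coord_cont i) (Hc_smooth gs a _ Aq)).
rewrite /trH; transitivity (\sum_(i < n) (s * Hc g a (delta_mx 0 i) q 0 i
    + Hc g b (delta_mx 0 i) q 0 i)).
  apply: eq_bigr => i _; have [_ Hl] := Hc_family (delta_mx 0 i).
  exact: (etrans (congr1 (fun w : E => w 0 i) (Hl q Aq s a b)) (entry_linP _ _ _ _)).
rewrite big_split /= -mulr_sumr; reflexivity.
Qed.

(* [R_1] in coordinates: the trace of [z |-> R(a, z) c] is
   [- 'D_(vert c) (trH a)]. *)
Definition R1l a : EE -> R^o := fun q =>
  - ((n%:R - 1)^-1 * (n%:R * 'D_(vert q.2) (trH a) q + 'D_(vert a) (trH q.2) q)).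

Lemma regroup_R1 (k m s x y z w : R) :
  - (k * (m * (s * x + y) + (s * z + w))) = s * (- (k * (m * x + z))) + - (k * (m * y + w)).
Proof. by ring. Qed.

Lemma R1l_family : smooth_family_on A R1l.
Proof.
have [ts tl] := trH_family.
have t_in v := smooth_family_on_derive_in oA v trH_family.
split=> [a q Aq|q Aq s a b].
  have s1 : smooth_at q (fun q => 'D_(vert q.2) (trH a) q).
    exact: (smooth_at_derive_field fEE (ts a q Aq) (smooth_at_vert_snd q)).
  (* The index [q.2] is frozen inside the derivative and moves only with the point of evaluation:
     the term is the family ['D_(vert a) (trH w)] taken at [w = q.2]. *)
  have s2 : smooth_at q (fun q => 'D_(vert a) (trH q.2) q).
    exact: (smooth_family_field fE (smooth_family_on_at oA (t_in (vert a)) Aq)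
      (smooth_at_psnd q)).
  exact: (smooth_atN (smooth_atZ _ (smooth_atD (smooth_atZ _ s1) s2))).
have [_ l1] := t_in (vert q.2).
have L1 := l1 q Aq s a b; rewrite /= in L1.
have td := smooth_at_differentiable (ts q.2 q Aq).
have L2 := derive_dirP s (vert a) (vert b) td; rewrite -vert_linear in L2.
rewrite /R1l; apply: (etrans (congr1 (fun x => - (_ * x)) (congr2 (fun x y => _ * x + y) L1 L2))).
exact: regroup_R1.
Qed.

End Traces.

(** * Projective change in coordinates *)

Section ProjectiveChange.
Variables (g g' : EE -> E) (lam : EE -> R^o).
Hypotheses (gs : smooth_on A g) (ls : smooth_on A lam).
Hypothesis (Eg : forall q, A q -> 'D_(vert q.2) g q = 2 *: g q).
Hypothesis (El : forall q, A q -> 'D_(vert q.2) lam q = 1 *: lam q).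
Hypothesis (gg' : forall q, A q -> g' q = g q - 2 *: (lam q *: q.2)).

Let fR : findim R^o := findim_regular.

Let dl a : EE -> R^o := 'D_(vert a) lam.

Lemma dl_smooth a : smooth_on A (dl a).
Proof. by move=> q Aq; exact: smooth_at_derive (ls Aq). Qed.

Lemma regroup_N (x y z : E) : - 2^-1 *: (x - (2 : R) *: (y + z)) = - 2^-1 *: x + (y + z).
Proof. by apply/rowP => i; rewrite !mxE; field. Qed.

(** The factor 2 in the change of the spray meets the [-1/2] in [Nl], so the difference is the fibre
    derivative of [lam] times [y] in the direction [b]. *)
Lemma Nl_projective b q : A q -> Nl g' b q = Nl g b q + (dl b q *: q.2 + lam q *: b).
Proof.
move=> Aq; rewrite /Nl.
have gd := diff_derivable (v := vert b) (smooth_at_differentiable (gs Aq)).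
have ld := smooth_at_differentiable (ls Aq).
have sd := smooth_at_differentiable (smooth_at_psnd q).
have lsd := differentiable_scalev ld sd.
have D1 := derive_scalev (vert b) ld sd; rewrite derive_psnd in D1.
have D2 := deriveZ (2 : R) (diff_derivable (v := vert b) lsd); rewrite D1 in D2.
have D3 := deriveB gd (derivableZ (k := 2) (diff_derivable (v := vert b) lsd)).
have D4 : 'D_(vert b) g' q = 'D_(vert b) g q - (2 : R) *: (dl b q *: q.2 + lam q *: b).
  apply: (etrans (derive_ext_on _ Aq gg')); apply: (etrans D3).
  exact: (congr1 (fun x => _ - x) D2).
by rewrite D4; exact: regroup_N.
Qed.

(* The 1-form in terms of which all curvatures change. *)
Definition Xi a : EE -> R^o := fun q => 'D_(hl g a q) lam q - lam q * dl a q.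

Lemma hl_lam_smooth a : smooth_on A (fun q => 'D_(hl g a q) lam q).
Proof. by move=> q Aq; exact: (smooth_at_derive_field fEE (ls Aq) (hl_smooth gs a Aq)). Qed.

Lemma Xi_smooth a : smooth_on A (Xi a).
Proof.
move=> q Aq; apply: (smooth_atB (hl_lam_smooth a Aq)).
exact: (smooth_at_scale (ls Aq) (dl_smooth a Aq)).
Qed.

Lemma hlP s a b q : A q -> hl g (s *: a + b) q = s *: hl g a q + hl g b q.
Proof.
move=> Aq; have [_ Nlin] := Nl_family gs.
by rewrite /hl (Nlin q Aq) opprD -scalerN.
Qed.

Lemma regroup_Xi (s x y z u v : R) :
  s * x + y - z * (s * u + v) = s * (x - z * u) + (y - z * v).
Proof. by ring. Qed.

Lemma Xi_family : smooth_family_on A Xi.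
Proof.
split=> [a|q Aq s a b]; first exact: Xi_smooth.
have ld := smooth_at_differentiable (ls Aq).
have D1 := derive_dirP s (hl g a q) (hl g b q) ld; rewrite -hlP // in D1.
have D2 := derive_dirP s (vert a) (vert b) ld; rewrite -vert_linear in D2.
apply: (etrans (congr2 (fun x y => x - _ * y) D1 D2)); exact: regroup_Xi.
Qed.

Lemma derive_dl_sym a b q : A q -> 'D_(vert a) (dl b) q = 'D_(vert b) (dl a) q.
Proof. by move=> Aq; exact: (derive_comm _ _ fR (ls Aq)). Qed.

Lemma euler_dl a q : A q -> 'D_(vert q.2) (dl a) q = 0.
Proof.
move=> Aq; apply: (etrans (euler_derive (vert a) fR ls El Aq)).
by rewrite scale1r; exact: subrr.
Qed.

Lemma euler_Nl a q : A q -> 'D_(vert q.2) (Nl g a) q = Nl g a q.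
Proof.
move=> Aq; have gd := smooth_at_differentiable (smooth_at_derive (vert a) (gs Aq)).
apply: (etrans (deriveZ (- 2^-1) (diff_derivable gd))).
apply: (congr1 (fun x => - 2^-1 *: x)).
apply: (etrans (euler_derive (vert a) fE gs Eg Aq)).
by rewrite scaler_nat mulr2n; exact: addrK.
Qed.

(* The difference of the vertical parts of the two horizontal lifts. *)
Let B a q : E := dl a q *: q.2 + lam q *: a.

Lemma derive_B b v q : A q ->
  'D_v (B b) q = 'D_v (dl b) q *: q.2 + dl b q *: v.2 + 'D_v lam q *: b.
Proof.
move=> Aq; have ld := smooth_at_differentiable (ls Aq).
have dd := smooth_at_differentiable (dl_smooth b Aq).
have sd := smooth_at_differentiable (smooth_at_psnd q).
have D1 := derive_scalev v dd sd; rewrite derive_psnd in D1.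
have D2 := derive_scalev v ld (differentiable_cst b q).
rewrite derive_cst scaler0 addr0 in D2.
have s1 := differentiable_scalev dd sd.
have s2 := differentiable_scalev ld (differentiable_cst b q).
apply: (etrans (deriveD (diff_derivable s1) (diff_derivable s2))).
exact: (congr2 _ D1 D2).
Qed.

Lemma derive_along_B (T : normedModType R) (f : EE -> T) a q :
  differentiable f q ->
  'D_(vert (B a q)) f q = dl a q *: 'D_(vert q.2) f q + lam q *: 'D_(vert a) f q.
Proof.
move=> fd; rewrite /B vert_linear vertZ.
have D1 := derive_dirP (dl a q) (vert q.2) (lam q *: vert a) fd.
apply: (etrans D1); apply: (congr1 (+%R _)); exact: derive_dirZ.
Qed.

Lemma B_differentiable b q : A q -> differentiable (B b) q.
Proof.
move=> Aq; have s1 := smooth_at_scale (dl_smooth b Aq) (smooth_at_psnd q).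
have s2 := smooth_at_scale (ls Aq) (smooth_at_cst q b).
exact: (smooth_at_differentiable (smooth_atD s1 s2)).
Qed.

(** The new horizontal lift is the old one minus [vert (B a q)], a combination of the directions [y]
    and [a]. Derivatives along [y] are evaluated by Euler's relation, with [Nl] and [lam] of degree
    1 and [dl] of degree 0. *)
Lemma derive_Nl_projective a b q : A q ->
  'D_(hl g' a q) (Nl g' b) q =
  ('D_(hl g a q) (Nl g b) q - (dl a q *: Nl g b q + lam q *: Gm g b a q)) +
  (('D_(hl g a q) (dl b) q *: q.2 + dl b q *: (- Nl g a q) + 'D_(hl g a q) lam q *: b) -
   ((lam q * 'D_(vert a) (dl b) q) *: q.2 + dl b q *: B a q
     + (dl a q * lam q + lam q * dl a q) *: b)).
Proof.
move=> Aq.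
have hE : hl g' a q = hl g a q - vert (B a q).
  by rewrite /hl Nl_projective // /B /vert -[RHS]/(_ - _, _ - _) subr0 opprD.
have Nd := Nl_differentiable gs b Aq; have Bd := B_differentiable b Aq.
have D1 := derive_ext_on (hl g' a q) Aq (@Nl_projective b).
have D2 := deriveD (diff_derivable (v := hl g' a q) Nd) (diff_derivable (v := hl g' a q) Bd).
apply: (etrans D1); apply: (etrans D2); rewrite hE.
have D3 := derive_dirB (hl g a q) (vert (B a q)) Nd.
have D4 := derive_dirB (hl g a q) (vert (B a q)) Bd.
apply: (etrans (congr2 _ D3 D4)).
have D5 := derive_along_B a Nd; rewrite (euler_Nl b Aq) in D5.
have D6 := derive_B b (hl g a q) Aq.
have D7 := derive_B b (vert (B a q)) Aq.
have D8 := derive_along_B a (smooth_at_differentiable (dl_smooth b Aq)).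
rewrite (euler_dl b Aq) scaler0 add0r in D8.
have D9 := derive_along_B a (smooth_at_differentiable (ls Aq)).
rewrite (El Aq) scale1r in D9.
rewrite D8 D9 in D7.
by apply: (congr2 _ (congr2 _ (erefl _) (congr1 _ D5)) (congr2 _ D6 (congr1 _ D7))).
Qed.

Lemma derive_Xi a b q : A q -> 'D_(vert b) (Xi a) q =
  'D_(vert (- Gm g a b q)) lam q + 'D_(hl g a q) (dl b) q
   - (dl b q * dl a q + lam q * 'D_(vert b) (dl a) q).
Proof.
move=> Aq; have ld := smooth_at_differentiable (ls Aq).
have dd := smooth_at_differentiable (dl_smooth a Aq).
have hd := smooth_at_differentiable (hl_smooth gs a Aq).
have D1 := derive_derive_field (vert b) fEE fR (ls Aq) hd.
rewrite derive_hl_vert // in D1.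
have D2 := derive_scalev (vert b) ld dd.
have h1 := smooth_at_differentiable (hl_lam_smooth a Aq).
have h2 := differentiable_scalev ld dd.
apply: (etrans (deriveB (diff_derivable h1) (diff_derivable h2))).
exact: (congr2 (fun x y => x - y) D1 D2).
Qed.

(** The scalar [e] stands for the derivative of [lam] along [vert (- Gm g a b q)]. It occurs in both
    ['D_(vert b) (Xi a)] and ['D_(vert a) (Xi b)], because [Gm] is symmetric, and cancels in their
    difference. *)
Lemma regroup_H (dab dba y na nb gm a b : E) (la lb l pab pba qq e da db : R) :
  (dab - (la *: nb + l *: gm)) + ((pab *: y + lb *: (- na) + da *: b) -
     ((l * qq) *: y + lb *: (la *: y + l *: a) + (la * l + l * la) *: b)) -
  ((dba - (lb *: na + l *: gm)) + ((pba *: y + la *: (- nb) + db *: a) -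
     ((l * qq) *: y + la *: (lb *: y + l *: b) + (lb * l + l * lb) *: a))) =
  dab - dba +
  ((e + pab - (lb * la + l * qq) - (e + pba - (la * lb + l * qq))) *: y +
   (da - l * la) *: b - (db - l * lb) *: a).
Proof. by apply/rowP => i; rewrite !mxE; ring. Qed.

(* The terms of [Hc g'] in [Nl] cancel because [Nl] is homogeneous of degree 1
   along the fibres. *)
Lemma Hc_projective a b q : A q -> Hc g' a b q = Hc g a b q +
  (('D_(vert b) (Xi a) q - 'D_(vert a) (Xi b) q) *: q.2 + Xi a q *: b - Xi b q *: a).
Proof.
move=> Aq; have D1 := derive_Nl_projective a b Aq; have D2 := derive_Nl_projective b a Aq.
rewrite (derive_dl_sym b a Aq) in D2.
have D3 := derive_Xi a b Aq; have D4 := derive_Xi b a Aq.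
rewrite (derive_dl_sym b a Aq) in D3; rewrite (Gm_sym gs b a Aq) in D1 D4.
apply: (etrans (congr2 (fun x y => x - y) D1 D2)).
apply: (etrans (regroup_H _ _ _ _ _ _ _ _ _ _ _ _ _ _ ('D_(vert (- Gm g a b q)) lam q) _ _)).
apply: (congr1 (+%R _)); apply: (congr1 (fun x => x *: q.2 + _ - _)).
exact: (congr2 (fun x y => x - y) (esym D3) (esym D4)).
Qed.

Lemma lin_coords (T : normedModType R) (L : E -> T) (w : E) : linear L ->
  \sum_(i < n) w 0 i *: L (delta_mx 0 i) = L w.
Proof.
move=> Ll; apply: esym.
exact: (linear_findim (co := fun i (v : E) => v 0 i : R^o) (row_sum_delta w) Ll).
Qed.

Lemma regroup_euler_Xi (x y l m : R) : x + (y - x) - (l * m + l * 0) = y - l * m.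
Proof. by ring. Qed.

Lemma regroup_trH (h y a : E) (x z u v : R) i :
  (h + ((x - z) *: y + u *: delta_mx 0 i - v *: a)) 0 i =
  h 0 i + ((y 0 i * x - y 0 i * z) + (u - a 0 i * v)).
Proof. by rewrite !mxE !eqxx /=; ring. Qed.

Lemma regroup_trH2 (m : nat) (x y : R) : x - y + (x *+ m - x) = m%:R * x - y.
Proof. by rewrite -mulr_natl; ring. Qed.

Lemma regroup_R1l (m s s' t t' u v w1 w2 z : R) : m - 1 != 0 ->
  s' = s + (m * u - (v + w1)) -> t' = t + (m * v - (z + w2)) ->
  z = u -> w1 = 0 -> w2 = 0 ->
  - ((m - 1)^-1 * (m * s' + t')) = - ((m - 1)^-1 * (m * s + t)) - (m + 1) * u.
Proof. by move=> m0 -> -> -> -> ->; field. Qed.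

(** Commuting the derivative along [y] with the horizontal one costs a term in [Nl g a], cancelled
    by the derivative of the lift since [Gm g a y = Nl g a]. So horizontal differentiation preserves
    the degree 1 of [lam], and [lam] times [dl a] has degree 1 + 0. *)
Lemma euler_Xi a q : A q -> 'D_(vert q.2) (Xi a) q = Xi a q.
Proof.
move=> Aq; have D := derive_Xi a q.2 Aq; apply: (etrans D).
have ld := smooth_at_differentiable (ls Aq).
have D1 := euler_derive (hl g a q) fR ls El Aq; rewrite scale1r in D1.
have D2 := derive_comm (hl g a q) (vert q.2) fR (ls Aq).
have D3 : Gm g a q.2 q = Nl g a q := euler_Nl a Aq.
have D4 := euler_dl a Aq.
have D5 : dl q.2 q = lam q := etrans (El Aq) (scale1r _).
have D6 : 'D_(vert (- Nl g a q)) lam q = 'D_(vert (hl g a q).2) lam q by [].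
have D7 : 'D_(hl g a q) (dl q.2) q = 'D_(hl g a q) lam q - 'D_(vert (- Nl g a q)) lam q.
  exact: (etrans D2 D1).
rewrite D3 D7 D4 D5.
exact: regroup_euler_Xi.
Qed.

(** In the trace over [b] of the change of [Hc], the part along [y] gives [Xi a], by Euler's
    relation, minus ['D_(vert a) (Xi q.2)]; the part along [b] gives [n] copies of [Xi a], and the
    part along [a] gives [- Xi a], which cancels the first. *)
Lemma trH_projective a q : A q -> trH g' a q =
  trH g a q + (n%:R * Xi a q - 'D_(vert a) (Xi q.2) q).
Proof.
move=> Aq; have [Xs Xl] := Xi_family.
have XqL : linear (Xi ^~ q) := Xl q Aq.
have Xd := smooth_at_differentiable (Xs a q Aq).
have dXl : linear (fun w => 'D_(vert w) (Xi a) q).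
  by move=> s b c; rewrite vert_linear; exact: derive_dirP.
have [_ Xl'] := smooth_family_on_derive_in oA (vert a) Xi_family.
have S1 := lin_coords q.2 dXl; rewrite /= (euler_Xi a Aq) in S1.
have S2 := lin_coords q.2 (Xl' q Aq).
have S3 := lin_coords a XqL.
transitivity (\sum_(i < n) (Hc g a (delta_mx 0 i) q 0 i +
   ((q.2 0 i * 'D_(vert (delta_mx 0 i)) (Xi a) q - q.2 0 i * 'D_(vert a) (Xi (delta_mx 0 i)) q)
    + (Xi a q - a 0 i * Xi (delta_mx 0 i) q)))).
  apply: eq_bigr => i _.
  apply: (etrans (congr1 (fun w : E => w 0 i) (Hc_projective a (delta_mx 0 i) Aq))).
  exact: regroup_trH.
rewrite big_split /= big_split /= sumrB sumrB sumr_const card_ord.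
apply: (congr1 (+%R _)).
apply: (etrans (congr2 (fun x y => x + y) (congr2 (fun x y => x - y) S1 S2)
  (congr2 (fun x y => x - y) (erefl (Xi a q *+ n)) S3))).
exact: regroup_trH2.
Qed.

(** The index [r.2] moves together with the point, so the Leibniz rule for families gives two
    terms. *)
Lemma derive_Xi_snd a c q : A q ->
  'D_(vert c) (fun r => 'D_(vert a) (Xi r.2) r) q =
  'D_(vert a) (Xi c) q + 'D_(vert c) ('D_(vert a) (Xi q.2)) q.
Proof.
move=> Aq; have F := smooth_family_on_at oA
  (smooth_family_on_derive_in oA (vert a) Xi_family) Aq.
have D := derive_family (vert c) fE F (smooth_at_differentiable (smooth_at_psnd q)).
rewrite derive_psnd in D; exact: D.
Qed.

Lemma derive_trH_projective a c q : A q -> 'D_(vert c) (trH g' a) q =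
  'D_(vert c) (trH g a) q + (n%:R * 'D_(vert c) (Xi a) q -
   ('D_(vert a) (Xi c) q + 'D_(vert c) ('D_(vert a) (Xi q.2)) q)).
Proof.
move=> Aq; have [ts _] := trH_family gs; have [Xs Xl] := Xi_family.
have td := diff_derivable (v := vert c) (smooth_at_differentiable (ts a q Aq)).
have Xd := diff_derivable (v := vert c) (smooth_at_differentiable (Xs a q Aq)).
have F := smooth_family_on_at oA (smooth_family_on_derive_in oA (vert a) Xi_family) Aq.
have Fd := diff_derivable (v := vert c)
  (smooth_at_differentiable (smooth_family_field fE F (smooth_at_psnd q))).
have Zd := derivableZ (k := n%:R) Xd.
have D := derive_ext_on (vert c) Aq (@trH_projective a); apply: (etrans D).
have D1 := deriveD td (derivableB Zd Fd); apply: (etrans D1).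
apply: (congr1 (+%R _)); apply: (etrans (deriveB Zd Fd)).
exact: (congr2 (fun x y => x - y) (deriveZ n%:R Xd) (derive_Xi_snd a c Aq)).
Qed.

Lemma euler_dXi a w q : A q -> 'D_(vert q.2) ('D_(vert a) (Xi w)) q = 0.
Proof.
move=> Aq; have [Xs _] := Xi_family.
have EX r : A r -> 'D_(vert r.2) (Xi w) r = 1 *: Xi w r.
  by move=> Ar; rewrite scale1r; exact: euler_Xi.
apply: (etrans (euler_derive (vert a) fR (Xs w) EX Aq)).
by rewrite scale1r; exact: subrr.
Qed.

(** With [u = Xi a] and [v = 'D_(vert a) (Xi q.2)], the two fibre derivatives of traces in [R1l]
    change by [n u - v] and [n v - u]; the second derivatives of [Xi] that also occur vanish by
    homogeneity. Then [n (n u - v) + (n v - u) = (n^2 - 1) u], and the division by [n - 1] leaves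
    [n + 1]. *)
Lemma R1l_projective a q : (1 < n)%N -> A q ->
  R1l g' a q = R1l g a q - (n%:R + 1) * Xi a q.
Proof.
move=> n1 Aq; have [Xs Xl] := Xi_family.
have m0 : n%:R - 1 != 0 :> R by rewrite subr_eq0 pnatr_eq1 gtn_eqF.
have D1 := derive_trH_projective a q.2 Aq.
have EX := euler_Xi a Aq; have D1' : 'D_(vert q.2) (trH g' a) q =
  'D_(vert q.2) (trH g a) q + (n%:R * Xi a q -
   ('D_(vert a) (Xi q.2) q + 'D_(vert q.2) ('D_(vert a) (Xi q.2)) q)).
  apply: (etrans D1); exact: (congr1 (fun x => _ + (_ * x - _)) EX).
have D2 := derive_trH_projective q.2 a Aq.
have C := derive_comm (vert a) (vert q.2) fR (Xs q.2 q Aq).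
have Z := euler_dXi a q.2 Aq.
exact: (regroup_R1l m0 D1' D2 EX Z (etrans C Z)).
Qed.

(* Coordinate expressions of the curvature of the Berwald connection, of the
   vertical derivative of [R_1] and of the Weyl tensor. *)
Definition Rl g a b c : EE -> E := fun q => - 'D_(vert c) (Hc g a b) q.

Definition D2R1l g a b : EE -> R^o := 'D_(vert a) (R1l g b).

Definition weyll g a b c : EE -> E := fun q =>
  Rl g a b c q + (n%:R + 1)^-1 *:
   ((D2R1l g c b q *: a + D2R1l g a b q *: c + 'D_(vert c) (D2R1l g a b) q *: q.2) -
    (D2R1l g c a q *: b + D2R1l g b a q *: c + 'D_(vert c) (D2R1l g b a) q *: q.2)).

Lemma D2R1l_projective a b q : (1 < n)%N -> A q ->
  D2R1l g' a b q = D2R1l g a b q - (n%:R + 1) * 'D_(vert a) (Xi b) q.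
Proof.
move=> n1 Aq; have [Xs _] := Xi_family; have [Rs _] := R1l_family gs.
have Rd := diff_derivable (v := vert a) (smooth_at_differentiable (Rs b q Aq)).
have Xd := diff_derivable (v := vert a) (smooth_at_differentiable (Xs b q Aq)).
have Zd := derivableZ (k := n%:R + 1) Xd.
have D := derive_ext_on (vert a) Aq (fun r Ar => R1l_projective b n1 Ar).
apply: (etrans D); apply: (etrans (deriveB Rd Zd)).
exact: (congr1 (fun x => _ - x) (deriveZ (n%:R + 1) Xd)).
Qed.

Lemma derive_D2R1l_projective a b c q : (1 < n)%N -> A q ->
  'D_(vert c) (D2R1l g' a b) q =
  'D_(vert c) (D2R1l g a b) q - (n%:R + 1) * 'D_(vert c) ('D_(vert a) (Xi b)) q.
Proof.
move=> n1 Aq; have [Xs _] := Xi_family; have [Rs _] := R1l_family gs.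
have Rd := diff_derivable (v := vert c)
  (smooth_at_differentiable (smooth_at_derive (vert a) (Rs b q Aq))).
have Xd := diff_derivable (v := vert c)
  (smooth_at_differentiable (smooth_at_derive (vert a) (Xs b q Aq))).
have Zd := derivableZ (k := n%:R + 1) Xd.
have D := derive_ext_on (vert c) Aq (fun r Ar => D2R1l_projective a b n1 Ar).
apply: (etrans D); apply: (etrans (deriveB Rd Zd)).
exact: (congr1 (fun x => _ - x) (deriveZ (n%:R + 1) Xd)).
Qed.

(** This is the fibre derivative of [Hc_projective]: the term along [c] comes from differentiating
    the factor [q.2], the others from differentiating [Xi]. *)
Lemma Rl_projective a b c q : A q -> Rl g' a b c q = Rl g a b c q -
  (('D_(vert c) ('D_(vert b) (Xi a)) q - 'D_(vert c) ('D_(vert a) (Xi b)) q) *: q.2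
   + ('D_(vert b) (Xi a) q - 'D_(vert a) (Xi b) q) *: c
   + 'D_(vert c) (Xi a) q *: b - 'D_(vert c) (Xi b) q *: a).
Proof.
move=> Aq; have [Xs _] := Xi_family.
have d1 := smooth_at_differentiable (Xs a q Aq).
have d2 := smooth_at_differentiable (Xs b q Aq).
have x1 := smooth_at_derive (vert b) (Xs a q Aq).
have x2 := smooth_at_derive (vert a) (Xs b q Aq).
have d3 := smooth_at_differentiable x1; have d4 := smooth_at_differentiable x2.
have d5 := differentiableB d3 d4.
have sd := smooth_at_differentiable (smooth_at_psnd q).
have Hd := smooth_at_differentiable (Hc_smooth gs a b Aq).
have e1 := differentiable_scalev d5 sd.
have e2 := differentiable_scalev d1 (differentiable_cst b q).
have e3 := differentiable_scalev d2 (differentiable_cst a q).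
have e12 := differentiableD e1 e2.
have e123 := differentiableB e12 e3.
have D := derive_ext_on (vert c) Aq (fun r Ar => Hc_projective a b Ar).
have D1 := deriveD (diff_derivable (v := vert c) Hd) (diff_derivable (v := vert c) e123).
have D2 := deriveB (diff_derivable (v := vert c) e12) (diff_derivable (v := vert c) e3).
have D3 := deriveD (diff_derivable (v := vert c) e1) (diff_derivable (v := vert c) e2).
have D4 := derive_scalev (vert c) d5 sd; rewrite derive_psnd in D4.
have D5 := derive_scalev (vert c) d1 (differentiable_cst b q).
rewrite derive_cst scaler0 addr0 in D5.
have D6 := derive_scalev (vert c) d2 (differentiable_cst a q).
rewrite derive_cst scaler0 addr0 in D6.
have D7 := deriveB (diff_derivable (v := vert c) d3) (diff_derivable (v := vert c) d4).
rewrite /Rl; apply: (etrans (congr1 -%R (etrans D D1))).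
apply: (etrans (opprD _ _)); apply: (congr1 (fun x => _ - x)).
apply: (etrans D2); apply: (congr2 (fun x y => x - y)); last exact: D6.
apply: (etrans D3); apply: (congr2 (fun x y => x + y)); last exact: D5.
by apply: (etrans D4); apply: (congr1 (fun x => x *: q.2 + _)); exact: D7.
Qed.

Lemma regroup_weyl (r r' y a b c : E)
    (k x1 x2 x3 x4 x5 x6 x1' x2' x3' x4' x5' x6' z1 z2 z3 z4 z5 z6 : R) :
  k != 0 ->
  r' = r - ((z5 - z6) *: y + (z3 - z4) *: c + z1 *: b - z2 *: a) ->
  x1' = x1 - k * z1 -> x2' = x2 - k * z2 -> x3' = x3 - k * z3 ->
  x4' = x4 - k * z4 -> x5' = x5 - k * z5 -> x6' = x6 - k * z6 ->
  r' + k^-1 *: ((x2' *: a + x4' *: c + x6' *: y) - (x1' *: b + x3' *: c + x5' *: y)) =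
  r + k^-1 *: ((x2 *: a + x4 *: c + x6 *: y) - (x1 *: b + x3 *: c + x5 *: y)).
Proof. by move=> k0 -> -> -> -> -> -> ->; apply/rowP => i; rewrite !mxE; field. Qed.

(** The curvature changes by a combination of [a], [b], [c] and [y] whose coefficients are first and
    second fibre derivatives of [Xi]. The matching derivatives of [R1l] change by [- (n + 1)] times
    the same quantities, so with the factor [(n + 1)^-1] each of the four coefficients cancels
    separately. *)
Lemma weyl_projective a b c q : (1 < n)%N -> A q -> weyll g' a b c q = weyll g a b c q.
Proof.
move=> n1 Aq.
have k0 : n%:R + 1 != 0 :> R by rewrite natr1 pnatr_eq0.
exact: (regroup_weyl k0 (Rl_projective a b c Aq)
  (D2R1l_projective c a n1 Aq) (D2R1l_projective c b n1 Aq)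
  (D2R1l_projective b a n1 Aq) (D2R1l_projective a b n1 Aq)
  (derive_D2R1l_projective b a c n1 Aq) (derive_D2R1l_projective a b c n1 Aq)).
Qed.

End ProjectiveChange.

End LocalSpray.

(** * The Berwald connection in a chart *)

Section SprayOperators.
Context {R : realType} {n : nat} {M : manifold R n}.
Local Notation E := 'rV[R]_n.
Local Notation EE := ('rV[R]_n * 'rV[R]_n)%type.
Implicit Types (u : TM M) (p q : EE).

Opaque derive trans vf_in pvf_in tcoord tinv.

Lemma pvf_inD (c : chart R n M) p (X Y : pvfield M) : atlas c -> cbase c p ->
  pvf_in c (fun u => X u + Y u) p = pvf_in c X p + pvf_in c Y p.
Proof.
move=> ac cp; have [_ ac' _ _] := overlap_chart_at ac cp.
have [cx _] := cinvK cp.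
exact: (derive_dirD _ _ (tchange_differentiable ac' ac (chart_at_dom _) cx)).
Qed.

Lemma pvf_inN (c : chart R n M) p (X : pvfield M) : atlas c -> cbase c p ->
  pvf_in c (fun u => - X u) p = - pvf_in c X p.
Proof.
move=> ac cp; have [_ ac' _ _] := overlap_chart_at ac cp.
have [cx _] := cinvK cp.
exact: (derive_dirN _ (tchange_differentiable ac' ac (chart_at_dom _) cx)).
Qed.

Lemma pvf_inZ (c : chart R n M) p (a : TM M -> R) (X : pvfield M) : atlas c -> cbase c p ->
  pvf_in c (fun u => a u *: X u) p = a (tinv c p) *: pvf_in c X p.
Proof.
move=> ac cp; have [_ ac' _ _] := overlap_chart_at ac cp.
have [cx _] := cinvK cp.
exact: (derive_dirZ _ _ (tchange_differentiable ac' ac (chart_at_dom _) cx)).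
Qed.

Definition pvf_lift (c : chart R n M) (F : EE -> E) : pvfield M := fun u =>
  tchange c (chart_at u.1) u.1 (F (tcoord c u)).

Lemma pvf_lift_in (c : chart R n M) F p : atlas c -> cbase c p ->
  pvf_in c (pvf_lift c F) p = F p.
Proof.
move=> ac cp; have [_ ac' _ dx] := overlap_chart_at ac cp.
have [cx _] := cinvK cp.
apply: (etrans (tchange_chain _ ac ac' ac cx dx cx)).
by rewrite tchange_id // tcoordK.
Qed.

(** The nonzero vectors over the domain of [c], read in the bundle chart. Fibre coordinates change
    linearly and invertibly, so being nonzero can be tested in any chart. *)
Definition sdom (c : chart R n M) : set EE := [set p | cbase c p /\ p.2 != 0].

Lemma sdom_open c : open (sdom c).
Proof.
rewrite (_ : sdom c = cbase c `&` (snd @^-1` [set~ 0])); last first.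
  by apply/seteqP; split=> p [cp] /eqP.
apply: openI; first exact: cbase_open.
apply: open_comp => [p _|]; first exact: cvg_snd.
by apply: closed_openC; exact/accessible_closed_set1/hausdorff_accessible/norm_hausdorff.
Qed.

Lemma slit_tinv c p : atlas c -> sdom c p -> slit (tinv c p).
Proof.
move=> ac [cp p0]; apply/eqP => u0; move/eqP: p0; apply.
have := tcoordK ac cp; move/(congr1 snd) => <-.
rewrite -[X in X = _]/(tchange _ _ _ (tinv c p).2) u0; exact: derive0.
Qed.

Lemma sdom_tcoord c u : atlas c -> cdom c u.1 -> slit u -> sdom c (tcoord c u).
Proof.
move=> ac cu su; split; first exact: cbase_tcoord.
apply/eqP => p0; move/eqP: su; apply.
have := tinvK ac cu; move/(congr1 snd) => <-.
rewrite -[X in X = _]/(tchange _ _ _ (tcoord c u).2) p0; exact: derive0.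
Qed.

Lemma smooth_vf_near_in c p (X : vfield M) : atlas c -> cbase c p ->
  smooth_vf_near (tinv c p) X -> smooth_at p (vf_in c X).
Proof.
move=> ac cp Xs; have o := overlap_chart_at ac cp; have o' := overlap_sym o.
have := smooth_vf_change o' Xs; rewrite (transKK o); exact.
Qed.

Lemma smooth_vf_in_near c p (X : vfield M) : atlas c -> cbase c p ->
  smooth_at p (vf_in c X) -> smooth_vf_near (tinv c p) X.
Proof. by move=> ac cp Xs; exact: (smooth_vf_change (overlap_chart_at ac cp) Xs). Qed.

Lemma smooth_pvf_near_in c p (X : pvfield M) : atlas c -> cbase c p ->
  smooth_pvf_near (tinv c p) X -> smooth_at p (pvf_in c X).
Proof.
move=> ac cp Xs; have o := overlap_chart_at ac cp; have o' := overlap_sym o.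
have := smooth_pvf_change o' Xs; rewrite (transKK o); exact.
Qed.

Lemma smooth_fun_near_in c p (f : TM M -> R) : atlas c -> cbase c p ->
  smooth_fun_near (tinv c p) f -> smooth_at p (f \o tinv c : EE -> R^o).
Proof.
move=> ac cp Xs; have o := overlap_chart_at ac cp; have o' := overlap_sym o.
have := smooth_fun_change o' Xs; rewrite (transKK o); exact.
Qed.

Lemma vf_lift_smooth c F p : atlas c -> cbase c p -> smooth_at p F ->
  smooth_at p (vf_in c (vf_lift c F : vfield M)).
Proof.
move=> ac cp Fs; apply: smooth_at_near_eq Fs.
exact: (open_near (@cbase_open _ _ _ c) cp (fun q cq => esym (vf_lift_in F ac cq))).
Qed.

Lemma pvf_lift_smooth c F p : atlas c -> cbase c p -> smooth_at p F ->
  smooth_at p (pvf_in c (pvf_lift c F)).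
Proof.
move=> ac cp Fs; apply: smooth_at_near_eq Fs.
exact: (open_near (@cbase_open _ _ _ c) cp (fun q cq => esym (pvf_lift_in F ac cq))).
Qed.

Lemma smooth_vf_in c p (X : vfield M) : atlas c -> sdom c p -> smooth_vf X ->
  smooth_at p (vf_in c X).
Proof.
move=> ac Ap Xs; have [cp _] := Ap; apply: smooth_vf_near_in cp _ => //.
exact/Xs/slit_tinv.
Qed.

Lemma Liouville_in c p : atlas c -> cbase c p ->
  vf_in c (Liouville : vfield M) p = vert p.2.
Proof. by move=> ac cp; rewrite (gamma_in _ ac cp) (eta_in ac cp). Qed.

(* In every chart [G = (y, g)] with [g] homogeneous of degree 2. *)
Definition is_spray (G : vfield M) : Prop :=
  [/\ smooth_vf G,
      forall c p, atlas c -> sdom c p -> (vf_in c G p).1 = p.2 &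
      forall c p, atlas c -> sdom c p ->
        'D_(vert p.2) (fun q => (vf_in c G q).2) p = 2 *: (vf_in c G p).2].

Section Operators.
Variables (G : vfield M) (c : chart R n M).
Hypotheses (Gspray : is_spray G) (ac : atlas c).

Let A := sdom c.
Let oA : open A := @sdom_open c.

Lemma sdom_cbase p : A p -> cbase c p. Proof. by case. Qed.

Definition spray_coef p : E := (vf_in c G p).2.
Local Notation g := spray_coef.

Lemma spray_smooth p : A p -> smooth_at p (vf_in c G).
Proof. by move=> Ap; have [Gs _ _] := Gspray; exact: smooth_vf_in. Qed.

Lemma spray_coef_smooth : smooth_on A g.
Proof. by move=> p Ap; exact: smooth_at_snd (spray_smooth Ap). Qed.

Lemma spray_in p : A p -> vf_in c G p = (p.2, g p).
Proof.
move=> Ap; have [_ G1 _] := Gspray.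
by rewrite [LHS]surjective_pairing; apply: (congr1 (pair^~ _)); exact: G1.
Qed.

Lemma derive_spray p v : A p -> 'D_v (vf_in c G) p = (v.2, 'D_v g p).
Proof.
move=> Ap; have Gd := smooth_at_differentiable (spray_smooth Ap).
rewrite [LHS]surjective_pairing -(derive_snd _ Gd) -(derive_fst _ Gd).
apply: (congr1 (pair^~ _)); apply: (etrans _ (derive_psnd v p)).
apply: (derive_ext_on oA _ Ap) => q Aq.
by rewrite spray_in.
Qed.

Lemma J_smooth p X : cbase c p -> smooth_at p (vf_in c X) -> smooth_at p (vf_in c (J X)).
Proof.
move=> cp Xs.
have s : smooth_at p (fun q => vert (vf_in c X q).1).
  exact: (smooth_at_pair (smooth_at_cst p (0 : E)) (smooth_at_fst Xs)).
apply: smooth_at_near_eq s.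
exact: (open_near (@cbase_open _ _ _ c) cp (fun q cq => esym (J_in X ac cq))).
Qed.

Lemma derive_J p X v : cbase c p -> smooth_at p (vf_in c X) ->
  'D_v (vf_in c (J X)) p = vert ('D_v (vf_in c X) p).1.
Proof.
move=> cp Xs; have Xd := smooth_at_differentiable Xs.
apply: (etrans (derive_ext_on (@cbase_open _ _ _ c) v cp (fun q cq => J_in X ac cq))).
have fd := smooth_at_differentiable (smooth_at_fst Xs).
have D := derive_pair v (differentiable_cst (0 : E) p) fd.
by rewrite derive_cst derive_fst // in D; exact: D.
Qed.

Lemma regroup_barthel (a e x y : E) :
  ((a, e) : EE) - vert x - vert (y - x) = (a, e - y).
Proof.
rewrite /vert -[LHS]/((a - 0 - 0, e - x - (y - x)) : EE) !subr0.
by rewrite opprB addrA subrK.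
Qed.

(** The derivative along [G] of the first component of [X] enters both [[J X, G]] and [J [X, G]] and
    cancels in their difference, so only the value of [X] at the point survives. *)
Lemma barthel_in p X : A p -> smooth_at p (vf_in c X) ->
  vf_in c (barthel G X) p =
  ((vf_in c X p).1, 'D_(vert (vf_in c X p).1) g p - (vf_in c X p).2).
Proof.
move=> Ap Xs; have cp := sdom_cbase Ap; have Gs := spray_smooth Ap.
have L1 := lie_in ac cp (J_smooth cp Xs) Gs.
have L2 := lie_in ac cp Xs Gs.
have L3 := J_in (lie X G) ac cp.
have D1 : 'D_(vf_in c (J X) p) (vf_in c G) p =
    ((vf_in c X p).1, 'D_(vert (vf_in c X p).1) g p).
  exact: (etrans (congr1 (fun v => 'D_v (vf_in c G) p) (J_in X ac cp)) (derive_spray _ Ap)).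
have D2 := derive_J (vf_in c G p) cp Xs.
have L2' := etrans L2 (congr1 (fun x => x - _) (derive_spray (vf_in c X p) Ap)).
have L2'' := congr1 (fun x : EE => vert x.1) L2'.
apply: (etrans (vf_inB _ _ ac cp)).
apply: (etrans (congr2 (fun x y => x - y) (etrans L1 (congr2 (fun x y => x - y) D1 D2))
  (etrans L3 L2''))).
exact: regroup_barthel.
Qed.

Lemma regroup_hproj (a b e : E) :
  2^-1 *: (((a, b) : EE) + (a, e - b)) = (a, - (- 2^-1 *: e)).
Proof.
rewrite -[LHS]/((2^-1 *: (a + a), 2^-1 *: (b + (e - b))) : EE) scaleNr opprK.
rewrite [b + _]addrC subrK; congr (_, _).
by apply/rowP => i; rewrite !mxE; field.
Qed.

Lemma regroup_vproj (a b e : E) :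
  2^-1 *: (((a, b) : EE) - (a, e - b)) = vert (b + - 2^-1 *: e).
Proof.
rewrite -[LHS]/((2^-1 *: (a - a), 2^-1 *: (b - (e - b))) : EE) subrr scaler0.
rewrite /vert; congr (_, _); by apply/rowP => i; rewrite !mxE; field.
Qed.

Lemma hproj_in p X : A p -> smooth_at p (vf_in c X) ->
  vf_in c (hproj G X) p = hl g (vf_in c X p).1 p.
Proof.
move=> Ap Xs; have cp := sdom_cbase Ap.
have E1 := vf_inZ (fun=> 2^-1) (fun u => X u + barthel G X u) ac cp; apply: (etrans E1).
have E2 := vf_inD X (barthel G X) ac cp.
have E3 := etrans E2 (congr1 (fun x => _ + x) (barthel_in Ap Xs)).
apply: (etrans (congr1 (fun x => 2^-1 *: x) E3)).
rewrite {1}[vf_in c X p]surjective_pairing; exact: regroup_hproj.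
Qed.

Lemma vproj_in p X : A p -> smooth_at p (vf_in c X) ->
  vf_in c (vproj G X) p = vert ((vf_in c X p).2 + Nl g (vf_in c X p).1 p).
Proof.
move=> Ap Xs; have cp := sdom_cbase Ap.
have E1 := vf_inZ (fun=> 2^-1) (fun u => X u - barthel G X u) ac cp; apply: (etrans E1).
have E2 := vf_inB X (barthel G X) ac cp.
have E3 := etrans E2 (congr1 (fun x => _ - x) (barthel_in Ap Xs)).
apply: (etrans (congr1 (fun x => 2^-1 *: x) E3)).
rewrite {1}[vf_in c X p]surjective_pairing; exact: regroup_vproj.
Qed.

(** [beta] is a choice with default value 0, so existence has to be shown: [h] applied to the field
    with constant components [(X, 0)] in the chart [c] has the required image under [rho]. *)
Lemma beta_spec p (X : pvfield M) : A p -> exists w : EE,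
  rho_at (tinv c p) w = X (tinv c p) /\
  exists2 Y, smooth_vf_near (tinv c p) Y & hproj G Y (tinv c p) = w.
Proof.
move=> Ap; have cp := sdom_cbase Ap.
pose Y : vfield M := vf_lift c (fun=> (pvf_in c X p, 0)).
have Ys : smooth_at p (vf_in c Y) := vf_lift_smooth ac cp (smooth_at_cst p _).
exists (hproj G Y (tinv c p)); split; last by exists Y; [exact: smooth_vf_in_near |].
apply: (@pvf_in_inj _ _ _ c p (rho (hproj G Y)) X ac cp).
apply: (etrans (rho_in _ ac cp)); apply: (etrans (congr1 fst (hproj_in Ap Ys))).
exact: (congr1 fst (vf_lift_in (fun=> (pvf_in c X p, 0)) ac cp)).
Qed.

Lemma beta_in p (X : pvfield M) : A p -> vf_in c (beta G X) p = hl g (pvf_in c X p) p.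
Proof.
move=> Ap; have cp := sdom_cbase Ap.
have [H1 [Y Ys H2]] := xgetPex (0 : EE) (beta_spec X Ap).
have Ys' := smooth_vf_near_in ac cp Ys.
have E1 : vf_in c (beta G X) p = vf_in c (hproj G Y) p by apply: vf_in_eq; rewrite H2.
have E2 := hproj_in Ap Ys'; apply: (etrans E1); apply: (etrans E2).
(* Uniqueness: a vector in the image of [h] is the horizontal lift of its first component, and [rho]
   prescribes that component. *)
apply: (congr1 (fun a => hl g a p)).
have E3 : (vf_in c (beta G X) p).1 = pvf_in c X p.
  by apply: (etrans (esym (rho_in _ ac cp))); apply: pvf_in_eq; exact: H1.
exact: (etrans (esym (congr1 fst (etrans E1 E2))) E3).
Qed.

Lemma beta_smooth p (X : pvfield M) : A p -> smooth_at p (pvf_in c X) ->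
  smooth_at p (vf_in c (beta G X)).
Proof.
move=> Ap Xs.
have s : smooth_at p (fun q => hl g (pvf_in c X q) q).
  apply: (smooth_at_pair Xs); apply: smooth_atN.
  exact: (smooth_family_field findim_E
    (smooth_family_on_at oA (Nl_family spray_coef_smooth) Ap) Xs).
apply: smooth_at_near_eq s.
exact: (open_near oA Ap (fun q Aq => esym (beta_in X Aq))).
Qed.

Lemma derive_Nl_field p (X : EE -> E) v : A p -> differentiable X p ->
  'D_v (fun q => Nl g (X q) q) p = Nl g ('D_v X p) p + 'D_v (Nl g (X p)) p.
Proof.
move=> Ap Xd; apply: derive_family => //; first exact: findim_E.
exact: (smooth_family_on_at oA (Nl_family spray_coef_smooth) Ap).
Qed.

Lemma derive_beta p (X : pvfield M) v : A p -> smooth_at p (pvf_in c X) ->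
  'D_v (vf_in c (beta G X)) p = ('D_v (pvf_in c X) p,
    - (Nl g ('D_v (pvf_in c X) p) p + 'D_v (Nl g (pvf_in c X p)) p)).
Proof.
move=> Ap Xs; have Xd := smooth_at_differentiable Xs.
apply: (etrans (derive_ext_on oA v Ap (fun q Aq => beta_in X Aq))).
have Nd := smooth_at_differentiable (smooth_family_field findim_E
    (smooth_family_on_at oA (Nl_family spray_coef_smooth) Ap) Xs).
apply: (etrans (derive_pair v Xd (differentiableN Nd))); apply: (congr1 (pair _)).
apply: (etrans (deriveN (diff_derivable Nd))).
exact: (congr1 -%R (derive_Nl_field v Ap Xd)).
Qed.

(** The vertical part is the vertical lift of exactly one vector: the local field with constant
    components [k] gives existence, and injectivity of [gamma] gives uniqueness. *)
Lemma Kmap_in p X : A p -> smooth_at p (vf_in c X) ->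
  pvf_in c (Kmap G X) p = (vf_in c X p).2 + Nl g (vf_in c X p).1 p.
Proof.
move=> Ap Xs; have cp := sdom_cbase Ap; have V := vproj_in Ap Xs.
set k := _ + _ in V *.
have ex : exists w : E, gamma_at (tinv c p) w = vproj G X (tinv c p).
  exists (pvf_lift c (fun=> k) (tinv c p)).
  apply: (@vf_in_inj _ _ _ c p (gamma (pvf_lift c (fun=> k))) (vproj G X) ac cp).
  apply: (etrans (gamma_in _ ac cp)); apply: (etrans _ (esym V)).
  exact: (congr1 vert (pvf_lift_in (fun=> k) ac cp)).
have H := xgetPex (0 : E) ex.
have E1 : vf_in c (gamma (Kmap G X)) p = vf_in c (vproj G X) p by apply: vf_in_eq; exact: H.
exact: (congr1 snd (etrans (esym (gamma_in (Kmap G X) ac cp)) (etrans E1 V))).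
Qed.

Lemma Kmap_smooth p X : A p -> smooth_at p (vf_in c X) ->
  smooth_at p (pvf_in c (Kmap G X)).
Proof.
move=> Ap Xs.
have s : smooth_at p (fun q => (vf_in c X q).2 + Nl g (vf_in c X q).1 q).
  apply: smooth_atD; first exact: smooth_at_snd.
  exact: (smooth_family_field findim_E
    (smooth_family_on_at oA (Nl_family spray_coef_smooth) Ap) (smooth_at_fst Xs)).
apply: smooth_at_near_eq s.
have nX := smooth_at_near Xs; have nA := open_near oA Ap (fun q (Aq : A q) => Aq).
by apply: filterS (filterI nX nA) => q [Xq Aq]; rewrite (Kmap_in Aq Xq).
Qed.

Lemma gamma_smooth p (X : pvfield M) : cbase c p -> smooth_at p (pvf_in c X) ->
  smooth_at p (vf_in c (gamma X)).
Proof.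
move=> cp Xs; have s := smooth_at_pair (smooth_at_cst p (0 : E)) Xs.
apply: smooth_at_near_eq s.
exact: (open_near (@cbase_open _ _ _ c) cp (fun q cq => esym (gamma_in X ac cq))).
Qed.

Lemma rho_smooth p X : cbase c p -> smooth_at p (vf_in c X) ->
  smooth_at p (pvf_in c (rho X)).
Proof.
move=> cp Xs; apply: smooth_at_near_eq (smooth_at_fst Xs).
exact: (open_near (@cbase_open _ _ _ c) cp (fun q cq => esym (rho_in X ac cq))).
Qed.

Lemma derive_gamma p (X : pvfield M) v : cbase c p -> smooth_at p (pvf_in c X) ->
  'D_v (vf_in c (gamma X)) p = vert ('D_v (pvf_in c X) p).
Proof.
move=> cp Xs; have Xd := smooth_at_differentiable Xs.
apply: (etrans (derive_ext_on (@cbase_open _ _ _ c) v cp (fun q cq => gamma_in X ac cq))).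
by have D := derive_pair v (differentiable_cst (0 : E) p) Xd; rewrite derive_cst in D.
Qed.

Lemma lie_smooth p X Y : cbase c p -> smooth_at p (vf_in c X) -> smooth_at p (vf_in c Y) ->
  smooth_at p (vf_in c (lie X Y)).
Proof.
move=> cp Xs Ys.
have s := smooth_atB (smooth_at_derive_field findim_EE Ys Xs)
  (smooth_at_derive_field findim_EE Xs Ys).
apply: smooth_at_near_eq s.
have nX := smooth_at_near Xs; have nY := smooth_at_near Ys.
have nC := open_near (@cbase_open _ _ _ c) cp (fun q (cq : cbase c q) => cq).
apply: filterS (filterI nX (filterI nY nC)) => q [Xq [Yq cq]].
exact: (esym (lie_in ac cq Xq Yq)).
Qed.

Lemma NlN p a : A p -> Nl g (- a) p = - Nl g a p.
Proof.
move=> Ap; have gd := smooth_at_differentiable (spray_coef_smooth Ap).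
rewrite /Nl vertN; apply: (etrans (congr1 (fun x => - 2^-1 *: x) (derive_dirN _ gd))).
exact: scalerN.
Qed.

Lemma regroup_berwald (dvz dhz nb nv : E) :
  dvz + (dhz + (nv + nb) + - nv) = dvz + dhz + nb.
Proof. by apply/rowP => i; rewrite !mxE; ring. Qed.

(** Split [X] as [vert k + hl g a p]. The vertical half of the definition gives the derivative of
    [Y] along [vert k]. The horizontal half gives the derivative along [hl] and the term in [Gm],
    once the two terms with a derivative of [rho X] inside [Nl] have cancelled. The two derivatives
    add up to the one along [X]. *)
Lemma berwald_in p X (Y : pvfield M) : A p ->
  smooth_at p (vf_in c X) -> smooth_at p (pvf_in c Y) ->
  pvf_in c (berwald G X Y) p = cov g (vf_in c X) (pvf_in c Y) p.
Proof.
move=> Ap Xs Ys; have cp := sdom_cbase Ap.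
have Ks := Kmap_smooth Ap Xs; have bY := beta_smooth Ap Ys.
have gK := gamma_smooth cp Ks; have rX := rho_smooth cp Xs.
have bX := beta_smooth Ap rX; have gY := gamma_smooth cp Ys.
have Yd := smooth_at_differentiable Ys.
set a := (vf_in c X p).1; set b := pvf_in c Y p; set k := (vf_in c X p).2 + Nl g a p.
have T1 : pvf_in c (rho (lie (gamma (Kmap G X)) (beta G Y))) p = 'D_(vert k) (pvf_in c Y) p.
  apply: (etrans (rho_in _ ac cp)).
  have L := lie_in ac cp gK bY.
  have D1 := derive_beta (vf_in c (gamma (Kmap G X)) p) Ap Ys.
  have D2 := derive_gamma (vf_in c (beta G Y) p) cp Ks.
  apply: (etrans (congr1 fst (etrans L (congr2 (fun x y => x - y) D1 D2)))).
  apply: (etrans (subr0 _)).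
  apply: (congr1 (fun v => 'D_v (pvf_in c Y) p)).
  exact: (etrans (gamma_in _ ac cp) (congr1 vert (Kmap_in Ap Xs))).
have T2 : pvf_in c (Kmap G (lie (beta G (rho X)) (gamma Y))) p =
    'D_(hl g a p) (pvf_in c Y) p + (Nl g ('D_(vert b) (pvf_in c (rho X)) p) p + Gm g a b p)
    + - Nl g ('D_(vert b) (pvf_in c (rho X)) p) p.
  apply: (etrans (Kmap_in Ap (lie_smooth cp bX gY))).
  have L := lie_in ac cp bX gY.
  have E1 : vf_in c (beta G (rho X)) p = hl g a p.
    by apply: (etrans (beta_in _ Ap)); apply: (congr1 (fun x => hl g x p)); exact: rho_in.
  have E2 : vf_in c (gamma Y) p = vert b := gamma_in Y ac cp.
  have D1 := derive_gamma (hl g a p) cp Ys.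
  have D2 := derive_beta (vert b) Ap rX.
  have E3 : pvf_in c (rho X) p = a := rho_in X ac cp.
  have D2' := etrans D2 (congr1 (fun x => (_, - (_ + 'D_(vert b) (Nl g x) p))) E3).
  have L' := etrans (etrans L (congr2 (fun v w => 'D_v (vf_in c (gamma Y)) p
    - 'D_w (vf_in c (beta G (rho X))) p) E1 E2)) (congr2 (fun x y => x - y) D1 D2').
  apply: (etrans (congr1 (fun x : EE => x.2 + Nl g x.1 p) L')) => /=.
  apply: (congr2 (fun x y => x + y)).
    exact: (congr1 (fun x => _ + x) (opprK _)).
  apply: (etrans (congr1 (fun x => Nl g x p) (sub0r _))).
  exact: NlN.
have XE : vf_in c X p = vert k + hl g a p.
  rewrite -[RHS]/(0 + a, k - Nl g a p) add0r addrK /a.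
  exact: surjective_pairing.
apply: (etrans (pvf_inD _ _ ac cp)).
apply: (etrans (congr2 (fun x y => x + y) T1 T2)).
apply: (etrans (regroup_berwald _ _ _ _)).
rewrite /cov -/a -/b XE; apply: (congr1 (fun x => x + _)).
exact: (esym (derive_dirD _ _ Yd)).
Qed.


Lemma berwald_smooth p X (Y : pvfield M) : A p ->
  smooth_at p (vf_in c X) -> smooth_at p (pvf_in c Y) ->
  smooth_at p (pvf_in c (berwald G X Y)).
Proof.
move=> Ap Xs Ys; apply: smooth_at_near_eq (cov_smooth oA spray_coef_smooth Ap Xs Ys).
have nA := open_near oA Ap (fun q (Aq : A q) => Aq).
apply: filterS (filterI (smooth_at_near Xs) (filterI (smooth_at_near Ys) nA)).
by move=> q [Xq [Yq Aq]]; exact: (esym (berwald_in Aq Xq Yq)).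
Qed.

Lemma berwald2_in p V W (Z : pvfield M) : A p ->
  smooth_at p (vf_in c V) -> smooth_at p (vf_in c W) -> smooth_at p (pvf_in c Z) ->
  pvf_in c (berwald G V (berwald G W Z)) p =
  cov g (vf_in c V) (cov g (vf_in c W) (pvf_in c Z)) p.
Proof.
move=> Ap Vs Ws Zs; apply: (etrans (berwald_in Ap Vs (berwald_smooth Ap Ws Zs))).
rewrite /cov (berwald_in Ap Ws Zs); apply: (congr1 (fun x => x + _)).
(* The outer connection differentiates the inner field, so the formula for the latter is needed on a
   neighbourhood of [p], where [W] and [Z] are still smooth. *)
apply: near_eq_derive; have nA := open_near oA Ap (fun q (Aq : A q) => Aq).
apply: filterS (filterI (smooth_at_near Ws) (filterI (smooth_at_near Zs) nA)).
by move=> q [Wq [Zq Aq]]; exact: (berwald_in Aq Wq Zq).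
Qed.

Lemma Rcirc_in p (X Y Z : pvfield M) : A p -> smooth_at p (pvf_in c X) ->
  smooth_at p (pvf_in c Y) -> smooth_at p (pvf_in c Z) ->
  pvf_in c (Rcirc G X Y Z) p = Rl g (pvf_in c X p) (pvf_in c Y p) (pvf_in c Z p) p.
Proof.
move=> Ap Xs Ys Zs; have cp := sdom_cbase Ap.
have Vs := beta_smooth Ap Xs; have Ws := beta_smooth Ap Ys.
set V := beta G X in Vs; set W := beta G Y in Ws.
have Us := lie_smooth cp Vs Ws; have L := lie_in ac cp Vs Ws.
have E1 := berwald2_in Ap Vs Ws Zs; have E2 := berwald2_in Ap Ws Vs Zs.
have E3 := berwald_in Ap Us Zs.
have C := cov_curvature oA spray_coef_smooth Ap Vs Ws Zs L.
apply: (etrans (pvf_inD _ _ ac cp)); apply: (etrans (congr2 (fun x y => x + y)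
  (etrans (pvf_inD _ _ ac cp) (congr2 (fun x y => x + y)
    (etrans (pvf_inN _ ac cp) (congr1 -%R E1)) E2)) E3)).
apply: (etrans C).
have -> : vf_in c V p = hl g (pvf_in c X p) p := beta_in X Ap.
have -> : vf_in c W p = hl g (pvf_in c Y p) p := beta_in Y Ap.
apply: (congr1 -%R); apply: esym.
exact: (derive_Hc_vert spray_coef_smooth (pvf_in c X p) (pvf_in c Y p) (pvf_in c Z p) Ap).
Qed.

(** * Traces, vertical derivatives and the Weyl tensor in a chart *)

Lemma eta_smooth p : cbase c p -> smooth_at p (pvf_in c (eta : pvfield M)).
Proof.
move=> cp; apply: smooth_at_near_eq (smooth_at_psnd p).
exact: (open_near (@cbase_open _ _ _ c) cp (fun q cq => esym (eta_in ac cq))).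
Qed.

Lemma frame_smooth d p i : overlap c d p -> smooth_at p (pvf_in c (frame d i)).
Proof.
move=> o; have o' := overlap_sym o; have [ad _ dp _] := o'.
have s := pvf_lift_smooth ad dp (smooth_at_cst (trans c d p) (delta_mx 0 i : E)).
by have := smooth_pvf_change o' s; rewrite (transKK o).
Qed.

Lemma frame_in d p i : overlap c d p ->
  pvf_in c (frame d i) p = 'D_(delta_mx 0 i) (c \o cinv d) (trans c d p).1.
Proof.
move=> o; have o' := overlap_sym o; have [ad _ dp _] := o'.
have C := pvf_in_change (frame d i) o'; rewrite (transKK o) in C; apply: (etrans C).
exact: (congr1 (fun w => 'D_w _ _) (pvf_lift_in (fun=> delta_mx 0 i) ad dp)).
Qed.

Lemma trace_conj (S T L : E -> E) : linear S -> linear T -> linear L ->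
  (forall w, T (S w) = w) ->
  \sum_(i < n) S (L (T (delta_mx 0 i))) 0 i = \sum_(i < n) L (delta_mx 0 i) 0 i.
Proof.
move=> Sl Tl Ll TS.
pose S' : {linear E -> E} := HB.pack S (GRing.isLinear.Build _ _ _ _ _ Sl).
pose T' : {linear E -> E} := HB.pack T (GRing.isLinear.Build _ _ _ _ _ Tl).
pose L' : {linear E -> E} := HB.pack L (GRing.isLinear.Build _ _ _ _ _ Ll).
have trE (f : E -> E) (B : 'M[R]_n) : (forall v, f v = v *m B) ->
    \sum_(i < n) f (delta_mx 0 i) 0 i = \tr B.
  by move=> fB; apply: eq_bigr => i _; rewrite fB -rowE mxE.
have SE v : S v = v *m lin1_mx S' by rewrite mul_rV_lin1.
have TE v : T v = v *m lin1_mx T' by rewrite mul_rV_lin1.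
have LE v : L v = v *m lin1_mx L' by rewrite mul_rV_lin1.
rewrite (trE (fun v => S (L (T v))) (lin1_mx T' *m (lin1_mx L' *m lin1_mx S'))); last first.
  by move=> v; rewrite SE LE TE !mulmxA.
rewrite (trE L _ LE) mxtrace_mulC -mulmxA.
suff -> : lin1_mx S' *m lin1_mx T' = 1%:M by rewrite mulmx1.
apply/row_matrixP => i; rewrite row_mul !rowE mulmx1.
by rewrite -SE -TE TS.
Qed.

Lemma derive_trH_sum p a b : A p ->
  \sum_(i < n) Rl g a (delta_mx 0 i) b p 0 i = - 'D_(vert b) (trH g a) p.
Proof.
move=> Ap; have Hd i := smooth_at_differentiable (Hc_smooth spray_coef_smooth a (delta_mx 0 i) Ap).
have cd i : differentiable (fun q => Hc g a (delta_mx 0 i) q 0 i : R^o) p.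
  exact: (differentiable_comp (Hd i) (clin_differentiable (coord_linear i) (@coord_cont _ _ i) _)).
have D := derive_sum_fin (vert b) cd.
apply: esym; apply: (etrans (congr1 -%R D)); rewrite -sumrN; apply: eq_bigr => i _.
rewrite /Rl mxE; apply: (congr1 -%R).
exact: (clin_derive_comp (coord_linear i) (@coord_cont _ _ i) (vert b) (Hd i)).
Qed.

Lemma Rl_linear p a b : A p -> linear (fun e => Rl g a e b p).
Proof.
move=> Ap; have F : smooth_family_on A (Hc g a).
  split=> [e|q Aq s x y /=]; first exact: (Hc_smooth spray_coef_smooth).
  (* Antisymmetry of [Hc] in its two vector arguments carries linearity over from the first to the
     second. *)
  have HN e : Hc g a e q = - Hc g e a q by exact: (esym (opprB _ _)).
  have [_ Hl] := Hc_family oA spray_coef_smooth a.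
  rewrite !HN (Hl q Aq) opprD scalerN; reflexivity.
have [_ Dl] := smooth_family_on_derive_in oA (vert b) F.
move=> s x y; rewrite /Rl; apply: (etrans (congr1 -%R (Dl p Ap s x y))).
by apply: (etrans (opprD _ _)); apply: (congr1 (fun x => x + _)); exact: (esym (scalerN _ _)).
Qed.

(** [trace] uses the frame of the chart [d] selected at the base point, while the curvature is
    expressed in [c]. The two endomorphisms are conjugate by the Jacobian [S] of the transition and
    its inverse [T], which does not affect the trace. *)
Lemma R2_in p (X Y : pvfield M) : A p -> smooth_at p (pvf_in c X) ->
  smooth_at p (pvf_in c Y) ->
  R2 G X Y (tinv c p) = - 'D_(vert (pvf_in c Y p)) (trH g (pvf_in c X p)) p.
Proof.
move=> Ap Xs Ys; have cp := sdom_cbase Ap; have o := overlap_chart_at ac cp.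
set d := chart_at (tinv c p).1 in o *.
have [_ ad _ dp] := o; have [cx ce] := cinvK cp.
set a := pvf_in c X p; set b := pvf_in c Y p.
pose S (w : E) : E := 'D_w (d \o cinv c) p.1.
pose T (w : E) : E := 'D_w (c \o cinv d) (trans c d p).1.
apply: (etrans _ (derive_trH_sum a b Ap)).
have Sl : linear S.
  by move=> s x y; apply: derive_dirP; exact/smooth_at_differentiable/overlap_smooth.
have Tl : linear T.
  move=> s x y; apply: derive_dirP.
  exact/smooth_at_differentiable/overlap_smooth/overlap_sym.
have TS w : T (S w) = w.
  have C := transition_chain w ac ad ac cp dp cx.
  rewrite /T transE //; apply: (etrans C); exact: transition_id.
apply: (etrans _ (trace_conj Sl Tl (Rl_linear a b Ap) TS)).
rewrite /R2 /trace -/d; apply: eq_bigr => i _; apply: (congr1 (fun w : E => w 0 i)).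
apply: (etrans (pvf_in_chart (Rcirc G X (frame d i) Y) ac cp)).
apply: (congr1 (fun w => 'D_w (d \o cinv c) p.1)).
apply: (etrans (Rcirc_in Ap Xs (frame_smooth i o) Ys)).
exact: (congr1 (fun e => Rl g a e b p) (frame_in i o)).
Qed.

Lemma R1_in p (X : pvfield M) : A p -> smooth_at p (pvf_in c X) ->
  R1 G X (tinv c p) = R1l g (pvf_in c X p) p.
Proof.
move=> Ap Xs; have cp := sdom_cbase Ap; have es := eta_smooth cp.
have E1 := R2_in Ap Xs es; have E2 := R2_in Ap es Xs.
rewrite (eta_in ac cp) in E1 E2.
rewrite /R1; apply: (etrans (congr2 (fun x y => _ * (_ * x + y)) E1 E2)).
by rewrite mulrN -opprD mulrN.
Qed.

Lemma form_smooth p (X : pvfield M) : A p -> smooth_at p (pvf_in c X) ->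
  smooth_at p (fun q => R1l g (pvf_in c X q) q).
Proof.
move=> Ap Xs.
exact: (smooth_family_field findim_E
  (smooth_family_on_at oA (R1l_family oA spray_coef_smooth) Ap) Xs).
Qed.

Lemma R1_near p (X : pvfield M) : A p -> smooth_at p (pvf_in c X) ->
  \forall q \near p, R1l g (pvf_in c X q) q = (R1 G X \o tinv c : EE -> R^o) q.
Proof.
move=> Ap Xs; have nA := open_near oA Ap (fun q (Aq : A q) => Aq).
apply: filterS (filterI (smooth_at_near Xs) nA) => q [Xq Aq].
exact: (esym (R1_in Aq Xq)).
Qed.

(** [Gm] sees only the horizontal component, which is 0 here: along the fibres the Berwald
    connection is plain coordinate differentiation. *)
Lemma berwald_vertical p (X Y : pvfield M) : A p ->
  smooth_at p (pvf_in c X) -> smooth_at p (pvf_in c Y) ->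
  pvf_in c (berwald G (gamma X) Y) p = 'D_(vert (pvf_in c X p)) (pvf_in c Y) p.
Proof.
move=> Ap Xs Ys; have cp := sdom_cbase Ap.
apply: (etrans (berwald_in Ap (gamma_smooth cp Xs) Ys)).
have gX : vf_in c (gamma X) p = vert (pvf_in c X p) := gamma_in X ac cp.
rewrite /cov gX; apply: (etrans _ (addr0 _)); apply: (congr1 (fun x => _ + x)).
have [_ Gl] := Gm_family1 oA spray_coef_smooth (pvf_in c Y p).
have := Gl p Ap (-1) 0 0; rewrite scaler0 addr0 scaleN1r addNr; exact.
Qed.

Lemma regroup_D1 (x y : R) : x + y - x = y.
Proof. by ring. Qed.

(** The Leibniz rule produces a term in which [Y] is differentiated; it equals the correction by the
    Berwald derivative of [Y] and cancels, so only the derivative with frozen arguments is left.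
    [D2_2_in] repeats this with two arguments. *)
Lemma D2_1_in p (X Y : pvfield M) : A p ->
  smooth_at p (pvf_in c X) -> smooth_at p (pvf_in c Y) ->
  D2_1 G (R1 G) X Y (tinv c p) = D2R1l g (pvf_in c X p) (pvf_in c Y p) p.
Proof.
move=> Ap Xs Ys; have cp := sdom_cbase Ap.
have nR := R1_near Ap Ys; have Rs := smooth_at_near_eq nR (form_smooth Ap Ys).
have D := der_in (gamma X) ac cp Rs.
have gX : vf_in c (gamma X) p = vert (pvf_in c X p) := gamma_in X ac cp.
have D1 : der (gamma X) (R1 G Y) (tinv c p) =
    'D_(vert (pvf_in c X p)) (fun q => R1l g (pvf_in c Y q) q) p.
  apply: (etrans D); rewrite gX; apply: near_eq_derive.
  by apply: filterS nR => q H; exact: esym H.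
have F := smooth_family_on_at oA (R1l_family oA spray_coef_smooth) Ap.
have D2 := derive_family (vert (pvf_in c X p)) findim_E F (smooth_at_differentiable Ys).
have gs := gamma_smooth cp Xs.
have E := R1_in Ap (berwald_smooth Ap gs Ys).
have E' := etrans E (congr1 (fun a => R1l g a p) (berwald_vertical Ap Xs Ys)).
apply: (etrans (congr2 (fun x y => x - y) (etrans D1 D2) E')).
exact: regroup_D1.
Qed.

Lemma D2R1l_family2 p : A p -> smooth_family2 p (D2R1l g).
Proof.
move=> Ap; have F := R1l_family oA spray_coef_smooth; have [Fs Fl] := F.
split=> [a b|]; first exact: smooth_at_derive (Fs b p Ap).
apply: (open_near oA Ap) => q Aq; split=> [b|a].
  move=> s x y; rewrite /D2R1l vert_linear; apply: derive_dirP.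
  exact: smooth_at_differentiable (Fs b q Aq).
by have [_ Dl] := smooth_family_on_derive_in oA (vert a) F; exact: Dl.
Qed.

Lemma D2_1_near p (X Y : pvfield M) : A p ->
  smooth_at p (pvf_in c X) -> smooth_at p (pvf_in c Y) ->
  \forall q \near p, D2R1l g (pvf_in c X q) (pvf_in c Y q) q =
    (D2_1 G (R1 G) X Y \o tinv c : EE -> R^o) q.
Proof.
move=> Ap Xs Ys; have nA := open_near oA Ap (fun q (Aq : A q) => Aq).
apply: filterS (filterI (smooth_at_near Xs) (filterI (smooth_at_near Ys) nA)).
by move=> q [Xq [Yq Aq]]; exact: (esym (D2_1_in Aq Xq Yq)).
Qed.

Lemma regroup_D2 (x y z : R) : x + y + z - x - y = z.
Proof. by ring. Qed.

Lemma D2_2_in p (X Y Z : pvfield M) : A p -> smooth_at p (pvf_in c X) ->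
  smooth_at p (pvf_in c Y) -> smooth_at p (pvf_in c Z) ->
  D2_2 G (D2_1 G (R1 G)) X Y Z (tinv c p) =
  'D_(vert (pvf_in c X p)) (D2R1l g (pvf_in c Y p) (pvf_in c Z p)) p.
Proof.
move=> Ap Xs Ys Zs; have cp := sdom_cbase Ap.
have F := D2R1l_family2 Ap.
have nR := D2_1_near Ap Ys Zs.
have Rs := smooth_at_near_eq nR (smooth_family2_field findim_E findim_E F Ys Zs).
have D := der_in (gamma X) ac cp Rs.
have gX : vf_in c (gamma X) p = vert (pvf_in c X p) := gamma_in X ac cp.
have D1 : der (gamma X) (D2_1 G (R1 G) Y Z) (tinv c p) =
    'D_(vert (pvf_in c X p)) (fun q => D2R1l g (pvf_in c Y q) (pvf_in c Z q) q) p.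
  apply: (etrans D); rewrite gX; apply: near_eq_derive.
  by apply: filterS nR => q H; exact: esym H.
have D2 := derive_family2 (vert (pvf_in c X p)) findim_E findim_E F Ys Zs.
have gs := gamma_smooth cp Xs.
have E1 := D2_1_in Ap (berwald_smooth Ap gs Ys) Zs.
have E2 := D2_1_in Ap Ys (berwald_smooth Ap gs Zs).
have E1' := etrans E1 (congr1 (fun a => D2R1l g a _ p) (berwald_vertical Ap Xs Ys)).
have E2' := etrans E2 (congr1 (fun a => D2R1l g _ a p) (berwald_vertical Ap Xs Zs)).
apply: (etrans (congr2 (fun x y => x - y) (congr2 (fun x y => x - y) (etrans D1 D2) E1') E2')).
exact: regroup_D2.
Qed.

Lemma weyl_in p (X Y Z : pvfield M) : A p -> smooth_at p (pvf_in c X) ->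
  smooth_at p (pvf_in c Y) -> smooth_at p (pvf_in c Z) ->
  pvf_in c (weyl G X Y Z) p = weyll g (pvf_in c X p) (pvf_in c Y p) (pvf_in c Z p) p.
Proof.
move=> Ap Xs Ys Zs; have cp := sdom_cbase Ap.
pose F (X Y : pvfield M) : pvfield M := fun u => D2_1 G (R1 G) Z Y u *: X u
  + D2_1 G (R1 G) X Y u *: Z u + D2_2 G (D2_1 G (R1 G)) Z X Y u *: eta u.
have FE X' Y' : smooth_at p (pvf_in c X') -> smooth_at p (pvf_in c Y') ->
  pvf_in c (F X' Y') p =
  D2R1l g (pvf_in c Z p) (pvf_in c Y' p) p *: pvf_in c X' p
  + D2R1l g (pvf_in c X' p) (pvf_in c Y' p) p *: pvf_in c Z p
  + 'D_(vert (pvf_in c Z p)) (D2R1l g (pvf_in c X' p) (pvf_in c Y' p)) p *: p.2.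
  move=> Xs' Ys'; apply: (etrans (pvf_inD _ _ ac cp)); apply: (congr2 (fun x y => x + y)).
    apply: (etrans (pvf_inD _ _ ac cp)); apply: (congr2 (fun x y => x + y)).
      apply: (etrans (pvf_inZ _ _ ac cp)).
      exact: (congr1 (fun s => s *: pvf_in c X' p) (D2_1_in Ap Zs Ys')).
    apply: (etrans (pvf_inZ _ _ ac cp)).
    exact: (congr1 (fun s => s *: pvf_in c Z p) (D2_1_in Ap Xs' Ys')).
  apply: (etrans (pvf_inZ _ _ ac cp)).
  exact: (congr2 (fun (s : R) (w : E) => s *: w) (D2_2_in Ap Zs Xs' Ys') (eta_in ac cp)).
apply: (etrans (pvf_inD _ _ ac cp)); apply: (congr2 (fun x y => x + y)).
  exact: Rcirc_in.
apply: (etrans (pvf_inZ (fun=> (n%:R + 1)^-1) _ ac cp)).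
apply: (congr1 (fun w => (n%:R + 1)^-1 *: w)).
apply: (etrans (pvf_inD (F X Y) (fun u => - F Y X u) ac cp)).
apply: (congr2 (fun x y => x + y)); first exact: FE.
apply: (etrans (pvf_inN _ ac cp)); apply: (congr1 -%R); exact: FE.
Qed.

End Operators.

(** Homogeneity makes [f (x, (1 + t) y)] affine in [t] as long as [1 + t > 0], hence near 0, with
    slope the value of [f] itself. *)
Lemma homogeneous_euler c p (f : TM M -> R) : atlas c -> sdom c p ->
  homogeneous1 f -> smooth_at p (f \o tinv c : EE -> R^o) ->
  'D_(vert p.2) (f \o tinv c : EE -> R^o) p = f (tinv c p).
Proof.
move=> ac Ap fh fs; have [cp _] := Ap.
have [_ ac' _ _] := overlap_chart_at ac cp; have [cx _] := cinvK cp.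
have td := tchange_differentiable ac ac' cx (chart_at_dom _).
have H (t : R) : 0 < 1 + t -> f (tinv c (p + t *: vert p.2)) = f (tinv c p) + t * f (tinv c p).
  move=> t0; rewrite -[X in _ = X + _]mul1r -mulrDl -fh //; apply: (congr1 f).
  have -> : p + t *: vert p.2 = (p.1, (1 + t) *: p.2).
    rewrite scalerDl scale1r -[LHS]/(p.1 + t *: 0, p.2 + t *: p.2).
    by rewrite scaler0 addr0.
  apply: (congr1 (pair (cinv c p.1))).
  exact: (derive_dirZ (1 + t) p.2 td).
have fd : differentiable (f \o tinv c : EE -> R^o) (p + 0 *: vert p.2).
  by rewrite scale0r addr0; exact: smooth_at_differentiable.
have [_ D] := is_derive_line fd.
rewrite scale0r addr0 in D; apply: (etrans (esym D)).
apply: (etrans _ (derive_affine (f (tinv c p) : R^o) (f (tinv c p)))).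
apply: near_eq_derive; near=> t; apply: H.
by rewrite -ltrBlDl sub0r; near: t; apply: lt_nbhsr; rewrite ltrN10.
Unshelve. all: by end_near. Qed.

Lemma regroup_energy (x : R) : 2^-1 * (x * x + x * x) = 2 * (2^-1 * (x * x)).
Proof. by field. Qed.

Lemma regroup_Omega (x y z t : R) : (x + z) - (y + t) - (x - y) = z - t.
Proof. by ring. Qed.

Lemma regroup_vert_energy (x : R) : 2 * x - x = 1 * x.
Proof. by ring. Qed.

Lemma regroup_fst (z x d x' y : R) :
  z - x = - d -> z = 0 -> x = x' -> y = 1 * d -> x' - y = 0.
Proof. by move=> *; lra. Qed.

Lemma regroup_horizontal (x y z t : R) : x - y = - z -> y = 2 * z - t -> t = 0 -> x = z.
Proof. by move=> *; lra. Qed.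

Lemma regroup_euler (dg x f0 h z gf v1 c v2 : R) :
  dg + c = f0 -> f0 = 2 * h - z -> z = 0 -> gf = h -> dg = gf + v1 ->
  x = c -> x = 1 * gf - v2 -> v1 - v2 = 0.
Proof. by move=> *; lra. Qed.

(** * The canonical spray *)

Section CanonicalSpray.
Variables (L : TM M -> R) (c : chart R n M).
Hypotheses (FL : finsler L) (ac : atlas c).

Let A := sdom c.
Let oA : open A := @sdom_open c.
Let e : EE -> R^o := energy L \o tinv c.
Let fR : findim R^o := findim_regular.

Lemma norm_smooth p : A p -> smooth_at p (L \o tinv c : EE -> R^o).
Proof.
move=> Ap; have [cp _] := Ap; apply: smooth_fun_near_in => //.
by apply: (finsler_smooth FL); exact: slit_tinv.
Qed.

Lemma energyE q : e q = 2^-1 *: ((L \o tinv c : EE -> R^o) q *: (L \o tinv c : EE -> R^o) q).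
Proof. by rewrite /e /= /energy expr2. Qed.

Lemma energy_smooth : smooth_on A e.
Proof.
move=> p Ap; have s := norm_smooth Ap.
apply: smooth_at_near_eq (smooth_atZ 2^-1 (smooth_at_scale s s)).
by apply: (open_near oA Ap) => q _; exact: esym (energyE q).
Qed.

Lemma energy_euler p : A p -> 'D_(vert p.2) e p = 2 *: e p.
Proof.
move=> Ap; have s := norm_smooth Ap; have d := smooth_at_differentiable s.
have E := homogeneous_euler ac Ap (finsler_homogeneous FL) s.
have D1 := derive_scalev (vert p.2) d d.
have D2 := deriveZ (2^-1 : R) (diff_derivable (v := vert p.2) (differentiable_scalev d d)).
rewrite D1 E in D2; apply: (etrans (derive_ext_on oA _ Ap (fun q _ => energyE q))).
apply: (etrans D2); rewrite energyE; exact: regroup_energy.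
Qed.

Lemma dJ_in q (Y : vfield M) : A q ->
  dJ (energy L) Y (tinv c q) = 'D_(vert (vf_in c Y q).1) e q.
Proof.
move=> Aq; have [cq _] := Aq; have D := der_in (J Y) ac cq (energy_smooth Aq).
apply: (etrans D); exact: (congr1 (fun v => 'D_v e q) (J_in Y ac cq)).
Qed.

Lemma der_dJ_in p (X Y : vfield M) : A p -> smooth_at p (vf_in c Y) ->
  der X (dJ (energy L) Y) (tinv c p) =
  'D_(vert ('D_(vf_in c X p) (vf_in c Y) p).1) e p
  + 'D_(vf_in c X p) ('D_(vert (vf_in c Y p).1) e) p.
Proof.
move=> Ap Ys; have [cp _] := Ap; have Yd := smooth_at_differentiable Ys.
have Y1s := smooth_at_fst Ys; have Y1d := smooth_at_differentiable Y1s.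
have vs := smooth_at_pair (smooth_at_cst p (0 : E)) Y1s.
have vd := smooth_at_differentiable vs.
have s := smooth_at_derive_field findim_EE (energy_smooth Ap) vs.
have nE : \forall q \near p, 'D_(vert (vf_in c Y q).1) e q =
    (dJ (energy L) Y \o tinv c : EE -> R^o) q.
  by apply: (open_near oA Ap) => q Aq; exact: (esym (dJ_in Y Aq)).
have D := der_in X ac cp (smooth_at_near_eq nE s); apply: (etrans D).
have nE' : \forall q \near p, (dJ (energy L) Y \o tinv c : EE -> R^o) q =
    'D_(vert (vf_in c Y q).1) e q.
  by apply: (open_near oA Ap) => q Aq; exact: (dJ_in Y Aq).
apply: (etrans (near_eq_derive _ nE')).
have D1 := derive_derive_field (vf_in c X p) findim_EE fR (energy_smooth Ap) vd.
apply: (etrans D1); apply: (congr2 (fun x y => x + y)); last first.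
  exact: (derive_comm _ _ fR (energy_smooth Ap)).
apply: (congr1 (fun v => 'D_v e p)).
apply: (etrans (derive_pair _ (differentiable_cst (0 : E) p) Y1d)).
by rewrite derive_cst; apply: (congr1 (pair 0)); exact: derive_fst.
Qed.

(** The derivatives of the components of [X] and [Y] assemble into the value of [dJ] on the bracket,
    which the exterior differential subtracts; only second derivatives of the energy remain. *)
Lemma Omega_in p (X Y : vfield M) : A p ->
  smooth_at p (vf_in c X) -> smooth_at p (vf_in c Y) ->
  Omega L X Y (tinv c p) =
  'D_(vf_in c X p) ('D_(vert (vf_in c Y p).1) e) p
  - 'D_(vf_in c Y p) ('D_(vert (vf_in c X p).1) e) p.
Proof.
move=> Ap Xs Ys; have [cp _] := Ap.
have ed := smooth_at_differentiable (energy_smooth Ap).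
have E1 := der_dJ_in X Ap Ys; have E2 := der_dJ_in Y Ap Xs.
have E3 := dJ_in (lie X Y) Ap; have Lie := lie_in ac cp Xs Ys.
have E3' := etrans E3 (congr1 (fun v : EE => 'D_(vert v.1) e p) Lie).
have E4 (x y : E) : 'D_(vert (x - y)) e p = 'D_(vert x) e p - 'D_(vert y) e p.
  by rewrite vertD vertN; exact: derive_dirB.
apply: (etrans (congr2 (fun x y => x - y) (congr2 (fun x y => x - y) E1 E2)
  (etrans E3' (E4 _ _)))).
exact: regroup_Omega.
Qed.

Let cvf (v : EE) : vfield M := vf_lift c (fun=> v).

Lemma cvf_in v p : A p -> vf_in c (cvf v) p = v.
Proof. by move=> [cp _]; exact: (vf_lift_in (fun=> v) ac cp). Qed.

Lemma cvf_smooth v p : A p -> smooth_at p (vf_in c (cvf v)).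
Proof. by move=> [cp _]; exact: (vf_lift_smooth ac cp (smooth_at_cst p v)). Qed.

Lemma derive_vert0 v p : A p -> 'D_v ('D_(vert 0) e) p = 0.
Proof.
move=> Ap; apply: (etrans _ (derive_cst (0 : R^o) p v)).
by apply: (derive_ext_on oA v Ap) => q Aq; exact: derive0.
Qed.

(** For a vertical vector the second term of [Omega_in] vanishes, and [Omega] pairs [w] with the
    first component of [Y] through the fibre Hessian of the energy. Nondegeneracy of [Omega]
    therefore gives that of the Hessian. *)
Lemma nondegenerate p (w : E) : A p ->
  (forall a, 'D_(vert w) ('D_(vert a) e) p = 0) -> w = 0.
Proof.
move=> Ap H; have [cp _] := Ap.
have X0 : cvf (vert w) (tinv c p) = 0.
  apply: (finsler_nondegenerate FL); first exact: slit_tinv.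
    exact: (smooth_vf_in_near ac cp (cvf_smooth _ Ap)).
  move=> Y Ys; have Ys' := smooth_vf_near_in ac cp Ys.
  apply: (etrans (Omega_in Ap (cvf_smooth _ Ap) Ys')); rewrite (cvf_in _ Ap).
  apply: (etrans (congr2 (fun x y => x - y) (H _) (derive_vert0 _ Ap))).
  exact: subrr.
have V0 : vf_in c (cvf (vert w)) p = 0.
  by rewrite vf_inE X0; exact: derive0.
exact: (congr1 snd (etrans (esym (cvf_in (vert w) Ap)) V0)).
Qed.

Variable G : vfield M.
Hypothesis LG : canonical_spray L G.

Lemma canonical_in p (v : EE) : A p ->
  'D_(vf_in c G p) ('D_(vert v.1) e) p - 'D_v ('D_(vert (vf_in c G p).1) e) p = - 'D_v e p.
Proof.
move=> Ap; have [cp _] := Ap; have [Gs GL] := LG.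
have Ys := cvf_smooth v Ap.
have H := GL _ (slit_tinv ac Ap) _ (smooth_vf_in_near ac cp Ys).
have D := der_in (cvf v) ac cp (energy_smooth Ap).
have O := Omega_in Ap (smooth_vf_in ac Ap Gs) Ys.
rewrite (cvf_in _ Ap) in D O; apply: (etrans (esym O)); apply: (etrans H).
exact: (congr1 -%R D).
Qed.

Lemma euler_vert_energy a p : A p ->
  'D_(vert p.2) ('D_(vert a) e) p = 1 *: 'D_(vert a) e p.
Proof.
move=> Ap; apply: (etrans (euler_derive oA (vert a) fR energy_smooth energy_euler Ap)).
exact: regroup_vert_energy.
Qed.

(** Tested on [(0, a)], the spray equation says that the fibre Hessian pairs the first component of
    [G] with [a] to ['D_(vert a) e]. By Euler's relation for ['D_(vert a) e], of degree 1, [y] has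
    the same pairings. *)
Lemma canonical_fst p : A p -> (vf_in c G p).1 = p.2.
Proof.
move=> Ap; apply/eqP; rewrite -subr_eq0; apply/eqP; apply: (nondegenerate Ap) => a.
have H := canonical_in (vert a) Ap.
have C := derive_comm (vert a) (vert (vf_in c G p).1) fR (energy_smooth Ap).
have Eu := euler_vert_energy a Ap.
have ed := smooth_at_differentiable (smooth_at_derive (vert a) (energy_smooth Ap)).
rewrite vertD vertN; apply: (etrans (derive_dirB _ _ ed)).
exact: (regroup_fst H (derive_vert0 _ Ap) C Eu).
Qed.

Let g p : E := (vf_in c G p).2.

Lemma canonical_E p : A p -> vf_in c G p = (p.2, g p).
Proof.
move=> Ap; rewrite [LHS]surjective_pairing; apply: (congr1 (pair^~ _)).
exact: canonical_fst.
Qed.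

(** This is the Euler-Lagrange equation, obtained by testing on [(a, 0)]: since the energy has
    degree 2, the subtracted term is twice the base derivative of the energy, and one copy is
    left. *)
Lemma canonical_horizontal a p : A p ->
  'D_(vf_in c G p) ('D_(vert a) e) p = 'D_((a, 0)) e p.
Proof.
move=> Ap; have H := canonical_in (a, 0) Ap; rewrite (canonical_fst Ap) /= in H.
have C := derive_comm ((a, 0) : EE) (vert p.2) fR (energy_smooth Ap).
have Eu := euler_derive oA ((a, 0) : EE) fR energy_smooth energy_euler Ap.
have Z : 'D_(vert ((a, 0) : EE).2) e p = 0 by exact: derive0.
exact: (regroup_horizontal H (etrans C Eu) Z).
Qed.

(** The Euler-Lagrange equation is differentiated along [y]. Its right side has degree 2 and
    ['D_(vert a) e] has degree 1; what remains says that the Hessian pairs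
    ['D_(vert p.2) g p - 2 *: g p] to 0 with every [a]. *)
Lemma canonical_euler p : A p -> 'D_(vert p.2) g p = 2 *: g p.
Proof.
move=> Ap; apply/eqP; rewrite -subr_eq0; apply/eqP; apply: (nondegenerate Ap) => a.
have [Gs _] := LG; have Gd := smooth_at_differentiable (smooth_vf_in ac Ap Gs).
have fs : smooth_on A ('D_(vert a) e).
  by move=> q Aq; exact: smooth_at_derive (energy_smooth Aq).
have fd := smooth_at_differentiable (fs p Ap).
have DG : 'D_(vert p.2) (vf_in c G) p = (p.2, 'D_(vert p.2) g p).
  rewrite [LHS]surjective_pairing -(derive_snd _ Gd) -(derive_fst _ Gd).
  apply: (congr1 (pair^~ _)); apply: (etrans _ (derive_psnd (vert p.2) p)).
  by apply: (derive_ext_on oA _ Ap) => q Aq; exact: canonical_fst.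
have D1 := derive_derive_field (vert p.2) findim_EE fR (fs p Ap) Gd.
have D2 := derive_ext_on oA (vert p.2) Ap (fun q Aq => canonical_horizontal a Aq).
have C := derive_comm (vert p.2) (vf_in c G p) fR (fs p Ap).
have E1 := euler_derive oA (vf_in c G p) fR fs (fun q Aq => euler_vert_energy a Aq) Ap.
have E2 := euler_derive oA ((a, 0) : EE) fR energy_smooth energy_euler Ap.
have Z : 'D_(vert ((a, 0) : EE).2) e p = 0 by exact: derive0.
have H := canonical_horizontal a Ap.
have E3 : 'D_('D_(vert p.2) (vf_in c G) p) ('D_(vert a) e) p =
    'D_(vf_in c G p) ('D_(vert a) e) p
    + 'D_(vert ('D_(vert p.2) g p - g p)) ('D_(vert a) e) p.
  apply: (etrans _ (derive_dirD _ _ fd)); apply: (congr1 (fun v => 'D_v _ p)).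
  rewrite DG (canonical_E Ap) -[RHS]/(p.2 + 0, g p + ('D_(vert p.2) g p - g p)).
  by rewrite addr0 addrC subrK.
have E4 : 'D_(vert ('D_(vert p.2) g p - 2 *: g p)) ('D_(vert a) e) p =
    'D_(vert ('D_(vert p.2) g p - g p)) ('D_(vert a) e) p
    - 'D_(vert (vf_in c G p).2) ('D_(vert a) e) p.
  apply: (etrans _ (derive_dirB _ _ fd)); apply: (congr1 (fun v => 'D_v _ p)).
  rewrite -vertN -vertD -/(g p); apply: (congr1 vert).
  by rewrite scaler_nat mulr2n opprD addrA.
apply: (etrans E4).
exact: (regroup_euler (etrans (esym D1) D2) E2 Z H E3 C E1).
Qed.

End CanonicalSpray.

Lemma canonical_is_spray (L : TM M -> R) (G : vfield M) :
  finsler L -> canonical_spray L G -> is_spray G.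
Proof.
move=> FL LG; split=> [|c p ac Ap|c p ac Ap]; first by have [] := LG.
  exact: (canonical_fst FL ac LG Ap).
exact: (canonical_euler FL ac LG Ap).
Qed.

Lemma smooth_pvf_in c p (X : pvfield M) : atlas c -> sdom c p -> smooth_pvf X ->
  smooth_at p (pvf_in c X).
Proof.
move=> ac Ap Xs; have [cp _] := Ap; apply: smooth_pvf_near_in cp _ => //.
exact/Xs/slit_tinv.
Qed.

Lemma spray_coef_projective (G G' : vfield M) (lambda : TM M -> R) c p :
  (forall u, slit u -> G' u = G u - (2 * lambda u) *: Liouville u) ->
  atlas c -> sdom c p ->
  spray_coef G' c p = spray_coef G c p - 2 *: ((lambda \o tinv c : EE -> R^o) p *: p.2).
Proof.
move=> GG' ac Ap; have [cp _] := Ap; rewrite scalerA.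
have E1 : vf_in c G' p = vf_in c (fun u => G u - (2 * lambda u) *: Liouville u) p.
  by apply: vf_in_eq; exact/GG'/slit_tinv.
have E2 := vf_inB G (fun u => (2 * lambda u) *: Liouville u) ac cp.
have E3 := vf_inZ (fun u => 2 * lambda u) (Liouville : vfield M) ac cp.
have E4 := etrans E3 (congr1 (fun v => _ *: v) (Liouville_in ac cp)).
exact: (congr1 snd (etrans E1 (etrans E2 (congr1 (fun v => _ - v) E4)))).
Qed.

(** In the chart selected at [u], both Weyl tensors are [weyll] of the respective spray coefficients
    at the same three constant vectors, so the comparison reduces to [weyl_projective]. *)
Lemma weyl_is_projective (G G' : vfield M) (X Y Z : pvfield M) u : (1 < n)%N ->
  is_spray G -> is_spray G' -> projectively_related G G' ->
  smooth_pvf X -> smooth_pvf Y -> smooth_pvf Z -> slit u ->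
  weyl G' X Y Z u = weyl G X Y Z u.
Proof.
move=> n1 sG sG' [lambda [ls lh GG']] Xs Ys Zs su.
pose c := chart_at u.1; pose p := tcoord c u.
have ac : atlas c := chart_at_atlas _; have cu : cdom c u.1 := chart_at_dom _.
have Ap : sdom c p := sdom_tcoord ac cu su; have [cp _] := Ap.
have up : tinv c p = u := tinvK ac cu.
rewrite -up; apply: (@pvf_in_inj _ _ _ c p (weyl G' X Y Z) (weyl G X Y Z) ac cp).
have W G0 (s0 : is_spray G0) := weyl_in s0 ac Ap (smooth_pvf_in ac Ap Xs)
  (smooth_pvf_in ac Ap Ys) (smooth_pvf_in ac Ap Zs).
apply: (etrans (W G' sG')); apply: (etrans _ (esym (W G sG))).
pose lam : EE -> R^o := lambda \o tinv c.
have lams : smooth_on (sdom c) lam.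
  by move=> q Aq; have [cq _] := Aq; apply: smooth_fun_near_in => //; exact/ls/slit_tinv.
have El q : sdom c q -> 'D_(vert q.2) lam q = 1 *: lam q.
  move=> Aq; apply: (etrans (homogeneous_euler ac Aq lh (lams q Aq))).
  exact: (esym (scale1r _)).
have Eg q : sdom c q -> 'D_(vert q.2) (spray_coef G c) q = 2 *: spray_coef G c q.
  by move=> Aq; have [_ _ sE] := sG; exact: sE.
exact: (weyl_projective (@sdom_open c) (spray_coef_smooth sG ac) lams Eg El
  (fun q Aq => spray_coef_projective GG' ac Aq) _ _ _ n1 Ap).
Qed.

End SprayOperators.

Theorem theorem3p3 (R : realType) (n : nat) (M : manifold R n)
  (L L' : TM M -> R) (G G' : vfield M) :
  (2 < n)%N ->
  finsler L -> finsler L' ->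
  canonical_spray L G -> canonical_spray L' G' ->
  projectively_related G G' ->
  forall X Y Z : pvfield M,
    smooth_pvf X -> smooth_pvf Y -> smooth_pvf Z ->
    forall u : TM M, slit u -> weyl G' X Y Z u = weyl G X Y Z u.
Proof.
move=> n2 FL FL' LG LG' GG' X Y Z Xs Ys Zs u su.
exact: (weyl_is_projective (ltnW n2) (canonical_is_spray FL LG)
  (canonical_is_spray FL' LG') GG' Xs Ys Zs su).
Qed.
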